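(* Let $(\Gamma \rightrightarrows \Gamma_0, \vartheta,\omega,r)$ be a twisted contact groupoid with $\dim\Gamma = 2n+1$, source map $\alpha$, target map $\beta$, inversion $\iota$, unit section $\varepsilon$, and let $(A(\Gamma),[\cdot,\cdot],T\alpha)$ be its Lie algebroid. Let $(\Lambda_{\Gamma},E_{\Gamma},\omega)$ be the twisted Jacobi structure on $\Gamma$ defined by the twisted contact structure $(\vartheta,\omega)$. Then: i) $r$ is multiplicative, i.e. $r(g\cdot h)=r(g)+r(h)$ for every $(g,h)\in\Gamma_2$; moreover $r\circ\varepsilon=0$ and $r\circ\iota=-r$. ii) $\iota^*\vartheta=-e^{r}\vartheta$. iii) $\Gamma_0$, identified with $\varepsilon(\Gamma_0)$, is a Legendrian submanifold of $\Gamma$, i.e. $\dim\Gamma_0=n$ and $\varepsilon^*\vartheta=0$. iv) $E_\Gamma$ is a left invariant vector field and $r$ is a first integral of it, i.e. $\mathcal{L}_{E_\Gamma}r=0$. v) For a section $X_0^l$ of $A(\Gamma)\to\Gamma_0$, write $X^l$ (resp. $X^r$) for the left (resp. right) invariant vector field on $\Gamma$ generated by $X_0^l$ (resp. by $-\iota_*X_0^l$). Let $E_0^l$ be the section of $A(\Gamma)$ corresponding to $E_\Gamma$, i.e. $E_\Gamma=E^l$. Then $$\Lambda_\Gamma^\#(dr)=E^l-e^{r}E^r .$$ vi) $\iota:\Gamma\to\Gamma$ is a $(-e^{-r})$-conformal twisted Jacobi map from $(\Gamma,\Lambda_\Gamma,E_\Gamma,\omega)$ to itself. vii) A vector field $Y$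 on $\Gamma$ is left (resp. right) invariant if and only if there exists $(\zeta_0,f_0)\in\Gamma(T^*\Gamma_0\times\mathbb{R})$ such that $$Y=\Lambda_\Gamma^\#(\alpha^*\zeta_0)+(\alpha^*f_0)E^l\qquad(\text{resp. } Y=e^{-r}\Lambda_\Gamma^\#(\beta^*\zeta_0)+(\beta^*f_0)E^r).$$ viii) For every pair $(f_0,g_0)$ of smooth functions on $\Gamma_0$, $\{\alpha^*f_0,\,e^{-r}\beta^*g_0\}=0$, where $\{f,g\}=\Lambda_\Gamma(df,dg)+\langle f\,dg-g\,df,E_\Gamma\rangle$ for $f,g\in C^\infty(\Gamma,\mathbb{R})$.
   Context: Bivector conventions: for a bivector field $\Lambda$ on a manifold $M$, $\Lambda^\#:T^*M\to TM$ is defined by $\langle\eta,\Lambda^\#(\zeta)\rangle=\Lambda(\zeta,\eta)$. For a $k$-form $\zeta$, $\Lambda^\#(\zeta)$ is the $k$-vector field $\Lambda^\#(\zeta)(\alpha_1,\dots,\alpha_k)=(-1)^k\zeta(\Lambda^\#\alpha_1,\dots,\Lambda^\#\alpha_k)$. For a 3-form $\zeta$, $(\Lambda^\#\otimes1)(\zeta)(E)$ is the bivector field $(\alpha_1,\alpha_2)\mapsto-\zeta(\Lambda^\#\alpha_1,\Lambda^\#\alpha_2,E)$; for a 2-form $\omega$, $(\Lambda^\#\otimes1)(\omega)(E)$ is the vector field $\alpha_1\mapsto\omega(\Lambda^\#\alpha_1,E)$. Twisted Jacobi manifold: a manifold $M$ with a bivector field $\Lambda$, a vector field $E$ and a 2-form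 $\omega$ such that $$\tfrac12[\Lambda,\Lambda]+E\wedge\Lambda=\Lambda^\#(d\omega)+\Lambda^\#(\omega)\wedge E,\qquad [E,\Lambda]=(\Lambda^\#\otimes1)(d\omega)(E)-((\Lambda^\#\otimes1)(\omega)(E))\wedge E,$$ where $[\cdot,\cdot]$ is the Schouten bracket with sign convention $\frac12[\Lambda,\Lambda](df,dg,dh)=\Lambda(df,d(\Lambda(dg,dh)))+$ cyclic permutations, and $[E,\Lambda]=\mathcal{L}_E\Lambda$. Conformal change: for a nowhere vanishing function $a$, $\Lambda^a=a\Lambda$, $E^a=\Lambda^\#(da)+aE$, $\omega^a=\frac1a\omega$ is again a twisted Jacobi structure. A smooth map $\psi:M_1\to M_2$ between twisted Jacobi manifolds is a twisted Jacobi map if $\Lambda_2=\psi_*\Lambda_1$, $E_2=\psi_*E_1$, $\omega_1=\psi^*\omega_2$; it is an $a$-conformal twisted Jacobi map ($a$ nowhere vanishing on $M_1$) if it is a twisted Jacobi map from $(M_1,\Lambda_1^a,E_1^a,\omega_1^a)$ to $(M_2,\Lambda_2,E_2,\omega_2)$. Twisted contact manifold: a $(2n+1)$-dimensional manifold with a 1-form $\vartheta$ and a 2-form $\omega$ with $\vartheta\wedge(d\vartheta+\omega)^n\ne0$ everywhere; $\vartheta$ is then called an $\omega$-twisted contact form. It defines a twisted Jacobi structure $(\Lambda,E,\omega)$ by $i(E)\vartheta=1$, $i(E)(d\vartheta+\omega)=0$, $\Lambda^\#(\vartheta)=0$, and $i(\Lambda^\#(\zeta))(d\vartheta+\omega)=-(\zeta-\langle\zeta,E\rangle\vartheta)$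 for all 1-forms $\zeta$. Lie groupoid conventions: $\Gamma\rightrightarrows\Gamma_0$ has source $\alpha$, target $\beta$, composable pairs $\Gamma_2=\{(g,h):\alpha(g)=\beta(h)\}$, product $m(g,h)=g\cdot h$ with $\alpha(g\cdot h)=\alpha(h)$, $\beta(g\cdot h)=\beta(g)$, unit section $\varepsilon:\Gamma_0\to\Gamma$, inversion $\iota(g)=g^{-1}$. Left translations are $L_g(h)=g\cdot h$, right translations $R_g(h)=h\cdot g$. A vector field is left invariant if it is tangent to the $\beta$-fibres and invariant under left translations, and right invariant if it is tangent to the $\alpha$-fibres and invariant under right translations. The Lie algebroid is $A(\Gamma)=\ker\beta_*\cap T_{\Gamma_0}\Gamma$, whose sections are identified with left invariant vector fields (with their Lie bracket), with anchor the restriction of $T\alpha$. Twisted contact groupoid $(\Gamma\rightrightarrows\Gamma_0,\vartheta,\omega,r)$: a Lie groupoid $\Gamma$ of dimension $2n+1$ with an $\omega$-twisted contact form $\vartheta$, where $\omega=\alpha^*\omega_0-e^{-r}\beta^*\omega_0$ for a 2-form $\omega_0$ on $\Gamma_0$ and a smooth function $r$ on $\Gamma$, such that on $\Gamma_2$ $$m^*\vartheta=pr_2^*(e^{-r})\cdot pr_1^*\vartheta+pr_2^*\vartheta,$$ with $pr_i:\Gamma_2\to\Gamma$ the projection on the $i$-th factor. *)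

(* Defs.v *)
From HB Require Import structures.
From mathcomp Require Import all_boot all_order all_algebra perm.
From mathcomp Require Import all_classical all_reals all_analysis.

Set Implicit Arguments.
Unset Strict Implicit.
Unset Printing Implicit Defensive.

Import Order.TTheory GRing.Theory Num.Theory.
Import numFieldNormedType.Exports.

Local Open Scope classical_set_scope.
Local Open Scope ring_scope.

(** * Smooth functions on open sets of R^n *)

Definition basis_vec (R : realType) (n : nat) (i : 'I_n) : 'rV[R]_n :=
  delta_mx 0 i.

(* Here and below, functions on R^n are total and U is open: only the values
   on U matter. *)
Fixpoint Ck (R : realType) (n : nat) (k : nat) (U : set 'rV[R]_n)
    (f : 'rV[R]_n -> R^o) : Prop :=
  (forall x, U x -> {for x, continuous f}) /\
  (if k is k'.+1 then forall i : 'I_n,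
     (forall x, U x -> derivable f x (basis_vec R i)) /\
     Ck k' U (fun x => 'D_(basis_vec R i) f x)
   else True).

Definition smooth_on (R : realType) (n : nat) (U : set 'rV[R]_n)
    (f : 'rV[R]_n -> R) : Prop := forall k, Ck k U f.

Definition smooth_on_mx (R : realType) (n p q : nat) (U : set 'rV[R]_n)
    (f : 'rV[R]_n -> 'M[R]_(p, q)) : Prop :=
  forall i j, smooth_on U (fun x => f x i j).

(** * Manifolds *)

(* [par] is the inverse of the coordinate map [crd]; it is meaningful on
   [img] only. *)
Record chart (R : realType) (T : topologicalType) (n : nat) := Chart {
  dom : set T;
  crd : T -> 'rV[R]_n;
  par : 'rV[R]_n -> T;
  img := crd @` dom;
  dom_open : open dom;
  img_open : open img;
  crdK : forall p, dom p -> par (crd p) = p;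
  crd_continuous : forall p, dom p -> {for p, continuous crd};
  par_continuous : forall x, img x -> {for x, continuous par} }.

Record manifold (R : realType) (n : nat) := Manifold {
  carrier :> topologicalType;
  atlas : set (chart R carrier n);
  atlas_cover : forall p : carrier, exists2 c, atlas c & dom c p;
  atlas_compat : forall c d, atlas c -> atlas d ->
    smooth_on_mx (crd c @` (dom c `&` dom d)) (fun x => crd d (par c x));
  manifold_hausdorff : hausdorff_space carrier;
  manifold_second_countable : @second_countable carrier;
  manifold_nonempty : [set: carrier] !=set0 }.

Section Tensors.
Context (R : realType) (n : nat) (M : manifold R n).
Implicit Types (p : M) (c : chart R M n).

(* A chart around each point is fixed once and for all, and every tensor at p
   is given by its components in [chart_at p]: tangent vectors are rows,
   covectors are columns, and 2-forms and bivectors are square matrices. *)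
Definition chart_at p : chart R M n := s2val (cid2 (atlas_cover p)).

Definition coord p : 'rV[R]_n := crd (chart_at p) p.

Definition vec_field := M -> 'rV[R]_n.
Definition field1 := M -> 'cV[R]_n.
Definition field2 := M -> 'M[R]_n.

Definition pair1 (z : 'cV[R]_n) (v : 'rV[R]_n) : R := (v *m z) 0 0.
Definition eval2 (w : 'M[R]_n) (u v : 'rV[R]_n) : R := (u *m w *m v^T) 0 0.
Definition evalb (L : 'M[R]_n) (z e : 'cV[R]_n) : R := (z^T *m L *m e) 0 0.

(* <e, sharp L z> = L(z, e) *)
Definition sharp (L : 'M[R]_n) (z : 'cV[R]_n) : 'rV[R]_n := z^T *m L.

Definition contract (v : 'rV[R]_n) (w : 'M[R]_n) : 'cV[R]_n := (v *m w)^T.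

Definition alternating (A : 'M[R]_n) : Prop :=
  A^T = - A.

(* Changes of components between the chart at a point and the chart [c]. *)
Definition to_chart c p : 'M[R]_n :=
  jacobian (fun x => crd c (par (chart_at p) x)) (coord p).
Definition of_chart c (x : 'rV[R]_n) : 'M[R]_n :=
  jacobian (fun y => crd (chart_at (par c x)) (par c y)) x.

Definition local1 (t : field1) c (x : 'rV[R]_n) : 'cV[R]_n :=
  of_chart c x *m t (par c x).
Definition local2 (w : field2) c (x : 'rV[R]_n) : 'M[R]_n :=
  of_chart c x *m w (par c x) *m (of_chart c x)^T.
Definition localb (L : field2) c (x : 'rV[R]_n) : 'M[R]_n :=
  (to_chart c (par c x))^T *m L (par c x) *m to_chart c (par c x).

Definition smooth_fun (f : M -> R) : Prop :=
  forall c, atlas c -> smooth_on (img c) (fun x => f (par c x)).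

Definition vector_field (X : vec_field) : Prop :=
  forall c, atlas c ->
    smooth_on_mx (img c) (fun x => X (par c x) *m to_chart c (par c x)).

Definition form1 (t : field1) : Prop :=
  forall c, atlas c -> smooth_on_mx (img c) (local1 t c).

Definition form2 (w : field2) : Prop :=
  (forall p, alternating (w p)) /\
  forall c, atlas c -> smooth_on_mx (img c) (local2 w c).

Definition bivector_field (L : field2) : Prop :=
  (forall p, alternating (L p)) /\
  forall c, atlas c -> smooth_on_mx (img c) (localb L c).

Definition partial (f : 'rV[R]_n -> R^o) (i : 'I_n) (x : 'rV[R]_n) : R :=
  'D_(basis_vec R i) f x.

Definition d0 (f : M -> R) : field1 := fun p =>
  \col_i partial (fun x => f (par (chart_at p) x)) i (coord p).

Definition d1 (t : field1) : field2 := fun p =>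
  \matrix_(i, j)
    (partial (fun x => local1 t (chart_at p) x j 0) i (coord p) -
     partial (fun x => local1 t (chart_at p) x i 0) j (coord p)).

Definition d2_comp (w : field2) p (i j k : 'I_n) : R :=
  partial (fun x => local2 w (chart_at p) x j k) i (coord p) +
  partial (fun x => local2 w (chart_at p) x k i) j (coord p) +
  partial (fun x => local2 w (chart_at p) x i j) k (coord p).

Definition d2 (w : field2) p (u v z : 'rV[R]_n) : R :=
  \sum_i \sum_j \sum_k d2_comp w p i j k * u 0 i * v 0 j * z 0 k.

End Tensors.

(** * Smooth maps *)

Section Maps.
Context (R : realType) (m n : nat) (M : manifold R m) (N : manifold R n).
Implicit Types (phi : M -> N).

Definition smooth_map phi : Prop :=
  continuous phi /\
  forall (c : chart R M m) (d : chart R N n), atlas c -> atlas d ->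
    smooth_on_mx (crd c @` (dom c `&` phi @^-1` dom d))
                 (fun x => crd d (phi (par c x))).

(* The tangent map at p is v |-> v *m tangent phi p. *)
Definition tangent phi (p : M) : 'M[R]_(m, n) :=
  jacobian (fun x => crd (chart_at (phi p)) (phi (par (chart_at p) x)))
           (coord p).

Definition pull1 phi (t : field1 N) : field1 M :=
  fun p => tangent phi p *m t (phi p).
Definition pull2 phi (w : field2 N) : field2 M :=
  fun p => tangent phi p *m w (phi p) *m (tangent phi p)^T.

Definition submersion phi : Prop :=
  smooth_map phi /\ forall p, row_full (tangent phi p).

Definition embedding phi : Prop :=
  [/\ smooth_map phi, forall p, row_free (tangent phi p), injective phi &
      forall U : set M, open U -> exists2 V : set N, open V & U = phi @^-1` V].

(* Smoothness of a section X of the pullback of TN along phi. *)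
Definition smooth_along phi (X : M -> 'rV[R]_n) : Prop :=
  forall (c : chart R M m) (d : chart R N n), atlas c -> atlas d ->
    smooth_on_mx (crd c @` (dom c `&` phi @^-1` dom d))
                 (fun x => X (par c x) *m to_chart d (phi (par c x))).

End Maps.

(** * Twisted Jacobi structures *)

Section Jacobi.
Context (R : realType) (n : nat) (M : manifold R n).
Implicit Types (L w : field2 M) (E : vec_field M) (f g h : M -> R).

Definition half_schouten L f g h : M -> R := fun p =>
  let term f1 f2 f3 :=
    evalb (L p) (d0 f1 p) (d0 (fun q => evalb (L q) (d0 f2 q) (d0 f3 q)) p) in
  term f g h + term g h f + term h f g.

Definition lie_bivector E L f g : M -> R := fun p =>
  pair1 (d0 (fun q => evalb (L q) (d0 f q) (d0 g q)) p) (E p)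
  - evalb (L p) (d0 (fun q => pair1 (d0 f q) (E q)) p) (d0 g p)
  - evalb (L p) (d0 f p) (d0 (fun q => pair1 (d0 g q) (E q)) p).

Definition vector := 'cV[R]_n -> R.
Definition bivector := 'cV[R]_n -> 'cV[R]_n -> R.

Definition wedge11 (X Y : vector) : bivector :=
  fun a b => X a * Y b - X b * Y a.
(* X /\ B = B /\ X for a vector X and a bivector B *)
Definition wedge12 (X : vector) (B : bivector) (a b c : 'cV[R]_n) : R :=
  X a * B b c + X b * B c a + X c * B a b.

Definition sharp_form2 L w p : bivector :=
  fun a b => eval2 (w p) (sharp (L p) a) (sharp (L p) b).
Definition sharp_d2 L w p (a b c : 'cV[R]_n) : R :=
  - d2 w p (sharp (L p) a) (sharp (L p) b) (sharp (L p) c).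
Definition sharp1_d2 L w E p : bivector :=
  fun a b => - d2 w p (sharp (L p) a) (sharp (L p) b) (E p).
Definition sharp1_form2 L w E p : vector :=
  fun a => eval2 (w p) (sharp (L p) a) (E p).

(* Both sides are multivector fields, compared on exact 1-forms, which span
   the cotangent space at every point. *)
Definition twisted_jacobi L E w : Prop :=
  [/\ bivector_field L, vector_field E, form2 w,
      forall f g h p, smooth_fun f -> smooth_fun g -> smooth_fun h ->
        let a := d0 f p in let b := d0 g p in let c := d0 h p in
        half_schouten L f g h p
          + wedge12 (fun e => pair1 e (E p)) (evalb (L p)) a b c
        = sharp_d2 L w p a b c
          + wedge12 (fun e => pair1 e (E p)) (sharp_form2 L w p) a b c
    & forall f g p, smooth_fun f -> smooth_fun g ->
        let a := d0 f p in let b := d0 g p in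
        lie_bivector E L f g p
        = sharp1_d2 L w E p a b
          - wedge11 (sharp1_form2 L w E p) (fun e => pair1 e (E p)) a b].

Definition nowhere_vanishing (a : M -> R) : Prop := forall p, a p != 0.

Definition conformal_bivector (a : M -> R) L : field2 M :=
  fun p => a p *: L p.
Definition conformal_vector (a : M -> R) L E : vec_field M :=
  fun p => sharp (L p) (d0 a p) + a p *: E p.
Definition conformal_form (a : M -> R) w : field2 M :=
  fun p => (a p)^-1 *: w p.

Definition jacobi_bracket L E f g : M -> R := fun p =>
  evalb (L p) (d0 f p) (d0 g p)
  + pair1 (f p *: d0 g p - g p *: d0 f p) (E p).

End Jacobi.

Definition twisted_jacobi_map (R : realType) (m n : nat)
    (M1 : manifold R m) (M2 : manifold R n)
    (L1 : field2 M1) (E1 : vec_field M1) (w1 : field2 M1)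
    (L2 : field2 M2) (E2 : vec_field M2) (w2 : field2 M2)
    (psi : M1 -> M2) : Prop :=
  [/\ twisted_jacobi L1 E1 w1, twisted_jacobi L2 E2 w2, smooth_map psi
    & [/\ forall p, L2 (psi p) = (tangent psi p)^T *m L1 p *m tangent psi p,
          forall p, E2 (psi p) = E1 p *m tangent psi p
        & forall p, w1 p = pull2 psi w2 p]].

Definition conformal_twisted_jacobi_map (R : realType) (m n : nat)
    (M1 : manifold R m) (M2 : manifold R n) (a : M1 -> R)
    (L1 : field2 M1) (E1 : vec_field M1) (w1 : field2 M1)
    (L2 : field2 M2) (E2 : vec_field M2) (w2 : field2 M2)
    (psi : M1 -> M2) : Prop :=
  [/\ smooth_fun a, nowhere_vanishing a, twisted_jacobi L1 E1 w1
    & twisted_jacobi_map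
        (conformal_bivector a L1) (conformal_vector a L1 E1)
        (conformal_form a w1) L2 E2 w2 psi].

(** * Twisted contact structures *)

Section Contact.
Context (R : realType) (n : nat) (M : manifold R (2 * n).+1).
Implicit Types (t : field1 M) (w L : field2 M) (E : vec_field M).

(* The value of t /\ w^n on (v_0, ..., v_2n) *)
Definition wedge_top (t : 'cV[R]_((2 * n).+1)) (w : 'M[R]_((2 * n).+1))
    (v : 'I_(2 * n).+1 -> 'rV[R]_((2 * n).+1)) : R :=
  (2 ^+ n)^-1 * \sum_(s : 'S_(2 * n).+1) (-1) ^+ s * pair1 t (v (s ord0)) *
    \prod_(i < n) eval2 w (v (s (inord (2 * i).+1))) (v (s (inord (2 * i).+2))).

Definition twisted_contact t w : Prop :=
  [/\ form1 t, form2 w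
    & forall p, exists v, wedge_top (t p) (d1 t p + w p) v != 0].

Definition contact_jacobi t w L E : Prop :=
  [/\ bivector_field L, vector_field E
    & forall p,
      [/\ pair1 (t p) (E p) = 1,
          contract (E p) (d1 t p + w p) = 0,
          sharp (L p) (t p) = 0
        & forall z : 'cV[R]_((2 * n).+1),
            contract (sharp (L p) z) (d1 t p + w p)
            = - (z - pair1 z (E p) *: t p)]].

Definition legendrian t (m : nat) (N : manifold R m) (phi : N -> M) : Prop :=
  [/\ embedding phi, m = n & forall x, pull1 phi t x = 0].

End Contact.

(** * Lie groupoids *)

(* P is the fibre product of f and g along p1 and p2, as a set, on tangent
   spaces, and in the category of manifolds. For submersions f and g this is
   the usual embedded submanifold structure on {(x, y) | f x = g y}, and it
   determines that structure. *)
Record fibre_product (R : realType) (m1 m2 n k : nat)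
    (M1 : manifold R m1) (M2 : manifold R m2) (N : manifold R n)
    (P : manifold R k) (f : M1 -> N) (g : M2 -> N)
    (p1 : P -> M1) (p2 : P -> M2) : Prop := FibreProduct {
  fp_smooth1 : smooth_map p1;
  fp_smooth2 : smooth_map p2;
  fp_comm : forall z, f (p1 z) = g (p2 z);
  fp_inj : forall z z', p1 z = p1 z' -> p2 z = p2 z' -> z = z';
  fp_surj : forall x y, f x = g y -> exists2 z, p1 z = x & p2 z = y;
  fp_tangent_inj : forall z, row_free (row_mx (tangent p1 z) (tangent p2 z));
  fp_tangent_surj : forall z (v : 'rV[R]_m1) (w : 'rV[R]_m2),
    v *m tangent f (p1 z) = w *m tangent g (p2 z) ->
    exists2 u : 'rV[R]_k, u *m tangent p1 z = v & u *m tangent p2 z = w;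
  fp_universal : forall (l : nat) (Q : manifold R l) (phi : Q -> P),
    smooth_map (p1 \o phi) -> smooth_map (p2 \o phi) -> smooth_map phi }.

(* [pairing g h] is the point (g, h) of the manifold [comp] of composable
   pairs; it is meaningful only when src g = tgt h. *)
Record lie_groupoid (R : realType) (k m : nat)
    (G : manifold R k) (G0 : manifold R m) := LieGroupoid {
  src : G -> G0;
  tgt : G -> G0;
  idt : G0 -> G;
  invg : G -> G;
  comp_dim : nat;
  comp : manifold R comp_dim;
  pr1 : comp -> G;
  pr2 : comp -> G;
  pairing : G -> G -> comp;
  mult : comp -> G;
  gmul g h := mult (pairing g h);
  src_submersion : submersion src;
  tgt_submersion : submersion tgt;
  idt_smooth : smooth_map idt;
  invg_smooth : smooth_map invg;
  mult_smooth : smooth_map mult;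
  comp_fibre_product : fibre_product src tgt pr1 pr2;
  pr1_pairing : forall g h, src g = tgt h -> pr1 (pairing g h) = g;
  pr2_pairing : forall g h, src g = tgt h -> pr2 (pairing g h) = h;
  src_mul : forall g h, src g = tgt h -> src (gmul g h) = src h;
  tgt_mul : forall g h, src g = tgt h -> tgt (gmul g h) = tgt g;
  mulA : forall g h l, src g = tgt h -> src h = tgt l ->
    gmul g (gmul h l) = gmul (gmul g h) l;
  src_idt : forall x, src (idt x) = x;
  tgt_idt : forall x, tgt (idt x) = x;
  mul_idt_l : forall g, gmul (idt (tgt g)) g = g;
  mul_idt_r : forall g, gmul g (idt (src g)) = g;
  src_inv : forall g, src (invg g) = tgt g;
  tgt_inv : forall g, tgt (invg g) = src g;
  mul_inv_l : forall g, gmul (invg g) g = idt (src g);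
  mul_inv_r : forall g, gmul g (invg g) = idt (tgt g) }.

Arguments src {R k m G G0} l : rename.
Arguments tgt {R k m G G0} l : rename.
Arguments idt {R k m G G0} l : rename.
Arguments invg {R k m G G0} l : rename.
Arguments comp {R k m G G0} l : rename.
Arguments pr1 {R k m G G0} l : rename.
Arguments pr2 {R k m G G0} l : rename.
Arguments pairing {R k m G G0} l : rename.
Arguments mult {R k m G G0} l : rename.
Arguments gmul {R k m G G0} l : rename.

Section Groupoid.
Context (R : realType) (k m : nat) (Gam : manifold R k) (Gam0 : manifold R m).
Context (G : lie_groupoid Gam Gam0).

(* The image under the tangent map of the product of the vector (v, w),
   tangent to the manifold of composable pairs at (g, h). The pseudo-inverse
   returns the unique tangent vector with projections v and w. *)
Definition tangent_mul (g h : Gam) (v w : 'rV[R]_k) : 'rV[R]_k :=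
  let z := pairing G g h in
  row_mx v w *m pinvmx (row_mx (tangent (pr1 G) z)
                               (tangent (pr2 G) z))
    *m tangent (mult G) z.

(* L_g is defined on a fibre of tgt, and R_g on a fibre of src; these maps
   apply to vectors tangent to these fibres. *)
Definition tangent_L (g h : Gam) (w : 'rV[R]_k) : 'rV[R]_k :=
  tangent_mul g h 0 w.
Definition tangent_R (g h : Gam) (v : 'rV[R]_k) : 'rV[R]_k :=
  tangent_mul h g v 0.

Definition left_invariant (Y : vec_field Gam) : Prop :=
  [/\ vector_field Y, forall g, Y g *m tangent (tgt G) g = 0
    & forall g h, src G g = tgt G h -> tangent_L g h (Y h) = Y (gmul G g h)].

Definition right_invariant (Y : vec_field Gam) : Prop :=
  [/\ vector_field Y, forall g, Y g *m tangent (src G) g = 0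
    & forall g h, src G h = tgt G g -> tangent_R g h (Y h) = Y (gmul G h g)].

(* X0 x is a tangent vector of Gam at the unit of x. *)
Definition algebroid_section (X0 : Gam0 -> 'rV[R]_k) : Prop :=
  smooth_along (idt G) X0 /\
  forall x, X0 x *m tangent (tgt G) (idt G x) = 0.

Definition left_field (X0 : Gam0 -> 'rV[R]_k) : vec_field Gam := fun g =>
  tangent_L g (idt G (src G g)) (X0 (src G g)).

Definition right_field (X0 : Gam0 -> 'rV[R]_k) : vec_field Gam := fun g =>
  let x := tgt G g in
  tangent_R g (idt G x) (- (X0 x *m tangent (invg G) (idt G x))).

End Groupoid.

Definition twisted_contact_groupoid (R : realType) (n m : nat)
    (Gam : manifold R (2 * n).+1) (Gam0 : manifold R m)
    (G : lie_groupoid Gam Gam0) (t : field1 Gam) (w : field2 Gam)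
    (r : Gam -> R) : Prop :=
  [/\ twisted_contact t w, smooth_fun r,
      exists2 w0 : field2 Gam0, form2 w0 &
        forall g, w g = pull2 (src G) w0 g
                        - expR (- r g) *: pull2 (tgt G) w0 g
    & forall z : comp G,
        pull1 (mult G) t z
        = expR (- r (pr2 G z)) *: pull1 (pr1 G) t z
          + pull1 (pr2 G) t z].

(* Main.v *)
(* The equation m^*theta = e^-r pr_1^*theta + pr_2^*theta, applied to the tangent
   maps of the identities g^-1 (g h) = h and g^-1 g = 1, gives eps^*theta = 0,
   iota^*theta = - e^r theta, and, at a vector with theta = 1, the multiplicativity
   of r. Put Om = d theta + omega. Differentiating the equation gives
     m^*Om = e^-r pr_1^*Om + pr_2^*Om - e^-r pr_2^*dr /\ pr_1^*theta,
   hence Om(w, u) = - dr(w) theta(u) for w in ker T beta and u in ker T alpha. The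
   intersections of these two kernels with ker theta are therefore Om-orthogonal,
   and since eps is isotropic a count of dimensions gives dim Gamma_0 = n and makes
   each of them the whole orthogonal of the other in ker theta. A vector is
   determined by its products with theta and Om, and the tangent map of m is onto,
   so every remaining identity reduces to a computation with the displayed formula;
   the fields in vii) are moreover determined by their values at the units.

   The twisted Jacobi identities of the contact data (theta, omega) are obtained in
   a chart, by differentiating the equations that define Lambda and E along
   Hamiltonian vector fields and summing cyclically. Applied to (theta/a, omega/a),
   whose contact data are a Lambda and Lambda^#(da) + a E, this covers the conformal
   change. *)
Require Import Defs.
From HB Require Import structures.
From mathcomp Require Import all_boot all_order all_algebra.
From mathcomp Require Import all_classical all_reals all_analysis.
From mathcomp Require Import ring lra zify.

Set Implicit Arguments.
Unset Strict Implicit.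
Unset Printing Implicit Defensive.

Import Order.TTheory GRing.Theory Num.Theory.
Import numFieldNormedType.Exports.

Local Open Scope classical_set_scope.
Local Open Scope ring_scope.

(** * Smooth functions on open sets of R^n *)

(** The components of a tensor at p refer to a chart that varies with p in no continuous way, so
    they cannot be differentiated as functions of p. Differential statements are therefore read
    along plots, smooth maps from open sets of some R^k, in one fixed chart near each point; d,
    pull-back and the chain rule are proved there. The groupoid enters through the derivatives of
    its laws and of the equation for theta. The outcome is a list of identities between rows and
    matrices at points, and what follows is linear algebra. In the displayed formula at (g, 1), a
    vector of ker T beta is Tm(0, w0) and a vector of ker T alpha is Tm(u, 0), so only the term with
    dr remains. In the converse of vii) the data are forced at the units: f_0 = theta(Y) and zeta_0
    = - i(Y)Om, restricted to Gamma_0. The tangent space at a unit is the sum of T Gamma_0, where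
    this choice makes the two fields agree, and of one of the two kernels, where the formula for
    Om(w, u) does. *)

Section DirectionalMVT.
Context (R : realType) (V : normedModType R).
Implicit Types (f : V -> R^o) (x v w : V).

Lemma is_derive_line f x v (t : R) : derivable f (x + t *: v) v ->
  is_derive t (1 : R) (fun s : R => f (x + s *: v) : R^o) ('D_v f (x + t *: v)).
Proof.
have E : (fun h : R => h^-1 *: (((fun s : R => f (x + s *: v) : R^o) \o shift t)
    (h *: (1 : R^o)) - f (x + t *: v))) =
   (fun h : R => h^-1 *: ((f \o shift (x + t *: v)) (h *: v) - f (x + t *: v))).
  apply/funext => h /=; congr (_ *: (f _ - _)).
  by rewrite -[h%:A]/(h * 1) mulr1 scalerDl addrCA.
move=> fv; apply: DeriveDef; first by rewrite /derivable E.
by rewrite /derive E.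
Qed.

Lemma is_deriveZv f x v (k : R) : derivable f x v ->
  is_derive x (k *: v) f (k *: 'D_v f x).
Proof.
move=> fv.
have g0 : is_derive (0 : R) (1 : R) (fun s : R => f (x + s *: v) : R^o) ('D_v f x).
  by have := @is_derive_line f x v 0; rewrite scale0r addr0; apply.
have gk : is_derive (0 : R) (1 : R) (fun s : R => s * k) k.
  have := @is_deriveM R _ id (cst k) (0:R) 1 1 0 (is_derive_id _ _) (is_derive_cst _ _ _).
  by rewrite scaler0 add0r /GRing.scale /= mulr1.
have := @is_derive1_comp R (fun s : R => f (x + s *: v)) (fun s : R => s * k) 0.
move=> /(_ ('D_v f x) k); rewrite mul0r => /(_ g0 gk) h.
have E : (fun h : R => h^-1 *: ((f \o shift x) (h *: (k *: v)) - f x)) =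
   (fun h : R => h^-1 *: ((((fun s : R => f (x + s *: v)) \o (fun s => s * k)) \o shift 0)
      (h *: (1 : R^o)) - ((fun s : R => f (x + s *: v)) \o (fun s => s * k)) 0)).
  apply/funext => s /=.
  rewrite -[s%:A]/(s * 1) mulr1 addr0 mul0r scale0r addr0 scalerA.
  by rewrite [x + _]addrC.
case: h => h1 h2; apply: DeriveDef; first by rewrite /derivable E.
by rewrite /derive E [LHS]h2 mulrC.
Qed.

Lemma MVT_line f x w :
  (forall t : R, 0 <= t <= 1 -> derivable f (x + t *: w) w) ->
  exists2 t : R, 0 <= t <= 1 & f (x + w) - f x = 'D_w f (x + t *: w).
Proof.
move=> fw.
pose g (s : R) := f (x + s *: w).
have gd (t : R) : 0 <= t <= 1 -> is_derive t 1 g ('D_w f (x + t *: w)).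
  by move=> /fw; exact: is_derive_line.
have [||t] := @MVT_segment R g (fun t => 'D_w f (x + t *: w)) 0 1 ler01.
- by move=> t; rewrite in_itv /= => /andP[a b]; apply: gd; rewrite !ltW.
- apply: derivable_within_continuous => t; rewrite in_itv /= => /gd.
  by case.
rewrite in_itv /= => t01; rewrite /g subr0 mulr1 scale0r addr0 scale1r => E.
by exists t.
Qed.

End DirectionalMVT.

Lemma continuous_at_sum (R : realType) (T : topologicalType) (I : Type)
    (r : seq I) (F : I -> T -> R^o) (x : T) :
  (forall i, {for x, continuous (F i)}) ->
  {for x, continuous (fun y => \sum_(i <- r) F i y : R^o)}.
Proof.
move=> Fc; elim: r => [|i r IH].
  rewrite (_ : (fun y => _) = cst 0); first exact: cst_continuous.
  by apply/funext => y; rewrite big_nil.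
rewrite (_ : (fun y => _) = F i \+ (fun y => \sum_(j <- r) F j y)).
  by apply: continuousD; [exact: Fc|exact: IH].
by apply/funext => y; rewrite big_cons.
Qed.

(** * Continuous partial derivatives imply differentiability *)

Section RowSpace.
Context (R : realType) (n : nat).
Implicit Types (U V : set 'rV[R]_n) (f g : 'rV[R]_n -> R^o) (x v h : 'rV[R]_n).

Lemma pair1_linear (z : 'cV[R]_n) : linear (pair1 z : 'rV[R]_n -> R^o).
Proof. by move=> a u v; rewrite /pair1 mulmxDl -scalemxAl !mxE. Qed.

HB.instance Definition _ (z : 'cV[R]_n) :=
  GRing.isLinear.Build R 'rV[R]_n R^o _ (pair1 z : 'rV[R]_n -> R^o)
    (pair1_linear z).

Lemma pair1E (z : 'cV[R]_n) v : pair1 z v = \sum_i v 0 i * z i 0.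
Proof. by rewrite /pair1 mxE. Qed.

Lemma pair1_continuous (z : 'cV[R]_n) : continuous (pair1 z : 'rV[R]_n -> R^o).
Proof.
move=> x; rewrite (_ : pair1 z = fun v => \sum_i v 0 i * z i 0); last first.
  by apply/funext => v; rewrite pair1E.
apply: continuous_at_sum => i.
apply: (@continuousM R _ (fun y : 'rV[R]_n => y 0 i : R) (cst (z i 0))).
  exact: coord_continuous.
exact: cst_continuous.
Qed.

Lemma coord_le_norm v i : `|v 0 i| <= `|v|.
Proof.
rewrite [leRHS]/Num.Def.normr /= mx_normrE.
by apply/bigmax_geP; right; exists (0, i).
Qed.

Lemma norm_row_le v (e : R) : 0 <= e -> (forall i, `|v 0 i| <= e) -> `|v| <= e.
Proof.
move=> e0 ve; rewrite [leLHS]/Num.Def.normr /= mx_normrE.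
by apply: bigmax_le => //= -[i j] _; rewrite ord1.
Qed.

Definition grad f x : 'cV[R]_n := \col_i partial f i x.

(** The truncations of [v] are the vertices of a staircase from 0 to [v] with edges parallel to the
    axes, so that only partial derivatives are met along it. *)
Definition head_row v (k : nat) : 'rV[R]_n := \row_j if (j < k)%N then v 0 j else 0.

Lemma head_row0 v : head_row v 0 = 0.
Proof. by apply/rowP => j; rewrite !mxE. Qed.

Lemma head_row_full v : head_row v n = v.
Proof. by apply/rowP => j; rewrite !mxE ltn_ord. Qed.

Lemma head_rowS v (k : 'I_n) :
  head_row v k.+1 = head_row v k + v 0 k *: basis_vec R k.
Proof.
apply/rowP => j; rewrite !mxE eqxx /= ltnS leq_eqVlt -val_eqE.
by case: eqVneq => [/val_inj ->|] /=; rewrite ?ltnn ?mulr1 ?mulr0 ?add0r ?addr0.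
Qed.

(** The increment is telescoped along the staircase; on each of the [n] edges the mean value theorem
    leaves an error of at most [e] times the norm of [h]. In the sup norm the staircase stays in the
    ball around [x] of radius the norm of [h]. *)
Lemma increment_le f x h (e : R) :
  (forall y, `|y - x| <= `|h| -> forall i, derivable f y (basis_vec R i) /\
     `|partial f i y - partial f i x| <= e) ->
  `|f (x + h) - f x - pair1 (grad f x) h| <= n%:R * e * `|h|.
Proof.
move=> H.
have -> : f (x + h) - f x =
    \sum_(0 <= k < n) (f (x + head_row h k.+1) - f (x + head_row h k)).
  by rewrite telescope_sumr // head_row_full head_row0 addr0.
rewrite big_mkord pair1E -sumrB.
apply: (le_trans (ler_norm_sum _ _ _)).
rewrite (_ : n%:R * e * `|h| = \sum_(i < n) e * `|h|); last first.
  by rewrite sumr_const card_ord -[RHS]mulr_natl mulrA.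
apply: ler_sum => k _; rewrite head_rowS addrA.
set y := x + head_row h k; set w := h 0 k *: _.
have yb (t : R) : 0 <= t <= 1 -> `|y + t *: w - x| <= `|h|.
  move=> /andP[t0 t1]; rewrite /y addrC addrA addrA addNr add0r.
  apply: norm_row_le => // i; rewrite !mxE eqxx /=.
  case: eqVneq => [->|_].
    rewrite ltnn add0r mulr1 normrM ger0_norm //.
    by apply: le_trans (coord_le_norm h k); rewrite ler_piMl.
  rewrite mulr0 mulr0 addr0; case: ifP => _; rewrite ?normr0 //.
  exact: coord_le_norm.
have [t /yb t01 ->] : exists2 t : R, 0 <= t <= 1 & f (y + w) - f y = 'D_w f (y + t *: w).
  apply: MVT_line => t /yb /H /(_ k) [fd _].
  by have [] := is_deriveZv (h 0 k) fd.
have [fd le_e] := H _ t01 k.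
have [_ ->] := is_deriveZv (h 0 k) fd.
rewrite mxE -[_ *: 'D_ _ _ _]/(_ * partial f k _) -mulrBr normrM mulrC.
by apply: ler_pM => //; exact: coord_le_norm.
Qed.

Lemma Ck1_is_diff U f x : open U -> Ck 1 U f -> U x ->
  is_diff x f (pair1 (grad f x)).
Proof.
move=> Uo [fc fd] Ux.
have near_e (e : R) : 0 < e -> \forall y \near x,
    forall i, derivable f y (basis_vec R i) /\
     `|partial f i y - partial f i x| <= e.
  move=> e0; apply: (@filter_forall _ 'I_n (fun i y => derivable f y (basis_vec R i) /\
     `|partial f i y - partial f i x| <= e) (nbhs x)) => i.
  have [fdi [Dc _]] := fd i.
  near=> y; split.
    by apply: fdi; near: y; exact: open_nbhs_nbhs.
  rewrite distrC; near: y.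
  by move/cvgrPdist_le: (Dc x Ux) => /(_ _ e0).
pose W : normedModType R := R^o.
pose df : {linear 'rV[R]_n -> W} := pair1 (grad f x).
have exp : (f : 'rV[R]_n -> W) \o shift x = cst (f x : W) + df +o_ (0 : 'rV[R]_n) id.
  apply/eqaddoP => e e0 /=.
  (* The staircase has [n] edges, each costing this much; [n.+1] keeps the quotient meaningful when
     [n] is 0. *)
  have en : 0 < e / n.+1%:R by rewrite divr_gt0.
  have /nbhs_ballP [d /= d0 dP] := near_e _ en.
  apply/nbhs_ballP; exists d => // h; rewrite -ball_normE /= sub0r normrN => hd.
  rewrite [X in `|X| <= _](_ : _ = f (x + h) - f x - pair1 (grad f x) h); last first.
    by rewrite (addrC x h) -addrA -opprD.
  apply: (le_trans (@increment_le f x h (e / n.+1%:R) _)).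
    move=> y yh i; apply: dP; rewrite -ball_normE /= distrC.
    exact: le_lt_trans hd.
  apply: ler_wpM2r => //; rewrite mulrCA ler_piMr ?(ltW e0) //.
  by rewrite ler_pdivrMr // mul1r ler_nat.
have dE := diff_unique (@pair1_continuous (grad f x) : continuous df) exp.
apply: DiffDef => //; apply/diff_locallyP; rewrite dE; split => //.
exact: pair1_continuous.
Unshelve. all: by end_near. Qed.

End RowSpace.

(** * Symmetry of second derivatives *)

Section Clairaut.
Context (R : realType) (V : normedModType R).
Implicit Types (f : V -> R^o) (x v w : V).

(** The second difference is the increment along [s *: v] of y |-> f (y + s w) - f y, so the mean
    value theorem applies once in the direction [v] and then once in the direction [w]. *)
Lemma second_difference (U : set V) f x v w (s : R) :
  (forall a b : R, 0 <= a <= 1 -> 0 <= b <= 1 ->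
     U (x + a *: (s *: v) + b *: (s *: w))) ->
  (forall y, U y -> derivable f y v) ->
  (forall y, U y -> derivable ('D_v f : V -> R^o) y w) ->
  exists a b : R, [/\ 0 <= a <= 1, 0 <= b <= 1 &
    f (x + s *: v + s *: w) - f (x + s *: v) - (f (x + s *: w) - f x) =
    s ^+ 2 * 'D_w ('D_v f : V -> R^o) (x + a *: (s *: v) + b *: (s *: w))].
Proof.
move=> UP fv fvw.
have shiftE (y : V) (c : V) : derivable f (y + c) v ->
    is_derive y v (fun z => f (z + c) : R^o) ('D_v f (y + c)).
  have E : (fun h : R => h^-1 *: (((fun z => f (z + c)) \o shift y) (h *: v) - f (y + c)))
         = (fun h : R => h^-1 *: ((f \o shift (y + c)) (h *: v) - f (y + c))).
    by apply/funext => h /=; rewrite addrA.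
  by move=> H; apply: DeriveDef; rewrite /derivable /derive E.
pose phi : V -> R^o := fun y => f (y + s *: w) - f y.
have phid (a : R) : 0 <= a <= 1 ->
    is_derive (x + a *: (s *: v)) (s *: v) phi
      (s *: ('D_v f (x + a *: (s *: v) + s *: w) - 'D_v f (x + a *: (s *: v)))).
  move=> a01; set y := x + _.
  have U1 : U (y + s *: w) by have := UP a 1 a01; rewrite scale1r; apply; rewrite ler01 lexx.
  have U0 : U y by have := UP a 0 a01; rewrite scale0r addr0; apply; rewrite ler01 lexx.
  have H := is_deriveB (shiftE _ _ (fv _ U1)) (derivableP (fv _ U0)).
  by case: H => H1 <-; apply: is_deriveZv.
have [a a01 Ea] : exists2 a : R, 0 <= a <= 1 &
    phi (x + s *: v) - phi x = 'D_(s *: v) phi (x + a *: (s *: v)).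
  by apply: MVT_line => a /phid [].
have [b b01 Eb] : exists2 b : R, 0 <= b <= 1 &
    'D_v f (x + a *: (s *: v) + s *: w) - 'D_v f (x + a *: (s *: v)) =
    'D_(s *: w) ('D_v f : V -> R^o) (x + a *: (s *: v) + b *: (s *: w)).
  apply: (@MVT_line R V ('D_v f : V -> R^o) (x + a *: (s *: v)) (s *: w)) => b b01.
  by have [] := is_deriveZv s (fvw _ (UP _ _ a01 b01)).
exists a, b; split => //.
have [_ Ephi] := phid _ a01.
have [_ Ew] := is_deriveZv s (fvw _ (UP _ _ a01 b01)).
rewrite [LHS]Ea Ephi Eb Ew -[LHS]/(s * (s * _)).
by rewrite mulrA -expr2.
Qed.

(** The second difference is symmetric in [v] and [w]. Written by the mean value theorem in both
    orders, it gives equal values of the two mixed derivatives at two points near [x], and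
    continuity brings these points back to [x]. *)
Lemma derive_comm (U : set V) f x v w : open U -> U x ->
  (forall y, U y -> derivable f y v) -> (forall y, U y -> derivable f y w) ->
  (forall y, U y -> derivable ('D_v f : V -> R^o) y w) ->
  (forall y, U y -> derivable ('D_w f : V -> R^o) y v) ->
  {for x, continuous ('D_w ('D_v f : V -> R^o) : V -> R^o)} ->
  {for x, continuous ('D_v ('D_w f : V -> R^o) : V -> R^o)} ->
  'D_w ('D_v f : V -> R^o) x = 'D_v ('D_w f : V -> R^o) x.
Proof.
move=> Uo Ux fv fw fvw fwv c1 c2.
set A := 'D_w ('D_v f : V -> R^o) : V -> R^o.
set B := 'D_v ('D_w f : V -> R^o) : V -> R^o.
apply/eqP; rewrite -subr_eq0 -normr_le0; apply/ler_addgt0Pl => e e0.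
rewrite addr0.
have e2 : 0 < e / 2 by rewrite divr_gt0.
have near3 : \forall y \near x, [/\ U y, `|A x - A y| <= e / 2 & `|B x - B y| <= e / 2].
  have nU : nbhs x U by exact: open_nbhs_nbhs.
  have nA : nbhs x (fun y => `|A x - A y| <= e / 2).
    exact: (@cvgr_dist_le _ R^o _ _ _ A (A x) c1 (e / 2) e2).
  have nB : nbhs x (fun y => `|B x - B y| <= e / 2).
    exact: (@cvgr_dist_le _ R^o _ _ _ B (B x) c2 (e / 2) e2).
  by apply: filterS (filterI nU (filterI nA nB)) => y [? []].
have /nbhs_ballP [d /= d0 dP] := near3.
(* This makes the parallelogram with sides [s *: v] and [s *: w] fit into the ball of radius [d];
   the summand 1 keeps the denominator positive when both vectors vanish. *)
pose s := d / (2 * (`|v| + `|w| + 1)).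
have vw0 : 0 < `|v| + `|w| + 1 by rewrite ltr_wpDl ?addr_ge0.
have s0 : 0 < s by rewrite divr_gt0 // mulr_gt0.
have sd : s * `|v| + s * `|w| < d.
  rewrite -mulrDr /s mulrAC ltr_pdivrMr ?mulr_gt0 // ltr_pM2l //.
  by have := normr_ge0 v; have := normr_ge0 w; lra.
clearbody s; have s1 := ltW s0.
have inb (a b : R) : 0 <= a <= 1 -> 0 <= b <= 1 ->
    ball x d (x + a *: (s *: v) + b *: (s *: w)).
  move=> /andP[a0 a1] /andP[b0 b1].
  rewrite -ball_normE /= -addrA opprD addrA subrr add0r normrN.
  apply: le_lt_trans sd; apply: (le_trans (ler_normD _ _)).
  rewrite !normrZ (ger0_norm a0) (ger0_norm b0) (ger0_norm s1).
  by apply: lerD; rewrite ler_piMl // mulr_ge0.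
have [a [b [a01 b01 E1]]] := @second_difference U f x v w s
  (fun a b p q => let: And3 u _ _ := dP _ (inb a b p q) in u) fv fvw.
have inb' (a' b' : R) : 0 <= a' <= 1 -> 0 <= b' <= 1 ->
    ball x d (x + a' *: (s *: w) + b' *: (s *: v)).
  by move=> p q; rewrite addrAC; exact: inb.
have [a' [b' [a01' b01' E2]]] := @second_difference U f x w v s
  (fun a b p q => let: And3 u _ _ := dP _ (inb' a b p q) in u) fw fwv.
have swap (p q r t : R) : p - q - (r - t) = p - r - (q - t) by ring.
have close (p q p' q' : R) : s ^+ 2 * p' = s ^+ 2 * q' ->
    `|p - p'| <= e / 2 -> `|q - q'| <= e / 2 -> `|p - q| <= e.
  move/(mulfI (lt0r_neq0 (exprn_gt0 2 s0))) => -> p1 q1.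
  have -> : p - q = (p - q') - (q - q') by ring.
  by apply: (le_trans (ler_normB _ _)); rewrite [leRHS](splitr e); exact: lerD.
have [_ hA _] := dP _ (inb _ _ a01 b01).
have [_ _ hB] := dP _ (inb' _ _ a01' b01').
apply: close hA hB; rewrite -[LHS]E1 -[RHS]E2 [x + s *: w + _]addrAC.
exact: swap.
Qed.

End Clairaut.

(** * Algebra of C^k and smooth functions *)

Section Smooth.
Context (R : realType) (n : nat).
Implicit Types (U V : set 'rV[R]_n) (f g : 'rV[R]_n -> R^o) (x v : 'rV[R]_n).

Lemma Ck_continuous k U f x : Ck k U f -> U x -> {for x, continuous f}.
Proof. by case: k => [|k] [fc _] /fc. Qed.

Lemma CkS k U f : Ck k.+1 U f -> Ck k U f.
Proof.
elim: k f => [|k IH] f [fc fd]; first by split.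
by split=> // i; have [fdi Dk] := fd i; split => //; apply: IH.
Qed.

Lemma Ck_derivable k U f i x : Ck k.+1 U f -> U x -> derivable f x (basis_vec R i).
Proof. by case=> _ /(_ i) [fd _] /fd. Qed.

Lemma Ck_partial k U f i : Ck k.+1 U f -> Ck k U (partial f i).
Proof. by case=> _ /(_ i) []. Qed.

Lemma Ck_subset k U V f : V `<=` U -> Ck k U f -> Ck k V f.
Proof.
move=> VU; elim: k f => [|k IH] f [fc fd]; split => //.
- by move=> x /VU /fc.
- by move=> x /VU /fc.
by move=> i; have [fdi Dk] := fd i; split; [move=> x /VU /fdi|apply: IH].
Qed.

Lemma nbhs_eq_on U f g x : open U -> {in U, f =1 g} -> U x ->
  \forall y \near x, f y = g y.
Proof.
move=> Uo fg Ux; have nU : nbhs x U by exact: open_nbhs_nbhs.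
by apply: filterS nU => y Uy; apply: fg; rewrite inE.
Qed.

Lemma partial_eq_on U f g i x : open U -> {in U, f =1 g} -> U x ->
  partial f i x = partial g i x.
Proof. by move=> Uo fg Ux; apply/near_eq_derive/(nbhs_eq_on Uo). Qed.

Lemma continuous_eq_on U f g x : open U -> {in U, f =1 g} -> U x ->
  {for x, continuous f} -> {for x, continuous g}.
Proof.
move=> Uo fg Ux fc; have nfg := nbhs_eq_on Uo fg Ux.
suff : g @ x --> f x by rewrite fg ?inE.
exact: cvg_trans (near_eq_cvg nfg) fc.
Qed.

Lemma Ck_eq k U f g : open U -> {in U, f =1 g} -> Ck k U f -> Ck k U g.
Proof.
move=> Uo; elim: k f g => [|k IH] f g fg [fc fd].
  by split => // x Ux; exact: (continuous_eq_on Uo fg Ux (fc x Ux)).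
split; first by move=> x Ux; exact: (continuous_eq_on Uo fg Ux (fc x Ux)).
move=> i; have [fdi Dk] := fd i; split.
  move=> x Ux; apply: near_eq_derivable (fdi x Ux).
  exact: nbhs_eq_on fg Ux.
apply: IH Dk => x; rewrite inE => Ux.
exact: partial_eq_on fg Ux.
Qed.

Lemma Ck_cst k U (a : R) : Ck k U (cst a).
Proof.
elim: k a => [|k IH] a; (split; first by move=> x _; exact: cst_continuous) => //.
move=> i; split; first by move=> x _; exact: derivable_cst.
rewrite (_ : (fun x => _) = cst 0); first exact: IH.
by apply/funext => x; rewrite derive_cst.
Qed.

Lemma CkD k U f g : open U -> Ck k U f -> Ck k U g -> Ck k U (f \+ g).
Proof.
move=> Uo; elim: k f g => [|k IH] f g [fc fd] [gc gd];
  (split; first by move=> x Ux; apply: continuousD; [exact: fc|exact: gc]) => //.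
move=> i; have [fdi Df] := fd i; have [gdi Dg] := gd i; split.
  by move=> x Ux; apply: derivableD; [exact: fdi|exact: gdi].
apply: Ck_eq (IH _ _ Df Dg) => // x; rewrite inE => Ux /=.
by rewrite deriveD; [|exact: fdi|exact: gdi].
Qed.

Lemma CkM k U f g : open U -> Ck k U f -> Ck k U g -> Ck k U (f \* g).
Proof.
move=> Uo; elim: k f g => [|k IH] f g Cf Cg;
  have := (Cf, Cg) => -[[fc fd] [gc gd]];
  (split; first by move=> x Ux; apply: (@continuousM R _ f g); [exact: fc|exact: gc]) => //.
move=> i; have [fdi Df] := fd i; have [gdi Dg] := gd i; split.
  by move=> x Ux; apply: derivableM; [exact: fdi|exact: gdi].
apply: Ck_eq (CkD Uo (IH _ _ (CkS Cf) Dg) (IH _ _ (CkS Cg) Df)) => // x.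
by rewrite inE => Ux /=; rewrite deriveM; [|exact: fdi|exact: gdi].
Qed.

Lemma Ck_expR k U f : open U -> Ck k U f -> Ck k U (fun x => expR (f x)).
Proof.
move=> Uo; elim: k f => [|k IH] f Cf; have [fc fd] := Cf;
  (split; first by move=> x Ux; apply: continuous_comp; [exact: fc|exact: continuous_expR]) => //.
move=> i; have [fdi Df] := fd i.
have H x : U x -> is_derive x (basis_vec R i) (fun x => expR (f x) : R^o)
    (expR (f x) * partial f i x).
  move=> Ux; set v := basis_vec R i.
  have g0 : is_derive (0 : R) (1 : R) (fun s : R => f (x + s *: v) : R^o) (partial f i x).
    have := @is_derive_line R _ f x v 0; rewrite scale0r addr0; apply.
    exact: fdi.
  have h := is_derive1_comp (is_derive_expR _) g0.
  rewrite scale0r addr0 in h.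
  have E : (fun h : R => h^-1 *: (((fun y => expR (f y) : R^o) \o shift x) (h *: v)
       - expR (f x))) =
     (fun h : R => h^-1 *: (((expR \o (fun s : R => f (x + s *: v))) \o shift 0)
       (h *: (1 : R^o)) - (expR \o (fun s : R => f (x + s *: v))) 0)).
    apply/funext => s /=; rewrite -[s%:A]/(s * 1) mulr1 addr0 scale0r addr0.
    by rewrite [x + _]addrC.
  case: h => h1 h2; apply: DeriveDef; first by rewrite /derivable E.
  by rewrite /derive E [LHS]h2.
split; first by move=> x /H [].
apply: Ck_eq (CkM Uo (IH _ (CkS Cf)) Df) => // x; rewrite inE => /H [_ E].
by rewrite E.
Qed.

Lemma Ck_coord k U (i : 'I_n) : Ck k U (fun x => x 0 i).
Proof.
case: k => [|k]; (split; first by move=> x _; exact: coord_continuous) => //.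
move=> j.
have H x : is_derive x (basis_vec R j) (fun x : 'rV[R]_n => x 0 i : R^o)
    ((i == j)%:R).
  have E : (fun h : R => h^-1 *: (((fun y : 'rV[R]_n => y 0 i : R^o) \o shift x)
      (h *: basis_vec R j) - x 0 i)) = (fun h : R => h^-1 *: (h *: ((i == j)%:R : R^o))).
    by apply/funext => h /=; rewrite !mxE eqxx /= addrK.
  have H : h^-1 *: (h *: ((i == j)%:R : R^o)) @[h --> (0 : R)^'] --> ((i == j)%:R : R^o).
    have nE : \forall h \near (0 : R)^', cst ((i == j)%:R : R^o) h =
        h^-1 *: (h *: ((i == j)%:R : R^o)).
      by apply: filterS (nbhs_dnbhs_neq (0 : R)) => h h0; rewrite scalerA mulVf ?scale1r.
    exact: cvg_trans (near_eq_cvg nE) (cvg_cst _).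
  apply: DeriveDef; first by rewrite /derivable E; apply/cvg_ex; exists ((i == j)%:R).
  by rewrite /derive E; apply/cvg_lim.
split; first by move=> x _; case: (H x).
rewrite (_ : (fun x => _) = cst ((i == j)%:R)); first exact: Ck_cst.
by apply/funext => x; case: (H x).
Qed.

End Smooth.

Section SmoothFunctions.
Context (R : realType) (n : nat).
Implicit Types (U V : set 'rV[R]_n) (f g : 'rV[R]_n -> R) (x v : 'rV[R]_n).

Lemma smooth_subset U V f : V `<=` U -> smooth_on U f -> smooth_on V f.
Proof. by move=> VU fs k; exact: Ck_subset (fs k). Qed.

Lemma smooth_eq U f g : open U -> {in U, f =1 g} -> smooth_on U f -> smooth_on U g.
Proof. by move=> Uo fg fs k; exact: Ck_eq (fs k). Qed.

Lemma smooth_cst U (a : R) : smooth_on U (fun=> a).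
Proof. by move=> k; exact: Ck_cst. Qed.

Lemma smooth_coord U i : smooth_on U (fun x => x 0 i).
Proof. by move=> k; exact: Ck_coord. Qed.

Lemma smoothD U f g : open U -> smooth_on U f -> smooth_on U g ->
  smooth_on U (fun x => f x + g x).
Proof. by move=> Uo fs gs k; exact: CkD. Qed.

Lemma smoothM U f g : open U -> smooth_on U f -> smooth_on U g ->
  smooth_on U (fun x => f x * g x).
Proof. by move=> Uo fs gs k; exact: CkM. Qed.

Lemma smoothN U f : open U -> smooth_on U f -> smooth_on U (fun x => - f x).
Proof.
move=> Uo fs; have := smoothM Uo (@smooth_cst U (-1)) fs.
by apply: smooth_eq => // x _; rewrite mulN1r.
Qed.

Lemma smoothB U f g : open U -> smooth_on U f -> smooth_on U g ->
  smooth_on U (fun x => f x - g x).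
Proof. by move=> Uo fs gs; apply: smoothD => //; exact: smoothN. Qed.

Lemma smooth_exp U f : open U -> smooth_on U f -> smooth_on U (fun x => expR (f x)).
Proof. by move=> Uo fs k; exact: Ck_expR. Qed.

Lemma smooth_sum (I : Type) (r : seq I) U (F : I -> 'rV[R]_n -> R) : open U ->
  (forall i, smooth_on U (F i)) -> smooth_on U (fun x => \sum_(i <- r) F i x).
Proof.
move=> Uo Fs; elim: r => [|i r IH].
  by apply: smooth_eq (@smooth_cst U 0) => // x _; rewrite big_nil.
by apply: smooth_eq (smoothD Uo (Fs i) IH) => // x _; rewrite big_cons.
Qed.

Lemma smooth_partial U f i : smooth_on U f -> smooth_on U (partial f i).
Proof. by move=> fs k; exact: Ck_partial (fs k.+1). Qed.

Lemma smooth_is_diff U f x : open U -> smooth_on U f -> U x ->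
  is_diff x (f : _ -> R^o) (pair1 (grad f x)).
Proof. by move=> Uo fs; exact: Ck1_is_diff (fs 1%N). Qed.

Lemma partial_comm U f i j x : open U -> smooth_on U f -> U x ->
  partial (partial f i) j x = partial (partial f j) i x.
Proof.
move=> Uo fs Ux; rewrite /partial; apply: (derive_comm (U := U)) => //.
- by move=> y; exact: Ck_derivable (fs 1%N).
- by move=> y; exact: Ck_derivable (fs 1%N).
- by move=> y; apply: Ck_derivable; exact: (smooth_partial i fs 1%N).
- by move=> y; apply: Ck_derivable; exact: (smooth_partial j fs 1%N).
- exact: (Ck_continuous (smooth_partial j (smooth_partial i fs) 0%N)).
- exact: (Ck_continuous (smooth_partial i (smooth_partial j fs) 0%N)).
Qed.

Lemma grad_eq_on U f g x : open U -> {in U, f =1 g} -> U x -> grad f x = grad g x.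
Proof.
by move=> Uo fg Ux; apply/colP => i; rewrite !mxE; exact: partial_eq_on fg Ux.
Qed.

Lemma grad_cst (a : R) x : grad (fun=> a) x = 0.
Proof. by apply/colP => i; rewrite !mxE /partial derive_cst. Qed.

Lemma partialD U f g i x : open U -> smooth_on U f -> smooth_on U g -> U x ->
  partial (fun y => f y + g y) i x = partial f i x + partial g i x.
Proof.
move=> Uo fs gs Ux.
by apply: deriveD; [exact: Ck_derivable (fs 1%N) Ux|exact: Ck_derivable (gs 1%N) Ux].
Qed.

Lemma partialM U f g i x : open U -> smooth_on U f -> smooth_on U g -> U x ->
  partial (fun y => f y * g y) i x = f x * partial g i x + g x * partial f i x.
Proof.
move=> Uo fs gs Ux.
by apply: deriveM; [exact: Ck_derivable (fs 1%N) Ux|exact: Ck_derivable (gs 1%N) Ux].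
Qed.

Lemma partial_sum U (I : Type) (r : seq I) (F : I -> 'rV[R]_n -> R) i x : open U ->
  (forall j, smooth_on U (F j)) -> U x ->
  partial (fun y => \sum_(j <- r) F j y) i x = \sum_(j <- r) partial (F j) i x.
Proof.
move=> Uo Fs Ux; elim: r => [|j r IH].
  rewrite big_nil (_ : (fun y => _) = fun=> 0); first by rewrite /partial derive_cst.
  by apply/funext => y; rewrite big_nil.
rewrite big_cons -IH -(partialD i Uo (Fs j) (smooth_sum r Uo Fs) Ux).
by congr (partial _ i x); apply/funext => y; rewrite big_cons.
Qed.

Lemma gradD U f g x : open U -> smooth_on U f -> smooth_on U g -> U x ->
  grad (fun y => f y + g y) x = grad f x + grad g x.
Proof. by move=> *; apply/colP => i; rewrite !mxE (@partialD U). Qed.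

Lemma gradM U f g x : open U -> smooth_on U f -> smooth_on U g -> U x ->
  grad (fun y => f y * g y) x = f x *: grad g x + g x *: grad f x.
Proof. by move=> *; apply/colP => i; rewrite !mxE (@partialM U). Qed.

Lemma gradN U f x : open U -> smooth_on U f -> U x ->
  grad (fun y => - f y) x = - grad f x.
Proof.
move=> Uo fs Ux.
rewrite (_ : (fun y => - f y) = fun y => (-1) * f y); last first.
  by apply/funext => y; rewrite mulN1r.
by rewrite (@gradM U) ?grad_cst ?scaler0 ?addr0 ?scaleN1r //; exact: smooth_cst.
Qed.

Lemma grad_sum U (I : Type) (r : seq I) (F : I -> 'rV[R]_n -> R) x : open U ->
  (forall j, smooth_on U (F j)) -> U x ->
  grad (fun y => \sum_(j <- r) F j y) x = \sum_(j <- r) grad (F j) x.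
Proof.
move=> Uo Fs Ux; apply/colP => i; rewrite !mxE (@partial_sum U) // summxE.
by apply: eq_bigr => j _; rewrite mxE.
Qed.

Lemma grad_expR U f x : open U -> smooth_on U f -> U x ->
  grad (fun y => expR (f y)) x = expR (f x) *: grad f x.
Proof.
move=> Uo fs Ux; apply/colP => i; rewrite !mxE.
have fd : differentiable (f : _ -> R^o) x by case: (smooth_is_diff Uo fs Ux).
have ed : differentiable (expR : R -> R^o) (f x) by apply/derivable1_diffP; exact: derivable_expR.
rewrite /partial deriveE; last exact: differentiable_comp.
rewrite diff_comp // -[LHS]/('d expR (f x) ('d (f : _ -> R^o) x (basis_vec R i))).
rewrite -(deriveE _ fd) /= -[X in 'd _ _ X]mulr1 -[X in 'd _ _ X]/(_ *: (1 : R^o)).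
by rewrite linearZ /= -deriveE // derive_val mulrC.
Qed.

End SmoothFunctions.

(** * Smooth maps between open sets, Jacobians and the chain rule *)

Section SmoothMaps.
Context (R : realType).

Lemma smooth_mx_subset n p q (U V : set 'rV[R]_n) (F : 'rV[R]_n -> 'M[R]_(p, q)) :
  V `<=` U -> smooth_on_mx U F -> smooth_on_mx V F.
Proof. by move=> VU Fs i j; exact: smooth_subset (Fs i j). Qed.

Lemma smooth_mx_eq n p q (U : set 'rV[R]_n) (F G : 'rV[R]_n -> 'M[R]_(p, q)) :
  open U -> {in U, F =1 G} -> smooth_on_mx U F -> smooth_on_mx U G.
Proof.
by move=> Uo FG Fs i j; apply: smooth_eq (Fs i j) => // x xU; rewrite FG.
Qed.

Lemma smooth_mx_id n (U : set 'rV[R]_n) : smooth_on_mx U (fun x => x).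
Proof. by move=> i j; rewrite (ord1 i); exact: smooth_coord. Qed.

Lemma smooth_mxM n p q s (U : set 'rV[R]_n) (F : 'rV[R]_n -> 'M[R]_(p, q))
    (G : 'rV[R]_n -> 'M[R]_(q, s)) : open U ->
  smooth_on_mx U F -> smooth_on_mx U G -> smooth_on_mx U (fun x => F x *m G x).
Proof.
move=> Uo Fs Gs i j.
apply: (@smooth_eq _ _ U (fun x => \sum_k F x i k * G x k j)) => //.
  by move=> x _; rewrite mxE.
by apply: smooth_sum => // k; apply: smoothM.
Qed.

Lemma smooth_mxD n p q (U : set 'rV[R]_n) (F G : 'rV[R]_n -> 'M[R]_(p, q)) : open U ->
  smooth_on_mx U F -> smooth_on_mx U G -> smooth_on_mx U (fun x => F x + G x).
Proof.
move=> Uo Fs Gs i j; apply: smooth_eq (smoothD Uo (Fs i j) (Gs i j)) => // x _.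
by rewrite mxE.
Qed.

Lemma smooth_mxN n p q (U : set 'rV[R]_n) (F : 'rV[R]_n -> 'M[R]_(p, q)) : open U ->
  smooth_on_mx U F -> smooth_on_mx U (fun x => - F x).
Proof.
move=> Uo Fs i j; apply: smooth_eq (smoothN Uo (Fs i j)) => // x _.
by rewrite mxE.
Qed.

Lemma smooth_mxZ n p q (U : set 'rV[R]_n) (f : 'rV[R]_n -> R)
    (F : 'rV[R]_n -> 'M[R]_(p, q)) : open U ->
  smooth_on U f -> smooth_on_mx U F -> smooth_on_mx U (fun x => f x *: F x).
Proof.
move=> Uo fs Fs i j; apply: smooth_eq (smoothM Uo fs (Fs i j)) => // x _.
by rewrite mxE.
Qed.

Lemma smooth_mx_tr n p q (U : set 'rV[R]_n) (F : 'rV[R]_n -> 'M[R]_(p, q)) : open U ->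
  smooth_on_mx U F -> smooth_on_mx U (fun x => (F x)^T).
Proof.
by move=> Uo Fs i j; apply: smooth_eq (Fs j i) => // x _; rewrite mxE.
Qed.

Section Jacobian.
Context (n m : nat).
Implicit Types (U : set 'rV[R]_n) (F G : 'rV[R]_n -> 'rV[R]_m) (x : 'rV[R]_n).

Lemma differentiable_row F x :
  (forall j, differentiable (fun y => F y 0 j : R^o) x) -> differentiable F x.
Proof.
move=> Fd; have -> : F = \sum_j (fun y => F y 0 j *: (delta_mx 0 j : 'rV[R]_m)).
  by apply/funext => y; rewrite fct_sumE [LHS]row_sum_delta.
by apply: differentiable_sum => j; apply: differentiableZl; exact: Fd.
Qed.

Lemma smooth_differentiable U F x : open U -> smooth_on_mx U F -> U x ->
  differentiable F x.
Proof.
move=> Uo Fs Ux; apply: differentiable_row => j.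
by case: (smooth_is_diff Uo (Fs 0 j) Ux).
Qed.

Lemma smooth_map_continuous U F x : open U -> smooth_on_mx U F -> U x ->
  {for x, continuous F}.
Proof.
move=> Uo Fs Ux; apply: differentiable_continuous.
exact: smooth_differentiable Uo Fs Ux.
Qed.

Lemma jacobianE U F x : open U -> smooth_on_mx U F -> U x ->
  jacobian F x = \matrix_(i, j) partial (fun y => F y 0 j) i x.
Proof.
move=> Uo Fs Ux; apply/row_matrixP => i; apply/rowP => j.
rewrite rowE -deriveEjacobian; last exact: smooth_differentiable Uo Fs Ux.
rewrite derive_mx; last exact/diff_derivable/(smooth_differentiable Uo Fs Ux).
by rewrite !mxE.
Qed.

Lemma jacobian_eq_on U F G x : open U -> {in U, F =1 G} -> smooth_on_mx U F -> U x ->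
  jacobian F x = jacobian G x.
Proof.
move=> Uo FG Fs Ux; rewrite (jacobianE Uo Fs Ux).
rewrite (jacobianE Uo (smooth_mx_eq Uo FG Fs) Ux).
apply/matrixP => i j; rewrite !mxE; apply: partial_eq_on Uo _ Ux => y yU.
by rewrite FG.
Qed.

Lemma smooth_jacobian U F : open U -> smooth_on_mx U F -> smooth_on_mx U (jacobian F).
Proof.
move=> Uo Fs i j; apply: smooth_eq (smooth_partial i (Fs 0 j)) => // x.
by rewrite inE => Ux; rewrite (jacobianE Uo Fs Ux) mxE.
Qed.

End Jacobian.

Lemma jacobian_id n (x : 'rV[R]_n) : jacobian id x = 1%:M.
Proof.
apply/row_matrixP => i; rewrite rowE -deriveEjacobian ?derive_id ?row1 //.
Qed.

Section Composition.
Context (n m : nat).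
Implicit Types (U : set 'rV[R]_n) (V : set 'rV[R]_m) (F : 'rV[R]_n -> 'rV[R]_m).

Lemma grad_comp U V F (g : 'rV[R]_m -> R) x : open U -> open V ->
  smooth_on_mx U F -> smooth_on V g -> U x -> V (F x) ->
  grad (fun y => g (F y)) x = jacobian F x *m grad g (F x).
Proof.
move=> Uo Vo Fs gs Ux VFx; have Fd := smooth_differentiable Uo Fs Ux.
have [gd gE] := smooth_is_diff Vo gs VFx.
apply/colP => i; rewrite [LHS]mxE /partial deriveE; last exact: differentiable_comp.
rewrite diff_comp // -[LHS]/('d (g : _ -> R^o) (F x) ('d F x (basis_vec R i))) gE.
by rewrite /pair1 -deriveE // deriveEjacobian // -mulmxA -rowE mxE.
Qed.

(** Induction on [k]: the partial derivatives of the composite are sums of products of a smooth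
    derivative of [F] with a C^k derivative of [g] composed with [F]. Only the order of [g]
    drops. *)
Lemma Ck_comp k U V F (g : 'rV[R]_m -> R) : open U -> open V ->
  smooth_on_mx U F -> Ck k V g -> (forall x, U x -> V (F x)) ->
  Ck k U (fun y => g (F y)).
Proof.
move=> Uo Vo Fs; elim: k g => [|k IH] g Cg FV; have [gc gd] := Cg;
  (split; first by move=> x Ux; apply: continuous_comp;
    [exact: smooth_map_continuous Uo Fs Ux|exact: gc (FV _ Ux)]) => //.
move=> i.
have H x : U x -> is_derive x (basis_vec R i) (fun y => g (F y) : R^o)
   (\sum_j partial (fun y => F y 0 j) i x * partial g j (F x)).
  move=> Ux; have Fd := smooth_differentiable Uo Fs Ux.
  have [gd1 gE] : is_diff (F x) (g : _ -> R^o) (pair1 (grad g (F x))).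
    apply: Ck1_is_diff Vo _ (FV _ Ux).
    by elim: (k) Cg => [//|k' IHk] C; apply/IHk/CkS.
  apply: DeriveDef; first exact/diff_derivable/differentiable_comp.
  rewrite deriveE; last exact: differentiable_comp.
  rewrite diff_comp // -[LHS]/('d (g : _ -> R^o) (F x) ('d F x (basis_vec R i))) gE.
  rewrite /pair1 -deriveE // deriveEjacobian // -mulmxA -rowE (jacobianE Uo Fs Ux).
  by rewrite !mxE; apply: eq_bigr => j _; rewrite !mxE.
split; first by move=> x /H [].
apply: (@Ck_eq _ _ _ _ (fun x =>
    \sum_j partial (fun y => F y 0 j) i x * partial g j (F x))) => //.
  by move=> x; rewrite inE => /H [_ <-].
have Hj j : Ck k U (fun x => partial (fun y => F y 0 j) i x * partial g j (F x)).
  apply: CkM => //; first exact: (smooth_partial i (Fs 0 j)).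
  by apply: IH => //; exact: Ck_partial Cg.
elim: (index_enum _) => [|j r IHr].
  by apply: Ck_eq (@Ck_cst _ _ _ U 0) => // x _; rewrite big_nil.
by apply: Ck_eq (CkD Uo (Hj j) IHr) => // x _; rewrite big_cons.
Qed.

Lemma smooth_comp U V F (g : 'rV[R]_m -> R) : open U -> open V ->
  smooth_on_mx U F -> smooth_on V g -> (forall x, U x -> V (F x)) ->
  smooth_on U (fun y => g (F y)).
Proof. by move=> Uo Vo Fs gs FV k; exact: Ck_comp (gs k) FV. Qed.

Lemma smooth_mx_comp p q U V F (G : 'rV[R]_m -> 'M[R]_(p, q)) : open U -> open V ->
  smooth_on_mx U F -> smooth_on_mx V G -> (forall x, U x -> V (F x)) ->
  smooth_on_mx U (fun y => G (F y)).
Proof.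
by move=> Uo Vo Fs Gs FV i j; exact: (smooth_comp Uo Vo Fs (Gs i j) FV).
Qed.

Lemma jacobian_comp p U V F (G : 'rV[R]_m -> 'rV[R]_p) x : open U -> open V ->
  smooth_on_mx U F -> smooth_on_mx V G -> U x -> V (F x) ->
  jacobian (fun y => G (F y)) x = jacobian F x *m jacobian G (F x).
Proof.
move=> Uo Vo Fs Gs Ux VFx; have Fd := smooth_differentiable Uo Fs Ux.
have Gd := smooth_differentiable Vo Gs VFx.
apply/row_matrixP => i; rewrite rowE -deriveEjacobian; last exact: differentiable_comp.
rewrite deriveE; last exact: differentiable_comp.
rewrite diff_comp // -[LHS]/('d G (F x) ('d F x (delta_mx 0 i))).
by rewrite -!deriveE // !deriveEjacobian // rowE mulmxA.
Qed.

End Composition.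
End SmoothMaps.

(** * Locality of smoothness, and the exterior derivative in coordinates *)

Section LocalSmoothness.
Context (R : realType) (n : nat).

Lemma Ck_local k (U : set 'rV[R]_n) (f : 'rV[R]_n -> R^o) :
  (forall x, U x -> exists V : set 'rV[R]_n, [/\ open V, V x & Ck k V f]) -> Ck k U f.
Proof.
elim: k f => [|k IH] f H.
  by split => // x /H [V [Vo Vx [fc _]]]; exact: fc.
split; first by move=> x /H [V [Vo Vx [fc _]]]; exact: fc.
move=> i; split; first by move=> x /H [V [Vo Vx Cf]]; exact: Ck_derivable Cf Vx.
by apply: IH => x /H [V [Vo Vx Cf]]; exists V; split => //; exact: Ck_partial Cf.
Qed.

Lemma smooth_local (U : set 'rV[R]_n) (f : 'rV[R]_n -> R) :
  (forall x, U x -> exists V : set 'rV[R]_n, [/\ open V, V x & smooth_on V f]) ->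
  smooth_on U f.
Proof.
by move=> H k; apply: Ck_local => x /H [V [Vo Vx fs]]; exists V; split.
Qed.

Lemma smooth_mx_local p q (U : set 'rV[R]_n) (F : 'rV[R]_n -> 'M[R]_(p, q)) :
  (forall x, U x -> exists V : set 'rV[R]_n, [/\ open V, V x & smooth_on_mx V F]) ->
  smooth_on_mx U F.
Proof.
move=> H i j; apply: smooth_local => x /H [V [Vo Vx Fs]].
by exists V; split => //; exact: Fs.
Qed.

Lemma open_preimage (S T : topologicalType) (O : set S) (phi : S -> T) (A : set T) :
  open O -> (forall x, O x -> {for x, continuous phi}) -> open A ->
  open (O `&` phi @^-1` A).
Proof.
rewrite !openE => Oo pc Ao x [Ox Ax].
apply: filterI; first exact: Oo.
by apply: (pc x Ox); exact: Ao.
Qed.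

(** The matrix of the exterior derivative of the 1-form with components [t]. *)
Definition dmx (t : 'rV[R]_n -> 'cV[R]_n) (x : 'rV[R]_n) : 'M[R]_n :=
  \matrix_(i, j) (partial (fun y => t y j 0) i x - partial (fun y => t y i 0) j x).

End LocalSmoothness.

(** The algebra behind the commutation of d with pull-back. [J] is the Jacobian, [D] the derivatives
    of the form, [tau] its components and [H] the second derivatives of the map, which drop out by
    symmetry. *)
Lemma curl_sum (R : comRingType) n m (J : 'I_n -> 'I_m -> R) (D : 'I_m -> 'I_m -> R)
    (tau : 'I_m -> R) (H : 'I_m -> 'I_n -> 'I_n -> R) i j :
  (forall a, H a i j = H a j i) ->
  \sum_a (J j a * (\sum_b J i b * D b a) + tau a * H a j i) -
  \sum_a (J i a * (\sum_b J j b * D b a) + tau a * H a i j) =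
  \sum_a (\sum_b J i b * (D b a - D a b)) * J j a.
Proof.
move=> HE; rewrite !big_split /=.
have -> : \sum_a tau a * H a i j = \sum_a tau a * H a j i.
  by apply: eq_bigr => a _; rewrite HE.
rewrite opprD addrACA subrr addr0.
have -> : \sum_a J i a * (\sum_b J j b * D b a) = \sum_a J j a * \sum_b J i b * D a b.
  under eq_bigr do rewrite mulr_sumr.
  rewrite exchange_big; apply: eq_bigr => a _; rewrite mulr_sumr.
  by apply: eq_bigr => b _; rewrite mulrCA.
rewrite -sumrB; apply: eq_bigr => a _; rewrite -mulrBr -sumrB mulrC.
by congr (_ * _); apply: eq_bigr => b _; rewrite mulrBr.
Qed.

Lemma dmx_pullback (R : realType) (n m : nat) (U : set 'rV[R]_n) (V : set 'rV[R]_m)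
    (F : 'rV[R]_n -> 'rV[R]_m) (t : 'rV[R]_m -> 'cV[R]_m) x :
  open U -> open V -> smooth_on_mx U F -> smooth_on_mx V t ->
  (forall y, U y -> V (F y)) -> U x ->
  dmx (fun y => jacobian F y *m t (F y)) x =
  jacobian F x *m dmx t (F x) *m (jacobian F x)^T.
Proof.
move=> Uo Vo Fs ts FV Ux.
pose Fj j y := F y 0 j.
pose J i a := partial (Fj a) i x.
pose D b a := partial (fun z => t z a 0) b (F x).
pose H a j i := partial (partial (Fj a) j) i x.
have tFs a : smooth_on U (fun y => t (F y) a 0) by exact: (smooth_comp Uo Vo Fs (ts a 0) FV).
have E i j : partial (fun y => (jacobian F y *m t (F y)) j 0) i x =
   \sum_a (J j a * (\sum_b J i b * D b a) + t (F x) a 0 * H a j i).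
  rewrite (@partial_eq_on _ _ U _
    (fun y => \sum_a partial (Fj a) j y * t (F y) a 0)) //; last first.
    move=> y; rewrite inE => Uy; rewrite mxE; apply: eq_bigr => a _.
    by rewrite (jacobianE Uo Fs Uy) mxE.
  rewrite (@partial_sum _ _ U _ _ (fun a y => partial (Fj a) j y * t (F y) a 0)) //; last first.
    by move=> a; apply: smoothM => //; apply: smooth_partial; exact: Fs.
  apply: eq_bigr => a _; rewrite (@partialM _ _ U) //; last first.
    by apply: smooth_partial; exact: Fs.
  congr (_ * _ + _).
  have := grad_comp Uo Vo Fs (ts a 0) Ux (FV _ Ux).
  move/colP/(_ i); rewrite [LHS]mxE => ->.
  by rewrite (jacobianE Uo Fs Ux) mxE; apply: eq_bigr => b _; rewrite !mxE.
apply/matrixP => i j; rewrite [LHS]mxE [X in X - _]E [X in _ - X]E curl_sum; last first.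
  by move=> a; apply: partial_comm Uo (Fs 0 a) Ux.
have JE : jacobian F x = \matrix_(i, a) J i a by exact: jacobianE Uo Fs Ux.
have DE : dmx t (F x) = \matrix_(b, a) (D b a - D a b) by [].
rewrite JE DE [RHS]mxE; apply: eq_bigr => a _.
by rewrite !mxE; congr (_ * _); apply: eq_bigr => b _; rewrite !mxE.
Qed.

(** * Manifolds, plots and tensor fields *)

Section Charts.
Context (R : realType) (n : nat) (M : manifold R n).
Implicit Types (p : M) (c d : chart R M n).

Lemma chart_at_atlas p : atlas (chart_at p).
Proof. exact: (s2valP (cid2 (atlas_cover p))). Qed.

Lemma chart_at_dom p : dom (chart_at p) p.
Proof. exact: (s2valP' (cid2 (atlas_cover p))). Qed.

Lemma coord_img p : img (chart_at p) (Defs.coord p).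
Proof. by exists p => //; exact: chart_at_dom. Qed.

Lemma coordK p : par (chart_at p) (Defs.coord p) = p.
Proof. by rewrite crdK //; exact: chart_at_dom. Qed.

Lemma par_dom c x : img c x -> dom c (par c x).
Proof. by case=> p cp <-; rewrite crdK. Qed.

Lemma parK c x : img c x -> crd c (par c x) = x.
Proof. by case=> p cp <-; rewrite crdK. Qed.

Lemma crd_img c p : dom c p -> img c (crd c p).
Proof. by move=> cp; exists p. Qed.

Lemma crd_imageE c (A : set M) : crd c @` (dom c `&` A) = img c `&` par c @^-1` A.
Proof.
apply/seteqP; split => [_ [p [cp Ap] <-]|x [cx Ax]].
  by split; [exact: crd_img|rewrite /= crdK].
by exists (par c x); [split => //; exact: par_dom|exact: parK].
Qed.

Lemma open_crd_image c (A : set M) : open A -> open (crd c @` (dom c `&` A)).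
Proof.
move=> Ao; rewrite crd_imageE; apply: open_preimage => //; first exact: img_open.
exact: par_continuous.
Qed.

End Charts.

(** * Plots and their Jacobians *)

Section Plots.
Context (R : realType) (k n : nat) (M : manifold R n).
Implicit Types (O : set 'rV[R]_k) (sigma : 'rV[R]_k -> M).

(** Plots may have any source dimension and need not be injective. Inverse charts are plots, and so
    are their composites with smooth maps, hence one calculus serves for tensors and for their
    pull-backs. *)
Definition smooth_plot O sigma : Prop :=
  [/\ open O, forall x, O x -> {for x, continuous sigma} &
    forall d, atlas d ->
      smooth_on_mx (O `&` sigma @^-1` dom d) (fun x => crd d (sigma x))].

(* Its row space is the tangent image of [sigma], in the chart at [sigma x]. *)
Definition plot_jac sigma x : 'M[R]_(k, n) :=
  jacobian (fun y => crd (chart_at (sigma x)) (sigma y)) x.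

Lemma open_plot O sigma (A : set M) : smooth_plot O sigma -> open A ->
  open (O `&` sigma @^-1` A).
Proof. by case=> Oo sc _ Ao; exact: open_preimage. Qed.

Lemma plot_subset O O' sigma : open O' -> O' `<=` O -> smooth_plot O sigma ->
  smooth_plot O' sigma.
Proof.
move=> Oo' sub [Oo sc ss]; split => //; first by move=> x /sub /sc.
by move=> d /ss; apply: smooth_mx_subset => x [/sub].
Qed.

Lemma plot_smooth_at O sigma x : smooth_plot O sigma -> O x ->
  let d := chart_at (sigma x) in let W := O `&` sigma @^-1` dom d in
  [/\ open W, W x & smooth_on_mx W (fun y => crd d (sigma y))].
Proof.
move=> sp Ox d W; split.
- exact: open_plot sp (dom_open d).
- by split => //; exact: chart_at_dom.
- by case: sp => _ _; apply; exact: chart_at_atlas.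
Qed.

Lemma plot_jac_eq O sigma tau x : smooth_plot O sigma -> {in O, sigma =1 tau} ->
  O x -> plot_jac sigma x = plot_jac tau x.
Proof.
move=> sp st Ox; have [Wo Wx Ws] := plot_smooth_at sp Ox.
have xO : x \in O by rewrite inE.
rewrite /plot_jac -(st x xO); apply: (jacobian_eq_on Wo _ Ws Wx) => y.
by rewrite inE => -[Oy _]; rewrite (st y) // inE.
Qed.

End Plots.

Section PlotComposition.
Context (R : realType).

Lemma plot_jac_reparam k l n (M : manifold R n) (O : set 'rV[R]_k) (O' : set 'rV[R]_l)
    (F : 'rV[R]_k -> 'rV[R]_l) (sigma : 'rV[R]_l -> M) x :
  open O -> smooth_on_mx O F -> (forall x, O x -> O' (F x)) -> smooth_plot O' sigma ->
  O x -> plot_jac (sigma \o F) x = jacobian F x *m plot_jac sigma (F x).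
Proof.
move=> Oo Fs FO sp Ox; have [Wo Wx Ws] := plot_smooth_at sp (FO _ Ox).
exact: jacobian_comp Oo Wo Fs Ws Ox Wx.
Qed.

Lemma par_plot n (M : manifold R n) (c : chart R M n) : atlas c ->
  smooth_plot (img c) (par c).
Proof.
move=> cA; split; [exact: img_open|exact: par_continuous|move=> d dA].
by have := atlas_compat cA dA; rewrite crd_imageE.
Qed.

Lemma plot_jac_par n (M : manifold R n) (c : chart R M n) x :
  plot_jac (par c) x = of_chart c x.
Proof. by []. Qed.

Lemma plot_jac_chart k n (M : manifold R n) (O : set 'rV[R]_k) (sigma : 'rV[R]_k -> M)
    (c : chart R M n) x : smooth_plot O sigma -> atlas c -> O x -> dom c (sigma x) ->
  plot_jac sigma x = jacobian (fun y => crd c (sigma y)) x *m of_chart c (crd c (sigma x)).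
Proof.
move=> sp cA Ox cx; have Wo := open_plot sp (dom_open c).
have ss : smooth_on_mx (O `&` sigma @^-1` dom c) (fun y => crd c (sigma y)).
  by case: sp => _ _; apply.
have Wx : (O `&` sigma @^-1` dom c) x by [].
rewrite -plot_jac_par -(plot_jac_reparam Wo ss _ (par_plot cA) Wx); last first.
  by move=> y [_]; exact: crd_img.
apply: plot_jac_eq Wx; first by apply: plot_subset sp => // y [].
by move=> y; rewrite inE => -[_ cy] /=; rewrite crdK.
Qed.

Lemma of_chart_coord n (M : manifold R n) (p : M) : of_chart (chart_at p) (Defs.coord p) = 1%:M.
Proof.
rewrite /of_chart coordK -(jacobian_id (Defs.coord p)).
apply/esym/(@jacobian_eq_on _ _ _ (img (chart_at p))).
- exact: img_open.
- by move=> y; rewrite inE => Uy; rewrite parK.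
- exact: smooth_mx_id.
- exact: coord_img.
Qed.

Lemma to_chart_coord n (M : manifold R n) (p : M) : to_chart (chart_at p) p = 1%:M.
Proof.
rewrite /to_chart -(jacobian_id (Defs.coord p)).
apply/esym/(@jacobian_eq_on _ _ _ (img (chart_at p))).
- exact: img_open.
- by move=> y; rewrite inE => Uy; rewrite parK.
- exact: smooth_mx_id.
- exact: coord_img.
Qed.

Lemma of_to_chart n (M : manifold R n) (c : chart R M n) x : atlas c -> img c x ->
  of_chart c x *m to_chart c (par c x) = 1%:M.
Proof.
move=> cA cx; set p := par c x; set d := chart_at p.
have dA : atlas d := chart_at_atlas p.
have dp : dom d p := chart_at_dom p.
have cp : dom c p := par_dom cx.
have s1 := atlas_compat cA dA; have s2 := atlas_compat dA cA.
have o1 := @open_crd_image _ _ _ c _ (dom_open d).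
have o2 := @open_crd_image _ _ _ d _ (dom_open c).
have U1 : (crd c @` (dom c `&` dom d)) x by rewrite crd_imageE.
have xE : crd d (par c x) = Defs.coord p by [].
have U2 : (crd d @` (dom d `&` dom c)) (Defs.coord p) by exists p.
rewrite /of_chart -/p -/d /to_chart -/d -xE -(jacobian_comp o1 o2 s1 s2 U1 U2).
rewrite -(jacobian_id x); apply/esym/(jacobian_eq_on o1) => //; last exact: smooth_mx_id.
move=> y; rewrite inE crd_imageE => -[cy dy] /=.
by rewrite crdK // parK.
Qed.

Lemma to_of_chart n (M : manifold R n) (c : chart R M n) x : atlas c -> img c x ->
  to_chart c (par c x) *m of_chart c x = 1%:M.
Proof. by move=> cA cx; apply: mulmx1C; exact: of_to_chart. Qed.

End PlotComposition.

(** * Smooth maps and tangent maps along plots *)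

Section MapsOnPlots.
Context (R : realType) (m n : nat) (M : manifold R m) (N : manifold R n).
Implicit Types (phi : M -> N).

Lemma plot_comp k (O : set 'rV[R]_k) (sigma : 'rV[R]_k -> M) phi :
  smooth_map phi -> smooth_plot O sigma -> smooth_plot O (phi \o sigma).
Proof.
move=> [pc ps] sp; have [Oo sc ss] := sp; split => //.
  by move=> x Ox; apply: continuous_comp; [exact: sc|exact: pc].
move=> d dA; apply: smooth_mx_local => x [Ox dx].
set c := chart_at (sigma x); have cA : atlas c := chart_at_atlas (sigma x).
pose A := dom c `&` phi @^-1` dom d.
have phid : open (phi @^-1` dom d) by move/continuousP: pc; apply; exact: dom_open.
have Ao : open A by apply: openI => //; exact: dom_open.
exists (O `&` sigma @^-1` A); split; first exact: open_plot sp Ao.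
  by split => //; split => //; exact: chart_at_dom.
apply: (@smooth_mx_eq _ _ _ _ _ (fun y => crd d (phi (par c (crd c (sigma y)))))).
- exact: open_plot sp Ao.
- by move=> y; rewrite inE => -[Oy [cy _]] /=; rewrite crdK.
have Vo := @open_crd_image _ _ _ c _ phid.
apply: (@smooth_mx_comp R k m 1 n _ _ (fun y => crd c (sigma y))
  (fun x => crd d (phi (par c x))) (open_plot sp Ao) Vo _ (ps c d cA dA)).
  by apply: smooth_mx_subset (ss c cA) => y [Oy [cy _]].
by move=> y [Oy Ay]; exists (sigma y).
Qed.

Lemma plot_jac_comp k (O : set 'rV[R]_k) (sigma : 'rV[R]_k -> M) phi x :
  smooth_map phi -> smooth_plot O sigma -> O x ->
  plot_jac (phi \o sigma) x = plot_jac sigma x *m tangent phi (sigma x).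
Proof.
move=> [pc ps] sp Ox; have [Oo sc ss] := sp.
set p := sigma x; set c := chart_at p; set d := chart_at (phi p).
have cA : atlas c := chart_at_atlas _.
have dA : atlas d := chart_at_atlas _.
pose A := dom c `&` phi @^-1` dom d.
have phid : open (phi @^-1` dom d) by move/continuousP: pc; apply; exact: dom_open.
have Ao : open A by apply: openI => //; exact: dom_open.
have Uo := open_plot sp Ao.
have Ap : A p by split; exact: chart_at_dom.
have Ux : (O `&` sigma @^-1` A) x by [].
have Vo := @open_crd_image _ _ _ c _ phid.
have Fs : smooth_on_mx (O `&` sigma @^-1` A) (fun y => crd c (sigma y)).
  by apply: smooth_mx_subset (ss c cA) => y [Oy [cy _]].
have VF y : (O `&` sigma @^-1` A) y -> (crd c @` (dom c `&` phi @^-1` dom d)) (crd c (sigma y)).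
  by move=> [Oy Ay]; exists (sigma y).
apply: (etrans _ (jacobian_comp Uo Vo Fs (ps c d cA dA) Ux (VF _ Ux))).
apply/esym/(jacobian_eq_on Uo _ _ Ux).
  by move=> y; rewrite inE => -[Oy [cy _]]; rewrite /= crdK.
exact: (@smooth_mx_comp R k m 1 n _ _ (fun y => crd c (sigma y))
  (fun x => crd d (phi (par c x))) Uo Vo Fs (ps c d cA dA) VF).
Qed.

Lemma smooth_mapP phi : smooth_map phi <->
  continuous phi /\ forall c : chart R M m, atlas c -> smooth_plot (img c) (phi \o par c).
Proof.
split=> [ps|[pc ps]].
  by split; [case: ps|move=> c cA; exact: plot_comp ps (par_plot cA)].
split => // c d cA dA; rewrite crd_imageE.
by have [_ _] := ps c cA; apply.
Qed.

Lemma tangentE phi p : smooth_map phi ->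
  tangent phi p = plot_jac (phi \o par (chart_at p)) (Defs.coord p).
Proof.
move=> ps; rewrite (plot_jac_comp ps (par_plot (chart_at_atlas p)) (coord_img p)).
by rewrite plot_jac_par of_chart_coord mul1mx coordK.
Qed.

End MapsOnPlots.

Section Functoriality.
Context (R : realType).

Lemma smooth_map_comp m n l (M : manifold R m) (N : manifold R n) (L : manifold R l)
    (phi : M -> N) (psi : N -> L) :
  smooth_map phi -> smooth_map psi -> smooth_map (psi \o phi).
Proof.
move=> ps qs; apply/smooth_mapP; split.
  by move=> x; apply: continuous_comp; [case: ps => pc _; exact: pc|case: qs => qc _; exact: qc].
by move=> c cA; apply: (plot_comp qs (plot_comp ps (par_plot cA))).
Qed.

Lemma smooth_map_id m (M : manifold R m) : smooth_map (fun p : M => p).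
Proof. by apply/smooth_mapP; split; [move=> x; exact: cvg_id|move=> c; exact: par_plot]. Qed.

Lemma tangent_comp m n l (M : manifold R m) (N : manifold R n) (L : manifold R l)
    (phi : M -> N) (psi : N -> L) p : smooth_map phi -> smooth_map psi ->
  tangent (psi \o phi) p = tangent phi p *m tangent psi (phi p).
Proof.
move=> ps qs; have cp := par_plot (chart_at_atlas p).
rewrite (tangentE _ (smooth_map_comp ps qs)) (tangentE _ ps).
rewrite (plot_jac_comp (sigma := phi \o par (chart_at p)) qs (plot_comp ps cp) (coord_img p)).
by rewrite /= coordK.
Qed.

Lemma tangent_id m (M : manifold R m) (p : M) : tangent (fun q : M => q) p = 1%:M.
Proof.
by rewrite (tangentE _ (smooth_map_id M)) plot_jac_par of_chart_coord.
Qed.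

End Functoriality.

(** * Functions and 1-forms along plots *)

Section TensorsOnPlots.
Context (R : realType) (n : nat) (M : manifold R n).
Implicit Types (f g : M -> R) (t : field1 M) (w L : field2 M) (X : vec_field M).

Lemma smooth_fun_plot k (O : set 'rV[R]_k) (sigma : 'rV[R]_k -> M) f :
  smooth_fun f -> smooth_plot O sigma -> smooth_on O (f \o sigma).
Proof.
move=> fs sp; have [Oo sc ss] := sp; apply: smooth_local => x Ox.
have [Wo Wx Ws] := plot_smooth_at sp Ox.
exists (O `&` sigma @^-1` dom (chart_at (sigma x))); split => //.
set c := chart_at (sigma x).
apply: (@smooth_eq _ _ _ (fun y => f (par c (crd c (sigma y))))) => //.
  by move=> y; rewrite inE => -[Oy cy] /=; rewrite crdK.
have fsc := fs c (chart_at_atlas _).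
apply: (smooth_comp Wo (@img_open _ _ _ c) Ws fsc) => y [_].
exact: crd_img.
Qed.

Lemma grad_plot k (O : set 'rV[R]_k) (sigma : 'rV[R]_k -> M) f x :
  smooth_fun f -> smooth_plot O sigma -> O x ->
  grad (f \o sigma) x = plot_jac sigma x *m d0 f (sigma x).
Proof.
move=> fs sp Ox; have [Wo Wx Ws] := plot_smooth_at sp Ox.
set c := chart_at (sigma x).
have fsc := fs c (chart_at_atlas _).
have cx : img c (crd c (sigma x)) by exact/crd_img/chart_at_dom.
apply: (etrans _ (grad_comp Wo (@img_open _ _ _ c) Ws fsc Wx cx)).
apply/esym/(grad_eq_on Wo _ Wx) => y.
by rewrite inE => -[Oy cy] /=; rewrite crdK.
Qed.

Definition plot_pull1 k (sigma : 'rV[R]_k -> M) t x : 'cV[R]_k :=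
  plot_jac sigma x *m t (sigma x).

(** The factors of [plot_pull1] refer to the chart at [sigma x], which jumps with [x]. In the fixed
    chart [c] they become smooth, and the pull-back becomes one by a map between open sets of
    coordinate spaces. *)
Lemma plot_pull1E k (O : set 'rV[R]_k) (sigma : 'rV[R]_k -> M) t (c : chart R M n) x :
  smooth_plot O sigma -> atlas c -> O x -> dom c (sigma x) ->
  plot_pull1 sigma t x =
  jacobian (fun y => crd c (sigma y)) x *m local1 t c (crd c (sigma x)).
Proof.
move=> sp cA Ox cx; rewrite /plot_pull1 (plot_jac_chart sp cA Ox cx) -mulmxA.
by rewrite /local1 crdK.
Qed.

Lemma smooth_plot_pull1 k (O : set 'rV[R]_k) (sigma : 'rV[R]_k -> M) t :
  form1 t -> smooth_plot O sigma -> smooth_on_mx O (plot_pull1 sigma t).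
Proof.
move=> ts sp; apply: smooth_mx_local => x Ox.
have [Wo Wx Ws] := plot_smooth_at sp Ox.
set c := chart_at (sigma x) in Wo Wx Ws *; set W := O `&` _ in Wo Wx Ws *.
have cA : atlas c := chart_at_atlas _.
exists W; split => //.
apply: (@smooth_mx_eq _ _ _ _ _ (fun y =>
  jacobian (fun y => crd c (sigma y)) y *m local1 t c (crd c (sigma y)))) => //.
  by move=> y; rewrite inE => -[Oy cy]; rewrite (plot_pull1E _ sp cA Oy cy).
apply: smooth_mxM => //; first exact: smooth_jacobian.
apply: (@smooth_mx_comp _ _ _ _ _ _ _ (fun y => crd c (sigma y)) (local1 t c)
  Wo (@img_open _ _ _ c) Ws (ts c cA)) => y [_].
exact: crd_img.
Qed.

Lemma dmx_plot_pull1 k (O : set 'rV[R]_k) (sigma : 'rV[R]_k -> M) t x :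
  form1 t -> smooth_plot O sigma -> O x ->
  dmx (plot_pull1 sigma t) x =
  plot_jac sigma x *m d1 t (sigma x) *m (plot_jac sigma x)^T.
Proof.
move=> ts sp Ox; have [Wo Wx Ws] := plot_smooth_at sp Ox.
set c := chart_at (sigma x) in Wo Wx Ws *; set W := O `&` _ in Wo Wx Ws *.
have cA : atlas c := chart_at_atlas _.
have E : dmx (plot_pull1 sigma t) x =
  dmx (fun y => jacobian (fun y => crd c (sigma y)) y *m local1 t c (crd c (sigma y))) x.
  apply/matrixP => i j; rewrite !mxE; congr (_ - _); apply: (partial_eq_on _ Wo _ Wx) => y;
  by rewrite inE => -[Oy cy]; rewrite (plot_pull1E _ sp cA Oy cy).
rewrite E (@dmx_pullback _ _ _ W (img c)) //; [exact: img_open|exact: ts|].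
by move=> y [_]; exact: crd_img.
Qed.

Lemma local2_d1 t (c : chart R M n) x : form1 t -> atlas c -> img c x ->
  local2 (d1 t) c x = dmx (local1 t c) x.
Proof. by move=> ts cA cx; rewrite (dmx_plot_pull1 ts (par_plot cA) cx). Qed.

End TensorsOnPlots.

Section FunctionCalculus.
Context (R : realType) (n : nat) (M : manifold R n).
Implicit Types (f g : M -> R) (p : M).

Let near_chart p : let c := chart_at p in [/\ open (img c), img c (Defs.coord p) & atlas c].
Proof. by split; [exact: img_open|exact: coord_img|exact: chart_at_atlas]. Qed.

Lemma smooth_funN f : smooth_fun f -> smooth_fun (fun p => - f p).
Proof. by move=> fs c cA; apply: smoothN; [exact: img_open|exact: fs]. Qed.

Lemma smooth_fun_exp f : smooth_fun f -> smooth_fun (fun p => expR (f p)).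
Proof. by move=> fs c cA; apply: smooth_exp; [exact: img_open|exact: fs]. Qed.

Lemma d0D f g p : smooth_fun f -> smooth_fun g ->
  d0 (fun q => f q + g q) p = d0 f p + d0 g p.
Proof.
by move=> fs gs; have [co ci ca] := near_chart p; exact: gradD co (fs _ ca) (gs _ ca) ci.
Qed.

Lemma d0M f g p : smooth_fun f -> smooth_fun g ->
  d0 (fun q => f q * g q) p = f p *: d0 g p + g p *: d0 f p.
Proof.
move=> fs gs; have [co ci ca] := near_chart p; rewrite -{2 4}(coordK p).
exact: gradM co (fs _ ca) (gs _ ca) ci.
Qed.

Lemma d0N f p : smooth_fun f -> d0 (fun q => - f q) p = - d0 f p.
Proof. by move=> fs; have [co ci ca] := near_chart p; exact: gradN co (fs _ ca) ci. Qed.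

Lemma d0_cst (a : R) p : d0 (fun=> a : R) p = 0.
Proof. exact: grad_cst. Qed.

Lemma d0_exp f p : smooth_fun f -> d0 (fun q => expR (f q)) p = expR (f p) *: d0 f p.
Proof.
move=> fs; have [co ci ca] := near_chart p; rewrite -{2}(coordK p).
exact: grad_expR co (fs _ ca) ci.
Qed.

End FunctionCalculus.

(** * Pull-back by smooth maps *)

Section Pullback.
Context (R : realType) (m n : nat) (M : manifold R m) (N : manifold R n).
Implicit Types (phi : M -> N).

Lemma smooth_fun_comp phi (f : N -> R) : smooth_map phi -> smooth_fun f ->
  smooth_fun (fun p => f (phi p)).
Proof.
move=> ps fs c cA; exact: (smooth_fun_plot fs (plot_comp ps (par_plot cA))).
Qed.

Lemma d0_comp phi (f : N -> R) p : smooth_map phi -> smooth_fun f ->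
  d0 (fun q => f (phi q)) p = tangent phi p *m d0 f (phi p).
Proof.
move=> ps fs; have sp := plot_comp ps (par_plot (chart_at_atlas p)).
have := grad_plot fs sp (coord_img p).
by rewrite -tangentE // /= coordK.
Qed.

Lemma local1_pull1 phi (t : field1 N) (c : chart R M m) x : smooth_map phi ->
  atlas c -> img c x -> local1 (pull1 phi t) c x = plot_pull1 (phi \o par c) t x.
Proof.
move=> ps cA cx; rewrite /plot_pull1 (plot_jac_comp ps (par_plot cA) cx).
by rewrite -mulmxA.
Qed.

Lemma form1_pull1 phi (t : field1 N) : smooth_map phi -> form1 t -> form1 (pull1 phi t).
Proof.
move=> ps ts c cA; have sp := plot_comp ps (par_plot cA).
apply: smooth_mx_eq (smooth_plot_pull1 ts sp); first exact: img_open.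
by move=> x; rewrite inE => cx; rewrite local1_pull1.
Qed.

Lemma dmx_eq_on k (U : set 'rV[R]_k) (s t : 'rV[R]_k -> 'cV[R]_k) x : open U ->
  {in U, s =1 t} -> U x -> dmx s x = dmx t x.
Proof.
move=> Uo st Ux; apply/matrixP => i j; rewrite !mxE.
by congr (_ - _); apply: (partial_eq_on _ Uo _ Ux) => y yU; rewrite st.
Qed.

Lemma d1_pull1 phi (t : field1 N) p : smooth_map phi -> form1 t ->
  d1 (pull1 phi t) p = pull2 phi (d1 t) p.
Proof.
move=> ps ts; have cA := chart_at_atlas p; set c := chart_at p.
have sp := plot_comp ps (par_plot cA).
have -> : d1 (pull1 phi t) p = dmx (plot_pull1 (phi \o par c) t) (Defs.coord p).
  apply: dmx_eq_on (@img_open _ _ _ c) _ (coord_img p) => x.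
  by rewrite inE => cx; exact: local1_pull1.
have := dmx_plot_pull1 ts sp (coord_img p).
by rewrite -(tangentE p ps) [(phi \o par c) _]/= coordK => ->.
Qed.

End Pullback.

(** * Calculus of forms, bivector fields and vector fields *)

Section FormCalculus.
Context (R : realType) (n : nat) (M : manifold R n).
Implicit Types (f : M -> R) (s t : field1 M) (w L : field2 M) (X Y : vec_field M) (p : M).

Lemma outer_mxE (a b : 'cV[R]_n) i j : (a *m b^T) i j = a i 0 * b j 0.
Proof. by rewrite mxE big_ord1 mxE. Qed.

Lemma d1_alternating t p : Defs.alternating (d1 t p).
Proof. by apply/matrixP => i j; rewrite !mxE opprB. Qed.

Lemma alternating_evalN (A : 'M[R]_n) (u v : 'rV[R]_n) : Defs.alternating A ->
  eval2 A u v = - eval2 A v u.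
Proof.
move=> aA; have E : u *m A *m v^T = (v *m A^T *m u^T)^T.
  by rewrite !trmx_mul !trmxK mulmxA.
by rewrite /eval2 E aA mulmxN mulNmx mxE [LHS]mxE.
Qed.

Lemma alternatingD (A B : 'M[R]_n) : Defs.alternating A -> Defs.alternating B ->
  Defs.alternating (A + B).
Proof. by rewrite /Defs.alternating => aA aB; rewrite linearD /= aA aB opprD. Qed.

Lemma alternatingZ a (A : 'M[R]_n) : Defs.alternating A -> Defs.alternating (a *: A).
Proof. by rewrite /Defs.alternating => aA; rewrite linearZ /= aA scalerN. Qed.

Lemma form1_d0 f : smooth_fun f -> form1 (d0 f).
Proof.
move=> fs c cA; have Uo := @img_open _ _ _ c.
have gs : smooth_on_mx (img c) (grad (f \o par c)).
  move=> i j; apply: smooth_eq (smooth_partial i (fs c cA)) => // x _.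
  by rewrite mxE.
apply: smooth_mx_eq gs => // x; rewrite inE => cx.
exact: (grad_plot fs (par_plot cA) cx).
Qed.

Lemma form1Z f t : smooth_fun f -> form1 t -> form1 (fun p => f p *: t p).
Proof.
move=> fs ts c cA; have Uo := @img_open _ _ _ c.
apply: smooth_mx_eq (smooth_mxZ Uo (fs c cA) (ts c cA)) => // x _.
by rewrite /local1 scalemxAr.
Qed.

Lemma form1N t : form1 t -> form1 (fun p => - t p).
Proof.
move=> ts c cA; have Uo := @img_open _ _ _ c.
apply: smooth_mx_eq (smooth_mxN Uo (ts c cA)) => // x _.
by rewrite /local1 mulmxN.
Qed.

Lemma form2_d1 t : form1 t -> form2 (d1 t).
Proof.
move=> ts; split; first exact: d1_alternating.
move=> c cA; have Uo := @img_open _ _ _ c.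
apply: (@smooth_mx_eq _ _ _ _ _ (dmx (local1 t c))) => //.
  by move=> x; rewrite inE => cx; rewrite local2_d1.
move=> i j.
apply: smooth_eq (smoothB Uo (smooth_partial i (ts c cA j 0))
  (smooth_partial j (ts c cA i 0))) => // x _.
by rewrite mxE.
Qed.

Lemma form2D w L : form2 w -> form2 L -> form2 (fun p => w p + L p).
Proof.
move=> [wa ws] [La Ls]; split; first by move=> p; exact: alternatingD.
move=> c cA; have Uo := @img_open _ _ _ c.
apply: smooth_mx_eq (smooth_mxD Uo (ws c cA) (Ls c cA)) => // x _.
by rewrite /local2 mulmxDr mulmxDl.
Qed.

Lemma form2Z f w : smooth_fun f -> form2 w -> form2 (fun p => f p *: w p).
Proof.
move=> fs [wa ws]; split; first by move=> p; exact: alternatingZ.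
move=> c cA; have Uo := @img_open _ _ _ c.
apply: smooth_mx_eq (smooth_mxZ Uo (fs c cA) (ws c cA)) => // x _.
by rewrite /local2 -scalemxAr -scalemxAl.
Qed.

Lemma bivector_fieldZ f L : smooth_fun f -> bivector_field L ->
  bivector_field (fun p => f p *: L p).
Proof.
move=> fs [wa ws]; split; first by move=> p; exact: alternatingZ.
move=> c cA; have Uo := @img_open _ _ _ c.
apply: smooth_mx_eq (smooth_mxZ Uo (fs c cA) (ws c cA)) => // x _.
by rewrite /localb -scalemxAr -scalemxAl.
Qed.

Lemma vector_fieldD X Y : vector_field X -> vector_field Y ->
  vector_field (fun p => X p + Y p).
Proof.
move=> Xs Ys c cA; have Uo := @img_open _ _ _ c.
apply: smooth_mx_eq (smooth_mxD Uo (Xs c cA) (Ys c cA)) => // x _.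
by rewrite mulmxDl.
Qed.

Lemma vector_fieldZ f X : smooth_fun f -> vector_field X ->
  vector_field (fun p => f p *: X p).
Proof.
move=> fs Xs c cA; have Uo := @img_open _ _ _ c.
apply: smooth_mx_eq (smooth_mxZ Uo (fs c cA) (Xs c cA)) => // x _.
by rewrite scalemxAl.
Qed.

Lemma local_sharp L t (c : chart R M n) x : atlas c -> img c x ->
  sharp (L (par c x)) (t (par c x)) *m to_chart c (par c x) =
  sharp (localb L c x) (local1 t c x).
Proof.
have change (z : 'cV[R]_n) (A J K : 'M[R]_n) : K *m J = 1%:M ->
    z^T *m A *m K = (J *m z)^T *m (K^T *m A *m K).
  move=> KJ; have JK : J^T *m K^T = 1%:M by rewrite -trmx_mul KJ trmx1.
  by rewrite trmx_mul !mulmxA -(mulmxA z^T J^T) JK mulmx1.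
by move=> cA cx; apply: change; exact: to_of_chart.
Qed.

Lemma local_pair1 t X (c : chart R M n) x : atlas c -> img c x ->
  pair1 (t (par c x)) (X (par c x)) =
  pair1 (local1 t c x) (X (par c x) *m to_chart c (par c x)).
Proof.
have change (z : 'cV[R]_n) (v : 'rV[R]_n) (J K : 'M[R]_n) : K *m J = 1%:M ->
    pair1 z v = pair1 (J *m z) (v *m K).
  by move=> KJ; rewrite /pair1 mulmxA -(mulmxA v) KJ mulmx1.
by move=> cA cx; apply: change; exact: to_of_chart.
Qed.

Lemma local_contract w X (c : chart R M n) x : atlas c -> img c x ->
  of_chart c x *m Defs.contract (X (par c x)) (w (par c x)) =
  Defs.contract (X (par c x) *m to_chart c (par c x)) (local2 w c x).
Proof.
have change (A : 'M[R]_n) (v : 'rV[R]_n) (J K : 'M[R]_n) : K *m J = 1%:M ->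
    J *m Defs.contract v A = Defs.contract (v *m K) (J *m A *m J^T).
  move=> KJ; rewrite /Defs.contract !mulmxA -(mulmxA v) KJ mulmx1.
  by rewrite [RHS]trmx_mul trmxK.
by move=> cA cx; apply: change; exact: to_of_chart.
Qed.

Lemma vector_field_sharp L t : bivector_field L -> form1 t ->
  vector_field (fun p => sharp (L p) (t p)).
Proof.
move=> [La Ls] ts c cA; have Uo := @img_open _ _ _ c.
apply: smooth_mx_eq (smooth_mxM Uo (smooth_mx_tr Uo (ts c cA)) (Ls c cA)) => // x.
by rewrite inE => cx; rewrite local_sharp.
Qed.

Lemma smooth_fun_pair1 t X : form1 t -> vector_field X ->
  smooth_fun (fun p => pair1 (t p) (X p)).
Proof.
move=> ts Xs c cA; have Uo := @img_open _ _ _ c.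
apply: smooth_eq (smooth_mxM Uo (Xs c cA) (ts c cA) 0 0) => // x.
by rewrite inE => cx; rewrite local_pair1.
Qed.

Lemma form1_contract w X : form2 w -> vector_field X ->
  form1 (fun p => Defs.contract (X p) (w p)).
Proof.
move=> [wa ws] Xs c cA; have Uo := @img_open _ _ _ c.
apply: smooth_mx_eq (smooth_mx_tr Uo (smooth_mxM Uo (Xs c cA) (ws c cA))) => // x.
by rewrite inE => cx; rewrite /local1 local_contract.
Qed.

Lemma d1D s t p : form1 s -> form1 t -> d1 (fun q => s q + t q) p = d1 s p + d1 t p.
Proof.
move=> ss ts; have cA := chart_at_atlas p; set c := chart_at p in cA *.
have Uo := @img_open _ _ _ c; have Ux : img c (Defs.coord p) := coord_img p.
apply/matrixP => i j; rewrite [LHS]mxE [RHS]mxE [d1 s p _ _]mxE [d1 t p _ _]mxE.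
have E k l : partial (fun x => local1 (fun q => s q + t q) c x k 0) l (Defs.coord p) =
    partial (fun x => local1 s c x k 0) l (Defs.coord p) +
    partial (fun x => local1 t c x k 0) l (Defs.coord p).
  rewrite -(partialD l Uo (ss c cA k 0) (ts c cA k 0) Ux); apply: (partial_eq_on _ Uo _ Ux) => x _.
  by rewrite /local1 mulmxDr mxE.
by rewrite -/c !E opprD addrACA.
Qed.

Lemma d1Z f t p : smooth_fun f -> form1 t -> d1 (fun q => f q *: t q) p =
  f p *: d1 t p + (d0 f p *m (t p)^T - t p *m (d0 f p)^T).
Proof.
move=> fs ts; have cA := chart_at_atlas p; set c := chart_at p in cA *.
have Uo := @img_open _ _ _ c; have Ux : img c (Defs.coord p) := coord_img p.
have tE : local1 t c (Defs.coord p) = t p by rewrite /local1 of_chart_coord mul1mx coordK.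
have E k l : partial (fun x => local1 (fun q => f q *: t q) c x k 0) l (Defs.coord p) =
    f p * partial (fun x => local1 t c x k 0) l (Defs.coord p) + t p k 0 * d0 f p l 0.
  have fE : f p = f (par c (Defs.coord p)) by rewrite coordK.
  rewrite -tE [d0 f p l 0]mxE fE.
  apply: (etrans _ (partialM l Uo (fs c cA) (ts c cA k 0) Ux)).
  apply: (partial_eq_on _ Uo _ Ux) => x _.
  by rewrite /local1 -scalemxAr mxE.
apply/matrixP => i j; rewrite [LHS]mxE -/c !E [RHS]mxE.
rewrite [X in _ = X + _]mxE [d1 t p i j]mxE -/c mulrBr.
rewrite [X in _ = _ + X]mxE [X in _ = _ + (_ + X)]mxE !outer_mxE.
by rewrite !(mulrC (t p _ _)) opprD addrACA.
Qed.

End FormCalculus.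

Lemma smooth_along_comp (R : realType) m n (M : manifold R m) (N : manifold R n)
    (phi : M -> N) (X : vec_field N) :
  smooth_map phi -> vector_field X -> smooth_along phi (fun p => X (phi p)).
Proof.
move=> [pc ps] Xs c d cA dA.
have phid : open (phi @^-1` dom d) by move/continuousP: pc; apply; exact: dom_open.
have Vo := open_crd_image (c := c) phid.
have Hs := @smooth_mx_comp R m n 1 n _ (img d) (fun y => crd d (phi (par c y)))
  (fun z => X (par d z) *m to_chart d (par d z)) Vo (@img_open _ _ _ d) (ps c d cA dA) (Xs d dA).
refine (smooth_mx_eq Vo _ (Hs _)) => [y|y [p [cp dp] <-]]; last first.
  by rewrite (crdK cp); exact: crd_img.
rewrite inE => -[p [cp dp] <-].
have e : par d (crd d (phi (par c (crd c p)))) = phi (par c (crd c p)).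
  by rewrite (crdK cp) (crdK dp).
exact (congr1 (fun q => X q *m to_chart d q) e).
Qed.

(** * Contact structures define twisted Jacobi structures *)

Section DirectionalDerivative.
Context (R : realType) (n : nat).
Implicit Types (U : set 'rV[R]_n) (x u v z : 'rV[R]_n).

Definition dirmx p q (F : 'rV[R]_n -> 'M[R]_(p, q)) x u : 'M[R]_(p, q) :=
  \matrix_(i, j) pair1 (grad (fun y => F y i j) x) u.

Lemma dirmx_eq_on p q U (F G : 'rV[R]_n -> 'M[R]_(p, q)) x u : open U ->
  {in U, F =1 G} -> U x -> dirmx F x u = dirmx G x u.
Proof.
move=> Uo FG Ux; apply/matrixP => i j; rewrite !mxE; congr (pair1 _ u).
by apply: (grad_eq_on Uo _ Ux) => y yU; rewrite FG.
Qed.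

Lemma dirmx_cst p q (A : 'M[R]_(p, q)) x u : dirmx (fun=> A) x u = 0.
Proof.
apply/matrixP => i j; rewrite !mxE.
by rewrite (grad_cst (A i j)) /pair1 mulmx0 mxE.
Qed.

Lemma pair1D (a b : 'cV[R]_n) u : pair1 (a + b) u = pair1 a u + pair1 b u.
Proof. by rewrite /pair1 mulmxDr mxE. Qed.

Lemma pair1Z c (a : 'cV[R]_n) u : pair1 (c *: a) u = c * pair1 a u.
Proof. by rewrite /pair1 -scalemxAr mxE. Qed.

Lemma pair1N (a : 'cV[R]_n) u : pair1 (- a) u = - pair1 a u.
Proof. by rewrite /pair1 mulmxN mxE. Qed.

Lemma pair1_sum (I : Type) (r : seq I) (F : I -> 'cV[R]_n) u :
  pair1 (\sum_(i <- r) F i) u = \sum_(i <- r) pair1 (F i) u.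
Proof.
elim: r => [|i r IH]; first by rewrite !big_nil /pair1 mulmx0 mxE.
by rewrite !big_cons pair1D IH.
Qed.

Lemma dirmxM p q s U (F : 'rV[R]_n -> 'M[R]_(p, q)) (G : 'rV[R]_n -> 'M[R]_(q, s)) x u :
  open U -> smooth_on_mx U F -> smooth_on_mx U G -> U x ->
  dirmx (fun y => F y *m G y) x u = dirmx F x u *m G x + F x *m dirmx G x u.
Proof.
move=> Uo Fs Gs Ux; apply/matrixP => i j; rewrite [LHS]mxE.
rewrite (@grad_eq_on _ _ U _ (fun y => \sum_k F y i k * G y k j)) //; last first.
  by move=> y _; rewrite mxE.
rewrite (@grad_sum _ _ U _ _ (fun k y => F y i k * G y k j)) //; last first.
  by move=> k; apply: smoothM.
rewrite pair1_sum !mxE -big_split /=; apply: eq_bigr => k _.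
rewrite (@gradM _ _ U) // pair1D !pair1Z !mxE addrC; congr (_ + _).
exact: mulrC.
Qed.

Lemma dirmxD p q U (F G : 'rV[R]_n -> 'M[R]_(p, q)) x u : open U ->
  smooth_on_mx U F -> smooth_on_mx U G -> U x ->
  dirmx (fun y => F y + G y) x u = dirmx F x u + dirmx G x u.
Proof.
move=> Uo Fs Gs Ux; apply/matrixP => i j; rewrite [LHS]mxE.
rewrite (@grad_eq_on _ _ U _ (fun y => F y i j + G y i j)) //; last first.
  by move=> y _; rewrite mxE.
by rewrite (@gradD _ _ U) // pair1D !mxE.
Qed.

Lemma dirmx_tr p q (F : 'rV[R]_n -> 'M[R]_(p, q)) x u :
  dirmx (fun y => (F y)^T) x u = (dirmx F x u)^T.
Proof.
apply/matrixP => i j; rewrite !mxE; congr (pair1 (grad _ x) u).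
by apply/funext => y; rewrite mxE.
Qed.

Lemma eval2_sum (A : 'M[R]_n) u v : eval2 A u v = \sum_j \sum_k A j k * u 0 j * v 0 k.
Proof.
rewrite /eval2 mxE exchange_big; apply: eq_bigr => k _.
rewrite !mxE mulr_suml; apply: eq_bigr => j _.
by rewrite (mulrC (u 0 j)).
Qed.

Lemma eval2D (A B : 'M[R]_n) u v : eval2 (A + B) u v = eval2 A u v + eval2 B u v.
Proof. by rewrite /eval2 mulmxDr mulmxDl mxE. Qed.

(** The exterior derivative of the 2-form with matrix [F], evaluated on constant vector fields: the
    brackets of these vanish, so only the cyclic sum of derivatives is left. *)
Definition cyclic_d (F : 'rV[R]_n -> 'M[R]_n) x u v z : R :=
  eval2 (dirmx F x u) v z + eval2 (dirmx F x v) z u + eval2 (dirmx F x z) u v.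

Lemma cyclic_dE (F : 'rV[R]_n -> 'M[R]_n) x u v z : cyclic_d F x u v z =
  \sum_i \sum_j \sum_k (partial (fun y => F y j k) i x + partial (fun y => F y k i) j x
    + partial (fun y => F y i j) k x) * u 0 i * v 0 j * z 0 k.
Proof.
pose D i j k := partial (fun y => F y j k) i x.
have E a b c : eval2 (dirmx F x a) b c = \sum_i \sum_j \sum_k D i j k * a 0 i * b 0 j * c 0 k.
  rewrite eval2_sum [RHS]exchange_big; apply: eq_bigr => j _.
  rewrite [RHS]exchange_big; apply: eq_bigr => k _.
  rewrite mxE pair1E !mulr_suml; apply: eq_bigr => i _.
  by rewrite mxE (mulrC (a 0 i)).
rewrite /cyclic_d !E.
have -> : \sum_i \sum_j \sum_k D i j k * v 0 i * z 0 j * u 0 k =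
          \sum_i \sum_j \sum_k D j k i * u 0 i * v 0 j * z 0 k.
  under eq_bigr do rewrite exchange_big; rewrite exchange_big.
  apply: eq_bigr => i _; apply: eq_bigr => j _; apply: eq_bigr => k _.
  by ring.
have -> : \sum_i \sum_j \sum_k D i j k * z 0 i * u 0 j * v 0 k =
          \sum_i \sum_j \sum_k D k i j * u 0 i * v 0 j * z 0 k.
  rewrite exchange_big; under eq_bigr do rewrite exchange_big.
  apply: eq_bigr => i _; apply: eq_bigr => j _; apply: eq_bigr => k _.
  by ring.
rewrite -!big_split; apply: eq_bigr => i _; rewrite -!big_split.
apply: eq_bigr => j _; rewrite -!big_split; apply: eq_bigr => k _.
by rewrite /= !mulrDl.
Qed.

Lemma cyclic_dD U (F G : 'rV[R]_n -> 'M[R]_n) x u v z : open U ->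
  smooth_on_mx U F -> smooth_on_mx U G -> U x ->
  cyclic_d (fun y => F y + G y) x u v z = cyclic_d F x u v z + cyclic_d G x u v z.
Proof.
move=> Uo Fs Gs Ux; rewrite /cyclic_d !(dirmxD _ Uo Fs Gs Ux) !eval2D.
by rewrite [RHS]addrACA -(addrACA (eval2 (dirmx F x u) v z)).
Qed.

(** This is d d = 0: the six second derivatives cancel in pairs by symmetry. *)
Lemma cyclic_d_dmx U (t : 'rV[R]_n -> 'cV[R]_n) x u v z : open U ->
  smooth_on_mx U t -> U x -> cyclic_d (dmx t) x u v z = 0.
Proof.
move=> Uo ts Ux; pose D i j k := partial (partial (fun y => t y k 0) j) i x.
have Dc i j k : D i j k = D j i k by exact: partial_comm Uo (ts k 0) Ux.
have E i j k : partial (fun y => dmx t y j k) i x = D i j k - D i k j.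
  rewrite (@partial_eq_on _ _ U _ (fun y => partial (fun y => t y k 0) j y +
    - partial (fun y => t y j 0) k y)) //; last by move=> y _; rewrite mxE.
  have s1 := smooth_partial j (ts k 0); have s2 := smooth_partial k (ts j 0).
  rewrite (partialD i Uo s1 (smoothN Uo s2) Ux); congr (_ + _).
  by have := gradN Uo s2 Ux => /colP/(_ i); rewrite !mxE.
rewrite cyclic_dE; apply: big1 => i _; apply: big1 => j _; apply: big1 => k _.
rewrite !E (Dc i k j) (Dc j i k) (Dc k j i).
have cancel (a b c : R) : a - b + (c - a) + (b - c) = 0 by ring.
by rewrite cancel !mul0r.
Qed.

End DirectionalDerivative.

Lemma evalb_alternating (R : realType) n (A : 'M[R]_n) (z e : 'cV[R]_n) :
  A^T = - A -> evalb A z e = - evalb A e z.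
Proof.
move=> aA; have := @alternating_evalN R n A z^T e^T aA.
by rewrite /eval2 !trmxK.
Qed.

(** Leibniz rule for Om(X, Y), where [DX], [DY] and [W] are the derivatives of [X], [Y] and [Om].
    The hypotheses are the equations of the Hamiltonian fields of functions with differentials [a]
    and [b]; they replace pairings with [Om] by pairings with differentials and with theta. *)
Lemma bilinear_leibniz (R : comRingType) n (DX X DY Y : 'rV[R]_n) (Om W : 'M[R]_n)
    (a b t : 'cV[R]_n) (ea eb : R) :
  Om *m Y^T = b - eb *: t -> X *m Om = - (a - ea *: t)^T ->
  ((DX *m Om + X *m W) *m Y^T + X *m Om *m DY^T) 0 0 =
  (DX *m b) 0 0 - eb * (DX *m t) 0 0 + (X *m W *m Y^T) 0 0
  - ((DY *m a) 0 0 - ea * (DY *m t) 0 0).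
Proof.
move=> OmY XOm; have -> : X *m Om *m DY^T = - (DY *m a - ea *: (DY *m t))^T.
  by rewrite XOm mulNmx -trmx_mul mulmxBr scalemxAr.
rewrite mulmxDl -(mulmxA DX) OmY mulmxBr -scalemxAr.
move: (DX *m b) (DX *m t) (X *m W *m Y^T) (DY *m a) (DY *m t) => P Q S T V.
by rewrite !mxE.
Qed.

(* Stated over an abstract ring because [ring] is very slow on terms that contain
   derivatives. *)
Lemma solve_leibniz (R : comRingType) (B B' P Q P' Q' hf hg ef eg tf tg W : R) :
  B = P - eg * Q + W - (P' - ef * Q') -> P = B - hg -> P' = B' - hf -> B' = - B ->
  Q = - tf -> Q' = - tg -> W = - B + hg - hf - eg * tf + ef * tg.
Proof.
move=> H EP EP' EB EQ EQ'; rewrite EP EP' EB EQ EQ' in H.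
have -> : W = B - (B - hg - eg * - tf + W - (- B - hf - ef * - tg)) + W by rewrite -H; ring.
by ring.
Qed.

Lemma solve_leibniz_E (R : comRingType) (P Q D H e T : R) :
  P = D - H -> Q = - T -> P - e * Q = D - H + e * T.
Proof. by move=> -> ->; ring. Qed.

(** With X_f the Hamiltonian field of f: [Wf] is the derivative of Om along X_f on (X_g, X_h), [Bgh]
    that of {g,h} along X_f, [hfgh] the Hessian of f on (X_g, X_h), [tfg] the derivative of theta
    along X_f paired with X_g, [ef] the Reeb derivative of f, and [bfg], [wfg] are {f,g} and
    omega(X_f, X_g). *)
Lemma solve_jacobi1 (R : comRingType) (Wf Wg Wh Bgh Bhf Bfg : R)
    (bfg bgh bhf ef eg eh wfg wgh whf : R) (hfgh hfhg hgfh hghf hhfg hhgf : R)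
    (tfg tgf tgh thg thf tfh : R) :
  Wf = - Bgh + hhfg - hgfh - eh * tfg + eg * tfh ->
  Wg = - Bhf + hfgh - hhgf - ef * tgh + eh * tgf ->
  Wh = - Bfg + hghf - hfhg - eg * thf + ef * thg ->
  tfg - tgf = bfg - wfg -> tgh - thg = bgh - wgh -> thf - tfh = bhf - whf ->
  hhfg = hhgf -> hfgh = hfhg -> hghf = hgfh ->
  Bgh + Bhf + Bfg + (ef * bgh + eg * bhf + eh * bfg) =
  - (Wf + Wg + Wh) + (ef * wgh + eg * whf + eh * wfg).
Proof.
move=> -> -> -> Efg Egh Ehf -> -> ->.
have -> : bfg = wfg + (tfg - tgf) by rewrite Efg; ring.
have -> : bgh = wgh + (tgh - thg) by rewrite Egh; ring.
have -> : bhf = whf + (thf - tfh) by rewrite Ehf; ring.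
by ring.
Qed.

(** The analogue of [solve_jacobi1] with the Reeb field in place of X_h; [Wg'] is [Wg] with the two
    arguments of the form exchanged, as the cyclic order requires. *)
Lemma solve_jacobi2 (R : comRingType) (WE Wf Wg Wg' B Df Dg ef eg wf wg : R)
    (hgEf hgfE hfEg hfgE tfE tEf tgE tEg : R) :
  WE = - B + hgEf - hfEg - eg * tEf + ef * tEg ->
  Wf = Dg - hgfE + eg * tfE -> Wg = Df - hfgE + ef * tgE -> Wg' = - Wg ->
  tfE - tEf = - wf -> tgE - tEg = - wg -> hgEf = hgfE -> hfEg = hfgE ->
  B + Df - Dg = - (Wf + Wg' + WE) - (wf * eg - wg * ef).
Proof.
move=> -> -> -> -> Ef Eg -> ->.
have -> : wf = - (tfE - tEf) by rewrite Ef; ring.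
have -> : wg = - (tgE - tEg) by rewrite Eg; ring.
by ring.
Qed.

(** * The twisted Jacobi identities in coordinates *)

Section CoordinateJacobi.
Context (R : realType) (n : nat) (U : set 'rV[R]_n).
Context (t : 'rV[R]_n -> 'cV[R]_n) (w L : 'rV[R]_n -> 'M[R]_n) (E : 'rV[R]_n -> 'rV[R]_n).
Context (Uo : open U).
Context (ts : smooth_on_mx U t) (ws : smooth_on_mx U w) (Ls : smooth_on_mx U L)
  (Es : smooth_on_mx U E).
Context (La : forall y, U y -> (L y)^T = - L y) (wa : forall y, U y -> (w y)^T = - w y).

Let Om y := dmx t y + w y.

Context (tE : forall y, U y -> E y *m t y = 1%:M).
Context (EOm : forall y, U y -> E y *m Om y = 0).
Context (tL : forall y, U y -> (t y)^T *m L y = 0).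
Context (LOm : forall y z, U y ->
  z^T *m L y *m Om y = - (z - (E y *m z) 0 0 *: t y)^T).

Let ham (f : 'rV[R]_n -> R) y : 'rV[R]_n := (grad f y)^T *m L y.
Let bra (f g : 'rV[R]_n -> R) y : R := evalb (L y) (grad f y) (grad g y).
Let eder (f : 'rV[R]_n -> R) y : R := pair1 (grad f y) (E y).
(** Neither [hess] nor the following [tder] is invariant under changes of coordinates. The Hessians
    cancel because they are symmetric, and [tder] survives only through its antisymmetric part, the
    exterior derivative of [t]. *)
Let hess (f : 'rV[R]_n -> R) x u v : R := pair1 (dirmx (grad f) x u) v.
Let tder x u v : R := pair1 (dirmx t x u) v.

Let dts : smooth_on_mx U (dmx t).
Proof.
move=> i j.
apply: smooth_eq (smoothB Uo (smooth_partial i (ts j 0)) (smooth_partial j (ts i 0))) => // x _.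
by rewrite mxE.
Qed.

Let Oms : smooth_on_mx U Om. Proof. exact: smooth_mxD. Qed.

Let grads f : smooth_on U f -> smooth_on_mx U (grad f).
Proof.
by move=> fs i j; apply: smooth_eq (smooth_partial i fs) => // x _; rewrite mxE.
Qed.

Let hams f : smooth_on U f -> smooth_on_mx U (ham f).
Proof. by move=> fs; apply: smooth_mxM => //; apply: smooth_mx_tr => //; exact: grads. Qed.

Let bras f g : smooth_on U f -> smooth_on U g -> smooth_on U (bra f g).
Proof. by move=> fs gs; exact: (smooth_mxM Uo (hams fs) (grads gs) 0 0). Qed.

Let Oma y : U y -> (Om y)^T = - Om y.
Proof.
move=> Uy; rewrite /Om linearD /= wa // opprD; congr (_ + _).
by apply/matrixP => i j; rewrite !mxE opprB.
Qed.

Let Lt y : U y -> L y *m t y = 0.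
Proof.
move=> Uy; rewrite -[LHS]trmxK trmx_mul (La Uy) mulmxN.
by rewrite tL // oppr0 trmx0.
Qed.

Let hamt f y : U y -> ham f y *m t y = 0.
Proof. by move=> Uy; rewrite -mulmxA Lt // mulmx0. Qed.

Let bra_alt f g y : U y -> bra f g y = - bra g f y.
Proof.
by move=> Uy; apply: evalb_alternating; exact: La.
Qed.

Let hamOm f y : U y -> ham f y *m Om y = - (grad f y - eder f y *: t y)^T.
Proof. by move=> Uy; rewrite LOm. Qed.

Let Omham f y : U y -> Om y *m (ham f y)^T = grad f y - eder f y *: t y.
Proof.
move=> Uy; rewrite -[Om y]opprK -Oma // mulNmx -trmx_mul hamOm //.
by rewrite linearN /= trmxK opprK.
Qed.

Let hamOmham f g y : U y -> eval2 (Om y) (ham f y) (ham g y) = bra f g y.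
Proof.
move=> Uy; rewrite /eval2 -mulmxA Omham // mulmxBr -scalemxAr hamt //.
by rewrite scaler0 subr0.
Qed.

Let hess_sym f x u v : smooth_on U f -> U x -> hess f x u v = hess f x v u.
Proof.
move=> fs Ux; rewrite /hess !pair1E.
have D a i : dirmx (grad f) x a i 0 = \sum_j a 0 j * partial (partial f i) j x.
  rewrite mxE pair1E; apply: eq_bigr => j _; rewrite mxE; congr (_ * _).
  by congr (partial _ j x); apply/funext => y; rewrite mxE.
under eq_bigr do rewrite D mulr_sumr.
rewrite exchange_big; apply: eq_bigr => j _; rewrite D mulr_sumr.
apply: eq_bigr => i _; rewrite (partial_comm i j Uo fs Ux).
by rewrite mulrCA.
Qed.

Let tder_d x u v : eval2 (dmx t x) u v = tder x u v - tder x v u.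
Proof.
rewrite /tder !pair1E eval2_sum.
have D a i : dirmx t x a i 0 = \sum_j a 0 j * partial (fun y => t y i 0) j x.
  by rewrite mxE pair1E; apply: eq_bigr => j _; rewrite mxE.
have -> : \sum_i v 0 i * dirmx t x u i 0 =
    \sum_j \sum_i v 0 i * (u 0 j * partial (fun y => t y i 0) j x).
  by rewrite exchange_big; apply: eq_bigr => i _; rewrite D mulr_sumr.
rewrite -sumrB; apply: eq_bigr => j _; rewrite D mulr_sumr -sumrB.
apply: eq_bigr => i _; rewrite mxE.
set a := partial _ _ _; set b := partial _ _ _; move: a b => a b; ring.
Qed.

(* Differentiating X_f.t = 0, X_f.dg = {f,g}, Om(X_f, X_g) = {f,g}. *)
Let dham_t f x u : smooth_on U f -> U x ->
  (dirmx (ham f) x u *m t x) 0 0 = - tder x u (ham f x).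
Proof.
move=> fs Ux; have := dirmxM u Uo (hams fs) ts Ux.
rewrite (dirmx_eq_on u Uo (_ : {in U, _ =1 fun=> 0}) Ux); last first.
  by move=> y; rewrite inE => Uy; rewrite hamt.
rewrite dirmx_cst => /matrixP/(_ 0 0); rewrite !mxE => /esym/eqP.
by rewrite addr_eq0 => /eqP ->; rewrite /tder /pair1 mxE.
Qed.

Let dham_grad f g x u : smooth_on U f -> smooth_on U g -> U x ->
  (dirmx (ham f) x u *m grad g x) 0 0 =
  pair1 (grad (bra f g) x) u - hess g x u (ham f x).
Proof.
move=> fs gs Ux; have := dirmxM u Uo (hams fs) (grads gs) Ux.
move/matrixP/(_ 0 0); rewrite [LHS]mxE [RHS]mxE -/(bra f g) => ->.
by rewrite /hess /pair1 addrK.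
Qed.

Let dE_t x u : U x -> (dirmx E x u *m t x) 0 0 = - tder x u (E x).
Proof.
move=> Ux; have := dirmxM u Uo Es ts Ux.
rewrite (dirmx_eq_on u Uo (_ : {in U, _ =1 fun=> 1%:M}) Ux); last first.
  by move=> y; rewrite inE => Uy; rewrite tE.
rewrite dirmx_cst => /matrixP/(_ 0 0); rewrite !mxE => /esym/eqP.
by rewrite addr_eq0 => /eqP ->; rewrite /tder /pair1 mxE.
Qed.

Let dE_grad g x u : smooth_on U g -> U x ->
  (dirmx E x u *m grad g x) 0 0 = pair1 (grad (eder g) x) u - hess g x u (E x).
Proof.
move=> gs Ux; have := dirmxM u Uo Es (grads gs) Ux.
move/matrixP/(_ 0 0); rewrite [LHS]mxE [RHS]mxE -/(eder g) => ->.
by rewrite /hess /pair1 addrK.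
Qed.

Let dOm_ham f g x u : smooth_on U f -> smooth_on U g -> U x ->
  eval2 (dirmx Om x u) (ham f x) (ham g x) =
  - pair1 (grad (bra f g) x) u + hess g x u (ham f x) - hess f x u (ham g x)
  - eder g x * tder x u (ham f x) + eder f x * tder x u (ham g x).
Proof.
move=> fs gs Ux.
have hgs := smooth_mx_tr Uo (hams gs).
have := dirmxM u Uo (smooth_mxM Uo (hams fs) Oms) hgs Ux.
rewrite (dirmxM u Uo (hams fs) Oms Ux) dirmx_tr.
move/matrixP/(_ 0 0); rewrite [LHS]mxE.
rewrite (grad_eq_on Uo (_ : {in U, _ =1 bra f g}) Ux); last first.
  by move=> y; rewrite inE => Uy; exact: hamOmham.
rewrite (bilinear_leibniz _ _ _ (Omham g Ux) (hamOm f Ux)).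
rewrite -[(ham f x *m _ *m _) 0 0]/(eval2 (dirmx Om x u) (ham f x) (ham g x)).
move=> H; have B_alt : pair1 (grad (bra g f) x) u = - pair1 (grad (bra f g) x) u.
  rewrite (grad_eq_on Uo (_ : {in U, _ =1 fun y => - bra f g y}) Ux); last first.
    by move=> y; rewrite inE => Uy; exact: bra_alt.
  by rewrite (gradN Uo (bras fs gs) Ux) pair1N.
exact: (solve_leibniz H (dham_grad u fs gs Ux) (dham_grad u gs fs Ux) B_alt
  (dham_t u fs Ux) (dham_t u gs Ux)).
Qed.

(** The vector equation Om E = 0 is differentiated first and paired with X_g afterwards, so that the
    derivative of [E] occurs but not that of X_g. *)
Let dOm_E g x u : smooth_on U g -> U x ->
  eval2 (dirmx Om x u) (ham g x) (E x) =
  pair1 (grad (eder g) x) u - hess g x u (E x) + eder g x * tder x u (E x).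
Proof.
move=> gs Ux; have OmE y : U y -> Om y *m (E y)^T = 0.
  move=> Uy; rewrite -[Om y]opprK -Oma // mulNmx -trmx_mul EOm //.
  by rewrite trmx0 oppr0.
have := dirmxM u Uo Oms (smooth_mx_tr Uo Es) Ux.
rewrite (dirmx_eq_on u Uo (_ : {in U, _ =1 fun=> 0}) Ux); last first.
  by move=> y; rewrite inE => Uy; rewrite OmE.
rewrite dirmx_cst dirmx_tr => /esym/eqP; rewrite addr_eq0 => /eqP H.
have -> : eval2 (dirmx Om x u) (ham g x) (E x) =
    (dirmx E x u *m grad g x) 0 0 - eder g x * (dirmx E x u *m t x) 0 0.
  rewrite /eval2 -mulmxA H mulmxN mulmxA hamOm // mulNmx opprK -trmx_mul.
  rewrite mulmxBr -scalemxAr.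
  move: (dirmx E x u *m grad g x) (dirmx E x u *m t x) => P Q.
  by rewrite !mxE.
apply: solve_leibniz_E (dE_grad u gs Ux) (dE_t u Ux).
Qed.

Let Om_alt x u : U x -> Defs.alternating (dirmx Om x u).
Proof.
move=> Ux; rewrite /Defs.alternating -dirmx_tr.
rewrite (dirmx_eq_on u Uo (_ : {in U, _ =1 fun y => - Om y}) Ux); last first.
  by move=> y; rewrite inE => Uy; exact: Oma.
apply/matrixP => i j; rewrite !mxE.
rewrite (_ : (fun y => (- Om y) i j) = fun y => - Om y i j); last first.
  by apply/funext => y; rewrite mxE.
by rewrite (gradN Uo (Oms i j) Ux) pair1N.
Qed.

(** [Om] and [w] differ by an exact form, hence have the same exterior derivative. *)
Let cyc_w x u v z : U x -> cyclic_d w x u v z = cyclic_d Om x u v z.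
Proof.
by move=> Ux; rewrite (cyclic_dD u v z Uo dts ws Ux) (cyclic_d_dmx u v z Uo ts Ux) add0r.
Qed.

Let tder_ham f g x : U x ->
  tder x (ham f x) (ham g x) - tder x (ham g x) (ham f x) =
  bra f g x - eval2 (w x) (ham f x) (ham g x).
Proof.
by move=> Ux; rewrite -tder_d -hamOmham // eval2D addrK.
Qed.

Let tder_ham_E f x : U x ->
  tder x (ham f x) (E x) - tder x (E x) (ham f x) = - eval2 (w x) (ham f x) (E x).
Proof.
move=> Ux; rewrite -tder_d; apply/eqP; rewrite -addr_eq0 -eval2D; apply/eqP.
rewrite (_ : eval2 _ _ _ = eval2 (Om x) (ham f x) (E x)) //.
rewrite alternating_evalN; last exact: Oma.
by rewrite /eval2 EOm // mul0mx mxE oppr0.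
Qed.

Lemma coordinate_jacobi1 f g h x :
  smooth_on U f -> smooth_on U g -> smooth_on U h -> U x ->
  pair1 (grad (bra g h) x) (ham f x) + pair1 (grad (bra h f) x) (ham g x)
    + pair1 (grad (bra f g) x) (ham h x)
  + (eder f x * bra g h x + eder g x * bra h f x + eder h x * bra f g x) =
  - cyclic_d w x (ham f x) (ham g x) (ham h x)
  + (eder f x * eval2 (w x) (ham g x) (ham h x)
     + eder g x * eval2 (w x) (ham h x) (ham f x)
     + eder h x * eval2 (w x) (ham f x) (ham g x)).
Proof.
move=> fs gs hs Ux; rewrite cyc_w // /cyclic_d.
apply: (solve_jacobi1 (dOm_ham (ham f x) gs hs Ux) (dOm_ham (ham g x) hs fs Ux)
  (dOm_ham (ham h x) fs gs Ux) (tder_ham f g Ux) (tder_ham g h Ux) (tder_ham h f Ux)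
  (hess_sym (ham f x) (ham g x) hs Ux) (hess_sym (ham g x) (ham h x) fs Ux)
  (hess_sym (ham h x) (ham f x) gs Ux)).
Qed.

Lemma coordinate_jacobi2 f g x : smooth_on U f -> smooth_on U g -> U x ->
  pair1 (grad (bra f g) x) (E x) + pair1 (grad (eder f) x) (ham g x)
    - pair1 (grad (eder g) x) (ham f x) =
  - cyclic_d w x (ham f x) (ham g x) (E x)
  - (eval2 (w x) (ham f x) (E x) * eder g x - eval2 (w x) (ham g x) (E x) * eder f x).
Proof.
move=> fs gs Ux; rewrite cyc_w // /cyclic_d.
have H := alternating_evalN (E x) (ham f x) (Om_alt (ham g x) Ux).
apply: (solve_jacobi2 (dOm_ham (E x) fs gs Ux) (dOm_E (ham f x) gs Ux)
  (dOm_E (ham g x) fs Ux) H (tder_ham_E f Ux) (tder_ham_E g Ux)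
  (hess_sym (E x) (ham f x) gs Ux) (hess_sym (E x) (ham g x) fs Ux)).
Qed.

End CoordinateJacobi.

(** * The twisted Jacobi identities on a manifold *)

Section ContactToJacobi.
Context (R : realType) (n : nat) (M : manifold R (2 * n).+1).
Implicit Types (f g h : M -> R) (p : M).
Context (t : field1 M) (w L : field2 M) (E : vec_field M).
Context (ts : form1 t) (ws : form2 w) (cJ : contact_jacobi t w L E).

Let Ls : bivector_field L. Proof. by case: cJ. Qed.
Let Es : vector_field E. Proof. by case: cJ. Qed.

Section InChart.
Context (c : chart R M (2 * n).+1) (cA : atlas c).
Let U := img c.
Let tc := local1 t c.
Let wc := local2 w c.
Let Lc := localb L c.
Let Ec x := E (par c x) *m to_chart c (par c x).

Let tr_conj (A J : 'M[R]_((2 * n).+1)) : A^T = - A -> (J *m A *m J^T)^T = - (J *m A *m J^T).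
Proof. by move=> aA; rewrite !trmx_mul trmxK aA mulmxA mulmxN mulNmx. Qed.

Lemma chart_alternating2 y : (wc y)^T = - wc y.
Proof. exact: tr_conj (proj1 ws (par c y)). Qed.

Lemma chart_alternatingb y : (Lc y)^T = - Lc y.
Proof.
have := tr_conj (to_chart c (par c y))^T (proj1 Ls (par c y)).
by rewrite trmxK.
Qed.

Lemma chart_omega y : U y -> dmx tc y + wc y = local2 (fun q => d1 t q + w q) c y.
Proof.
by move=> cy; rewrite -(local2_d1 ts cA cy) /local2 -mulmxDl -mulmxDr.
Qed.

Lemma chart_reeb_theta y : U y -> Ec y *m tc y = 1%:M.
Proof.
move=> cy; apply/matrixP => i j; rewrite !ord1 [RHS]mxE eqxx.
have [_ _ /(_ (par c y)) [<- _ _ _]] := cJ.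
by rewrite (local_pair1 t E cA cy).
Qed.

Lemma chart_reeb_omega y : U y -> Ec y *m (dmx tc y + wc y) = 0.
Proof.
move=> cy; rewrite chart_omega // -[LHS]trmxK.
rewrite -[(_ *m _)^T]/(Defs.contract (Ec y) (local2 (fun q => d1 t q + w q) c y)).
rewrite -(local_contract (fun q => d1 t q + w q) E cA cy).
have [_ _ /(_ (par c y)) [_ -> _ _]] := cJ.
by rewrite mulmx0 trmx0.
Qed.

Lemma chart_theta_sharp y : U y -> (tc y)^T *m Lc y = 0.
Proof.
move=> cy; rewrite -[LHS](local_sharp L t cA cy).
have [_ _ /(_ (par c y)) [_ _ -> _]] := cJ.
by rewrite mul0mx.
Qed.

Lemma chart_sharp_omega y z : U y ->
  z^T *m Lc y *m (dmx tc y + wc y) = - (z - (Ec y *m z) 0 0 *: tc y)^T.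
Proof.
move=> cy; rewrite chart_omega //.
have change (J K A Om : 'M[R]_((2 * n).+1)) (e : 'rV[R]_((2 * n).+1)) (th : 'cV[R]_((2 * n).+1)) :
    K *m J = 1%:M -> J *m K = 1%:M ->
    (forall z0, Defs.contract (sharp A z0) Om = - (z0 - pair1 z0 e *: th)) ->
    z^T *m (K^T *m A *m K) *m (J *m Om *m J^T) =
    - (z - (e *m K *m z) 0 0 *: (J *m th))^T.
  move=> KJ JK /(_ (K *m z)); rewrite /Defs.contract /sharp => H.
  have -> : z^T *m (K^T *m A *m K) *m (J *m Om *m J^T) = ((K *m z)^T *m A *m Om) *m J^T.
    by rewrite trmx_mul !mulmxA -(mulmxA (z^T *m K^T *m A)) KJ mulmx1.
  rewrite -[_ *m Om]trmxK H linearN /= mulNmx -trmx_mul mulmxBr mulmxA JK mul1mx.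
  by rewrite -scalemxAr /pair1 mulmxA.
have [_ _ /(_ (par c y)) [_ _ _ H]] := cJ.
exact: (change _ _ _ _ _ _ (to_of_chart cA cy) (of_to_chart cA cy) H).
Qed.

Lemma chart_bracket f g y : smooth_fun f -> smooth_fun g -> U y ->
  evalb (L (par c y)) (d0 f (par c y)) (d0 g (par c y)) =
  evalb (Lc y) (grad (f \o par c) y) (grad (g \o par c) y).
Proof.
move=> fs gs cy; have cP := par_plot cA.
rewrite (grad_plot fs cP cy) (grad_plot gs cP cy).
rewrite -[LHS]/(pair1 (d0 g (par c y)) (sharp (L (par c y)) (d0 f (par c y)))).
rewrite (local_pair1 (d0 g) (fun q => sharp (L q) (d0 f q)) cA cy).
by rewrite (local_sharp L (d0 f) cA cy).
Qed.

Lemma chart_reeb_derivative f y : smooth_fun f -> U y ->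
  pair1 (d0 f (par c y)) (E (par c y)) = pair1 (grad (f \o par c) y) (Ec y).
Proof.
move=> fs cy; rewrite (grad_plot fs (par_plot cA) cy).
by rewrite (local_pair1 (d0 f) E cA cy).
Qed.

End InChart.

Lemma d0_chart (F : M -> R) p (F' : 'rV[R]_((2 * n).+1) -> R) :
  (forall y, img (chart_at p) y -> F (par (chart_at p) y) = F' y) ->
  d0 F p = grad F' (Defs.coord p).
Proof.
move=> FE; apply: (grad_eq_on (@img_open _ _ _ (chart_at p)) _ (coord_img p)).
by move=> y; rewrite inE; exact: FE.
Qed.

Lemma localb_coord p : localb L (chart_at p) (Defs.coord p) = L p.
Proof. by rewrite /localb coordK to_chart_coord trmx1 mul1mx mulmx1. Qed.

Lemma local2_coord p : local2 w (chart_at p) (Defs.coord p) = w p.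
Proof. by rewrite /local2 coordK of_chart_coord trmx1 mul1mx mulmx1. Qed.

Lemma d2_cyclic p u v z :
  d2 w p u v z = cyclic_d (local2 w (chart_at p)) (Defs.coord p) u v z.
Proof. by rewrite cyclic_dE. Qed.

(** In the chart at [p] the changes of components are the identity at [coord p], so there the
    coordinate identities are the required ones, once every function differentiated at [p] has been
    written in that chart. *)
Theorem contact_twisted_jacobi : twisted_jacobi L E w.
Proof.
split=> [||| f g h p fs gs hs a b c|f g p fs gs a b]; [exact: Ls|exact: Es|exact: ws| |].
- have cA := chart_at_atlas p; set ch := chart_at p in cA *.
  have cp := coord_img p.
  have := coordinate_jacobi1 (@img_open _ _ _ ch) (ts cA) (proj2 ws _ cA)
    (proj2 Ls _ cA) (fun y _ => chart_alternatingb ch y)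
    (fun y _ => chart_alternating2 ch y) (@chart_theta_sharp ch cA)
    (fun y z cy => @chart_sharp_omega ch cA y z cy) (fs _ cA) (gs _ cA) (hs _ cA) cp.
  cbv beta; rewrite localb_coord local2_coord -!d2_cyclic.
  rewrite coordK to_chart_coord mulmx1.
  have bE f1 f2 (s1 : smooth_fun f1) (s2 : smooth_fun f2) :
    d0 (fun q => evalb (L q) (d0 f1 q) (d0 f2 q)) p =
    grad (fun y => evalb (localb L ch y) (grad (fun x => f1 (par ch x)) y)
                                         (grad (fun x => f2 (par ch x)) y))
      (Defs.coord p).
    by apply: d0_chart => y cy; exact: chart_bracket.
  rewrite -(bE g h gs hs) -(bE h f hs fs) -(bE f g fs gs).
  rewrite -[grad (fun x => f (par ch x)) _]/(d0 f p) -[grad (fun x => g (par ch x)) _]/(d0 g p).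
  rewrite -[grad (fun x => h (par ch x)) _]/(d0 h p).
  by [].
have cA := chart_at_atlas p; set ch := chart_at p in cA *.
have cp := coord_img p.
have := coordinate_jacobi2 (@img_open _ _ _ ch) (ts cA) (proj2 ws _ cA)
    (proj2 Ls _ cA) (Es cA) (fun y _ => chart_alternatingb ch y)
    (fun y _ => chart_alternating2 ch y)
    (@chart_reeb_theta ch cA) (@chart_reeb_omega ch cA) (@chart_theta_sharp ch cA)
    (fun y z cy => @chart_sharp_omega ch cA y z cy) (fs _ cA) (gs _ cA) cp.
cbv beta; rewrite localb_coord local2_coord -!d2_cyclic.
rewrite coordK to_chart_coord mulmx1.
have bE : d0 (fun q => evalb (L q) (d0 f q) (d0 g q)) p =
    grad (fun y => evalb (localb L ch y) (grad (fun x => f (par ch x)) y)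
                                         (grad (fun x => g (par ch x)) y)) (Defs.coord p).
  by apply: d0_chart => y cy; exact: chart_bracket.
have eE f1 (s1 : smooth_fun f1) : d0 (fun q => pair1 (d0 f1 q) (E q)) p =
    grad (fun y => pair1 (grad (fun x => f1 (par ch x)) y)
      (E (par ch y) *m to_chart ch (par ch y))) (Defs.coord p).
  by apply: d0_chart => y cy; exact: chart_reeb_derivative.
rewrite -bE -(eE f fs) -(eE g gs).
rewrite -[grad (fun x => f (par ch x)) _]/(d0 f p) -[grad (fun x => g (par ch x)) _]/(d0 g p).
(* [lie_bivector] has the differential of E(f) in the first slot of the bivector, while the
   coordinate identity pairs it with X_g, that is, has it in the second one; hence the change of
   sign. *)
rewrite /lie_bivector => H; rewrite (evalb_alternating _ _ (proj1 Ls p)) opprK.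
exact: H.
Qed.

End ContactToJacobi.

(** * Contact structures at a single point *)

Section ContactPoint.
Context (R : realType) (n : nat).
Implicit Types (t z e : 'cV[R]_n) (Om L : 'M[R]_n) (E u v x : 'rV[R]_n).

Lemma pair1_addr z u v : pair1 z (u + v) = pair1 z u + pair1 z v.
Proof. by rewrite /pair1 mulmxDl mxE. Qed.

Lemma pair1_scaler z c v : pair1 z (c *: v) = c * pair1 z v.
Proof. by rewrite /pair1 -scalemxAl mxE. Qed.

Lemma pair1_oppr z v : pair1 z (- v) = - pair1 z v.
Proof. by rewrite /pair1 mulNmx mxE. Qed.

Lemma pair1_0r z : pair1 z 0 = 0.
Proof. by rewrite /pair1 mul0mx mxE. Qed.

Lemma pair1_0l v : pair1 (0 : 'cV[R]_n) v = 0.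
Proof. by rewrite /pair1 mulmx0 mxE. Qed.

Lemma pair1_inj u v : (forall z, pair1 z u = pair1 z v) -> u = v.
Proof.
move=> H; apply/rowP => i; have := H (delta_mx i 0).
by rewrite /pair1 -!colE !mxE.
Qed.

Lemma eval2E Om u v : eval2 Om u v = pair1 (Defs.contract u Om) v.
Proof.
rewrite /eval2 /pair1 /Defs.contract -[X in fun_of_matrix X]trmxK trmx_mul trmxK.
by rewrite mxE.
Qed.

Lemma eval2_addr Om u v x : eval2 Om u (v + x) = eval2 Om u v + eval2 Om u x.
Proof. by rewrite !eval2E pair1_addr. Qed.

Lemma eval2_scaler Om u c v : eval2 Om u (c *: v) = c * eval2 Om u v.
Proof. by rewrite !eval2E pair1_scaler. Qed.

Lemma eval2_oppr Om u v : eval2 Om u (- v) = - eval2 Om u v.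
Proof. by rewrite !eval2E pair1_oppr. Qed.

Lemma eval2_0r Om u : eval2 Om u 0 = 0.
Proof. by rewrite !eval2E pair1_0r. Qed.

Lemma eval2_addl Om u v x : eval2 Om (u + v) x = eval2 Om u x + eval2 Om v x.
Proof. by rewrite /eval2 !mulmxDl mxE. Qed.

Lemma eval2_scalel Om c u v : eval2 Om (c *: u) v = c * eval2 Om u v.
Proof. by rewrite /eval2 -!scalemxAl mxE. Qed.

Lemma eval2_oppl Om u v : eval2 Om (- u) v = - eval2 Om u v.
Proof. by rewrite /eval2 !mulNmx mxE. Qed.

Lemma eval2_0l Om v : eval2 Om 0 v = 0.
Proof. by rewrite /eval2 !mul0mx mxE. Qed.

Lemma eval2Z c Om u v : eval2 (c *: Om) u v = c * eval2 Om u v.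
Proof. by rewrite /eval2 -scalemxAr -scalemxAl mxE. Qed.

Lemma eval2N Om u v : eval2 (- Om) u v = - eval2 Om u v.
Proof. by rewrite -scaleN1r eval2Z mulN1r. Qed.

Lemma eval2_outer z e u v : eval2 (z *m e^T) u v = pair1 z u * pair1 e v.
Proof.
rewrite /eval2 /pair1 mulmxA -[_ *m e^T *m _]mulmxA -trmx_mul.
by rewrite [LHS]mxE big_ord1 [X in _ * X]mxE.
Qed.

Lemma eval2_conj m (J : 'M[R]_(m, n)) Om (u v : 'rV[R]_m) :
  eval2 (J *m Om *m J^T) u v = eval2 Om (u *m J) (v *m J).
Proof. by rewrite /eval2 trmx_mul !mulmxA. Qed.

Lemma pair1_mulmx m (J : 'M[R]_(m, n)) z (u : 'rV[R]_m) :
  pair1 (J *m z) u = pair1 z (u *m J).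
Proof. by rewrite /pair1 mulmxA. Qed.

Lemma pair1_sharpC L z e : L^T = - L -> pair1 e (sharp L z) = - pair1 z (sharp L e).
Proof. exact: evalb_alternating. Qed.

(** The equations of [contact_jacobi] at one point, tested on vectors. The condition that the
    bivector annihilates theta is turned by antisymmetry into: its image lies in ker theta. *)
Definition contact_point t Om L E : Prop :=
  [/\ Om^T = - Om, L^T = - L, pair1 t E = 1
    & (forall v, eval2 Om E v = 0) /\
      forall z, pair1 t (sharp L z) = 0 /\
        forall v, eval2 Om (sharp L z) v = - (pair1 z v - pair1 z E * pair1 t v)].

(** Pairing [u - v], which lies in ker theta, with [sharp L z] under [Om] gives back z(u - v) for
    every covector z. The bivector thus inverts [Om] on ker theta. *)
Lemma contact_point_inj t Om L E u v : contact_point t Om L E ->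
  pair1 t u = pair1 t v -> (forall x, eval2 Om u x = eval2 Om v x) -> u = v.
Proof.
move=> [Oa La tE [OE Oz]] tuv Ouv; apply: pair1_inj => z.
have [_ H] := Oz z.
have := H (u - v); rewrite eval2_addr eval2_oppr !(alternating_evalN (sharp L z) _ Oa) Ouv.
rewrite subrr !pair1_addr !pair1_oppr tuv subrr mulr0 subr0 => /esym/eqP.
by rewrite oppr_eq0 subr_eq0 => /eqP.
Qed.

End ContactPoint.

Lemma pair1_injl (R : realType) k (a b : 'cV[R]_k) :
  (forall u : 'rV[R]_k, pair1 a u = pair1 b u) -> a = b.
Proof.
move=> H; apply/colP => i; have := H (delta_mx 0 i).
by rewrite /pair1 -!rowE !mxE.
Qed.

Lemma eval2_inj (R : realType) n (A B : 'M[R]_n) :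
  (forall u v, eval2 A u v = eval2 B u v) -> A = B.
Proof.
move=> H; apply/matrixP => i j; have := H (delta_mx 0 i) (delta_mx 0 j).
by rewrite /eval2 -!rowE trmx_delta -!colE !mxE.
Qed.

Lemma sharpZr (R : realType) n (L : 'M[R]_n) c z : sharp L (c *: z) = c *: sharp L z.
Proof. by rewrite /sharp linearZ -scalemxAl. Qed.

Lemma contact_jacobi_point (R : realType) (n : nat) (M : manifold R (2 * n).+1)
    (t : field1 M) (w L : field2 M) (E : vec_field M) p :
  (forall p, Defs.alternating (w p)) -> contact_jacobi t w L E ->
  contact_point (t p) (d1 t p + w p) (L p) (E p).
Proof.
move=> wa [[La _] _ /(_ p) [tE OE tL Oz]]; split; [|exact: La|exact: tE|].
  by apply: alternatingD; [exact: d1_alternating|exact: wa].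
split=> [v|z]; first by rewrite eval2E OE /pair1 mulmx0 mxE.
split.
  rewrite pair1_sharpC; last exact: La.
  by rewrite tL pair1_0r oppr0.
by move=> v; rewrite eval2E Oz pair1N pair1D pair1N pair1Z.
Qed.

Lemma eq_contract (R : realType) n (A : 'M[R]_n) (u : 'rV[R]_n) (z : 'cV[R]_n) :
  (forall v, eval2 A u v = pair1 z v) -> Defs.contract u A = z.
Proof.
move=> H; apply/colP => i; have := H (delta_mx 0 i); rewrite eval2E /pair1 -!rowE.
by rewrite !mxE.
Qed.

(** [aE], [dv] and [tv] stand for da(E), da(v) and theta(v). The literal 0 and 1 are the known
    values of Om(E, v), da(Lam#(da)), theta(Lam#(da)) and theta(E). *)
Lemma conformal_solve1 (R : comRingType) (a b aE dv tv : R) : a * b = 1 ->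
  b * (- (dv - aE * tv) + a * 0)
  + ((- b ^+ 2 * 0 + a * (- b ^+ 2 * aE)) * tv - (0 + a * 1) * (- b ^+ 2 * dv)) = 0.
Proof.
move=> ab; rewrite [LHS](_ : _ = (1 - a * b) * b * (aE * tv - dv)); last by ring.
by rewrite ab subrr !mul0r.
Qed.

Lemma conformal_solve2 (R : comRingType) (a b zv zE tv zda dv : R) : a * b = 1 ->
  b * (a * - (zv - zE * tv)) + (a * (- b ^+ 2 * - zda) * tv - a * 0 * (- b ^+ 2 * dv))
  = - (zv - (zda + a * zE) * (b * tv)).
Proof.
move=> ab; rewrite [LHS](_ : _ = (a * b) * (- (zv - zE * tv) + b * zda * tv)); last by ring.
rewrite [RHS](_ : _ = - zv + (a * b) * zE * tv + b * zda * tv); last by ring.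
by rewrite ab; ring.
Qed.

(** * Conformal change of contact data *)

Section Conformal.
Context (R : realType) (n : nat) (M : manifold R (2 * n).+1).
Context (t : field1 M) (w L : field2 M) (E : vec_field M) (a b : M -> R).
Context (ts : form1 t) (ws : form2 w) (cJ : contact_jacobi t w L E).
Context (sa : smooth_fun a) (sb : smooth_fun b) (ab : forall p, a p * b p = 1).

Lemma conformal_form2 p u v :
  eval2 (d1 (fun q => b q *: t q) p + b p *: w p) u v =
  b p * eval2 (d1 t p + w p) u v
  + (pair1 (d0 b p) u * pair1 (t p) v - pair1 (t p) u * pair1 (d0 b p) v).
Proof.
rewrite (d1Z p sb ts) !eval2D eval2N !eval2Z !eval2_outer.
move: (eval2 _ _ _) (eval2 _ _ _) => x y; ring.
Qed.

Lemma d0_inverse p : d0 b p = - (b p ^+ 2) *: d0 a p.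
Proof.
have := d0M p sa sb; rewrite (_ : (fun q => _) = fun=> 1); last exact/funext.
rewrite d0_cst => /esym/eqP; rewrite addr_eq0 => /eqP H.
rewrite -[LHS]scale1r -(ab p) mulrC -scalerA H scalerN scalerA expr2 scaleNr.
by [].
Qed.

Lemma conformal_contact : contact_jacobi (fun p => b p *: t p) (fun p => b p *: w p)
  (conformal_bivector a L) (conformal_vector a L E).
Proof.
have [Ls Es _] := cJ.
split; [exact: bivector_fieldZ|apply: vector_fieldD|move=> p].
- by apply: vector_field_sharp => //; exact: form1_d0.
- exact: vector_fieldZ.
have [Oa La tE [OE Oz]] := contact_jacobi_point p (proj1 ws) cJ.
have [tS OS] := Oz (d0 a p).
have daS : pair1 (d0 a p) (sharp (L p) (d0 a p)) = 0.
  have := pair1_sharpC (d0 a p) (d0 a p) La; lra.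
have abp := ab p.
split.
- rewrite pair1Z pair1_addr pair1_scaler tS tE add0r mulr1 mulrC.
  exact: ab.
- apply: eq_contract => v; rewrite conformal_form2 d0_inverse /conformal_vector.
  rewrite !(pair1_addr, pair1_scaler, eval2_addl, eval2_scalel, pair1Z) tS tE OE OS daS.
  rewrite pair1_0l; exact: conformal_solve1.
- have [_ _ /(_ p) [_ _ tL _]] := cJ.
  have scale c d (z : 'cV[R]_((2 * n).+1)) A : sharp A z = 0 -> sharp (c *: A) (d *: z) = 0.
    by rewrite /sharp => H; rewrite [(d *: z)^T]linearZ /= -scalemxAr -scalemxAl H !scaler0.
  exact: scale.
move=> z; apply: eq_contract => v; rewrite conformal_form2 d0_inverse.
have -> : sharp (conformal_bivector a L p) z = a p *: sharp (L p) z.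
  by rewrite /sharp /conformal_bivector -scalemxAr.
have [tz Ozz] := Oz z.
rewrite !(pair1_addr, pair1_scaler, eval2_addl, eval2_scalel, pair1Z, pair1N, pair1D).
rewrite tz Ozz (pair1_sharpC z (d0 a p) La).
exact: conformal_solve2.
Qed.

End Conformal.

(** * Tangent maps of a Lie groupoid *)

Lemma tangent_square (R : realType) k m1 m2 n (M : manifold R k) (M1 : manifold R m1)
    (M2 : manifold R m2) (N : manifold R n) (p1 : M -> M1) (p2 : M -> M2)
    (q1 : M1 -> N) (q2 : M2 -> N) (c : M) (u : 'rV[R]_k) :
  smooth_map p1 -> smooth_map q1 -> smooth_map p2 -> smooth_map q2 ->
  (forall c, q1 (p1 c) = q2 (p2 c)) ->
  u *m tangent p1 c *m tangent q1 (p1 c) = u *m tangent p2 c *m tangent q2 (p2 c).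
Proof.
move=> s1 t1 s2 t2 E.
have F : q1 \o p1 = q2 \o p2 by apply/funext.
have := congr1 (fun phi => tangent phi c) F.
move: (tangent_comp c s1 t1) (tangent_comp c s2 t2) => -> -> H.
by rewrite -(mulmxA u) H mulmxA.
Qed.

Lemma tangent_triangle (R : realType) k m1 n (M : manifold R k) (M1 : manifold R m1)
    (N : manifold R n) (p1 : M -> M1) (q1 : M1 -> N) (phi : M -> N) (c : M) (u : 'rV[R]_k) :
  smooth_map p1 -> smooth_map q1 -> (forall c, q1 (p1 c) = phi c) ->
  u *m tangent p1 c *m tangent q1 (p1 c) = u *m tangent phi c.
Proof.
move=> s1 t1 E; have F : q1 \o p1 = phi by apply/funext.
have := congr1 (fun phi => tangent phi c) F.
by move: (tangent_comp c s1 t1) => -> <-; rewrite mulmxA.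
Qed.

Section GroupoidTangent.
Context (R : realType) (k m : nat) (Gam : manifold R k) (Gam0 : manifold R m).
Context (G : lie_groupoid Gam Gam0).
Implicit Types (z : Defs.comp G) (g h : Gam) (x : Gam0) (u v w y : 'rV[R]_k).

Let fp := comp_fibre_product G.
Let ssm : smooth_map (src G) := proj1 (src_submersion G).
Let tsm : smooth_map (tgt G) := proj1 (tgt_submersion G).
Let esm : smooth_map (idt G) := idt_smooth G.
Let ism : smooth_map (invg G) := invg_smooth G.
Let p1sm : smooth_map (pr1 G) := fp_smooth1 fp.
Let p2sm : smooth_map (pr2 G) := fp_smooth2 fp.
Let msm : smooth_map (mult G) := mult_smooth G.

Lemma comp_comm z : src G (pr1 G z) = tgt G (pr2 G z).
Proof. exact: (fp_comm fp z). Qed.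

Lemma pairingK z : pairing G (pr1 G z) (pr2 G z) = z.
Proof.
apply: (fp_inj fp); first by rewrite pr1_pairing // comp_comm.
by rewrite pr2_pairing // comp_comm.
Qed.

Lemma multE z : mult G z = gmul G (pr1 G z) (pr2 G z).
Proof. by rewrite /gmul pairingK. Qed.

(** The pair of tangent projections is injective on the composable pairs, so the pseudo-inverse in
    [tangent_mul] recovers [U] from its two projections. *)
Lemma tangent_mulE z (U : 'rV[R]_(comp_dim G)) :
  tangent_mul G (pr1 G z) (pr2 G z) (U *m tangent (pr1 G) z) (U *m tangent (pr2 G) z)
  = U *m tangent (mult G) z.
Proof.
rewrite /tangent_mul pairingK -mul_mx_row; congr (_ *m _).
by rewrite mulmxKp //; exact: (fp_tangent_inj fp).
Qed.

Definition composable g h v w : Prop :=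
  v *m tangent (src G) g = w *m tangent (tgt G) h.

Lemma composable_proj z (U : 'rV[R]_(comp_dim G)) :
  composable (pr1 G z) (pr2 G z) (U *m tangent (pr1 G) z) (U *m tangent (pr2 G) z).
Proof. exact: (tangent_square z U p1sm ssm p2sm tsm comp_comm). Qed.

Lemma tangent_mul_at z (U : 'rV[R]_(comp_dim G)) g h v w y :
  pr1 G z = g -> pr2 G z = h -> U *m tangent (pr1 G) z = v ->
  U *m tangent (pr2 G) z = w -> U *m tangent (mult G) z = y ->
  composable g h v w /\ tangent_mul G g h v w = y.
Proof.
by move=> <- <- <- <- <-; split; [exact: composable_proj|exact: tangent_mulE].
Qed.

Section PairMap.
Context (l : nat) (Q : manifold R l) (p q : Q -> Gam).
Context (psm : smooth_map p) (qsm : smooth_map q).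
Context (pq : forall c, src G (p c) = tgt G (q c)).

Definition pair_map (c : Q) : Defs.comp G := pairing G (p c) (q c).

Lemma pr1_pair_map : pr1 G \o pair_map = p.
Proof. by apply/funext => c /=; rewrite pr1_pairing. Qed.

Lemma pr2_pair_map : pr2 G \o pair_map = q.
Proof. by apply/funext => c /=; rewrite pr2_pairing. Qed.

Lemma smooth_pair_map : smooth_map pair_map.
Proof.
by apply: (fp_universal fp); [rewrite pr1_pair_map|rewrite pr2_pair_map].
Qed.

Lemma pr1_pair_mapE c : pr1 G (pair_map c) = p c.
Proof. exact: pr1_pairing. Qed.

Lemma pr2_pair_mapE c : pr2 G (pair_map c) = q c.
Proof. exact: pr2_pairing. Qed.

Lemma tangent_mul_pair_map c (u : 'rV[R]_l) g h v w y : p c = g -> q c = h ->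
  u *m tangent p c = v -> u *m tangent q c = w ->
  u *m tangent (fun c => gmul G (p c) (q c)) c = y ->
  composable g h v w /\ tangent_mul G g h v w = y.
Proof.
have U1 := tangent_triangle c u smooth_pair_map p1sm pr1_pair_mapE.
have U2 := tangent_triangle c u smooth_pair_map p2sm pr2_pair_mapE.
have U3 := tangent_triangle c u smooth_pair_map msm
  (fun c => erefl : mult G (pair_map c) = gmul G (p c) (q c)).
move=> pg qh pv qw ry.
exact: (tangent_mul_at (etrans (pr1_pair_mapE c) pg) (etrans (pr2_pair_mapE c) qh)
  (etrans U1 pv) (etrans U2 qw) (etrans U3 ry)).
Qed.

End PairMap.

Lemma composable_lift g h v w : src G g = tgt G h -> composable g h v w ->
  exists z (U : 'rV[R]_(comp_dim G)), [/\ pr1 G z = g, pr2 G z = h,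
    U *m tangent (pr1 G) z = v & U *m tangent (pr2 G) z = w].
Proof.
move=> gh vw; have [z zg zh] := fp_surj fp gh.
have [|U Uv Uw] := @fp_tangent_surj _ _ _ _ _ _ _ _ _ _ _ _ _ fp z v w; first by rewrite zg zh.
exact: (ex_intro _ z (ex_intro _ U (And4 zg zh Uv Uw))).
Qed.

Lemma submersion_surj l n (M : manifold R l) (N : manifold R n) (phi : M -> N) p
  (v : 'rV[R]_n) : submersion phi -> exists u : 'rV[R]_l, u *m tangent phi p = v.
Proof.
move=> [_ /(_ p) full]; exists (v *m pinvmx (tangent phi p)).
by rewrite -mulmxA mulVpmx // mulmx1.
Qed.

Lemma composable_r g h v : exists w, composable g h v w.
Proof.
have [w E] := submersion_surj h (v *m tangent (src G) g) (tgt_submersion G).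
by exists w; exact: esym E.
Qed.

Lemma tangent_mul_src g h v w : src G g = tgt G h -> composable g h v w ->
  tangent_mul G g h v w *m tangent (src G) (gmul G g h) = w *m tangent (src G) h.
Proof.
move=> gh vw; have [z [U [zg zh zv zw]]] := composable_lift gh vw.
have E c : src G (mult G c) = src G (pr2 G c) by rewrite multE (src_mul (comp_comm c)).
have := tangent_square z U msm ssm p2sm ssm E; have := tangent_mulE z U; have := multE z.
by move: zg zh zv zw => <- <- <- <- -> ->.
Qed.

Lemma tangent_mul_tgt g h v w : src G g = tgt G h -> composable g h v w ->
  tangent_mul G g h v w *m tangent (tgt G) (gmul G g h) = v *m tangent (tgt G) g.
Proof.
move=> gh vw; have [z [U [zg zh zv zw]]] := composable_lift gh vw.
have E c : tgt G (mult G c) = tgt G (pr1 G c) by rewrite multE (tgt_mul (comp_comm c)).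
have := tangent_square z U msm tsm p1sm tsm E; have := tangent_mulE z U; have := multE z.
by move: zg zh zv zw => <- <- <- <- -> ->.
Qed.

(* The involution (g, h) |-> (g^-1, gh) exchanges the second projection and the
   product; it replaces the implicit function theorem in what follows. *)
Definition twist : Defs.comp G -> Defs.comp G :=
  pair_map (invg G \o pr1 G) (mult G).

Lemma twist_comm z : src G ((invg G \o pr1 G) z) = tgt G (mult G z).
Proof. by rewrite /= src_inv multE (tgt_mul (comp_comm z)). Qed.

Let isp1 : smooth_map (invg G \o pr1 G) := smooth_map_comp p1sm ism.

Lemma smooth_twist : smooth_map twist.
Proof. exact: (smooth_pair_map isp1 msm twist_comm). Qed.

Lemma pr1_twist z : pr1 G (twist z) = invg G (pr1 G z).
Proof. exact: (pr1_pairing (twist_comm z)). Qed.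

Lemma pr2_twist z : pr2 G (twist z) = mult G z.
Proof. exact: (pr2_pairing (twist_comm z)). Qed.

Lemma mult_twist z : mult G (twist z) = pr2 G z.
Proof.
rewrite (multE (twist z)) pr1_twist pr2_twist multE.
rewrite (Defs.mulA (src_inv G (pr1 G z)) (comp_comm z)) mul_inv_l comp_comm.
exact: mul_idt_l.
Qed.

Lemma invgK g : invg G (invg G g) = g.
Proof.
have E1 := mul_idt_l G g; have E2 := mul_inv_l G (invg G g).
rewrite src_inv in E2; rewrite -E2 -(Defs.mulA (src_inv G (invg G g)) (src_inv G g)) in E1.
rewrite mul_inv_l in E1; have E3 := mul_idt_r G (invg G (invg G g)).
rewrite src_inv tgt_inv in E3.
by rewrite E3 in E1.
Qed.

Lemma twistK z : twist (twist z) = z.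
Proof.
apply: (fp_inj fp).
  by rewrite !pr1_twist invgK.
by rewrite pr2_twist mult_twist.
Qed.

(** Since [mult] composed with [twist] is [pr2], a lift of [y] through [pr2] at the twisted point is
    carried by T [twist] to a lift through [mult]. If [y] is tangent to the target fibre, the first
    component of the lift can be taken to be 0, and it stays 0 under T [invg]. *)
Lemma tangent_mul_surj g h y : src G g = tgt G h ->
  exists v w, [/\ composable g h v w, tangent_mul G g h v w = y &
    y *m tangent (tgt G) (gmul G g h) = 0 -> v = 0].
Proof.
move=> gh; have [z [z' [zg zh zz z2]]] : exists z z', [/\ pr1 G z = g, pr2 G z = h,
    twist z' = z & pr2 G z' = gmul G g h].
  have [z zg zh] := fp_surj fp gh; exists z, (twist z).
  by split; [exact: zg|exact: zh|exact: twistK|rewrite pr2_twist multE zg zh].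
have [U' [U'2 U'1]] : exists U' : 'rV[R]_(comp_dim G),
    U' *m tangent (pr2 G) z' = y /\
    (y *m tangent (tgt G) (gmul G g h) = 0 -> U' *m tangent (pr1 G) z' = 0).
  move: z2 => <-.
  have [v0 v0E] := submersion_surj (pr1 G z') (y *m tangent (tgt G) (pr2 G z'))
    (src_submersion G).
  (* One lift has to serve both conclusions: for [y] tangent to the target fibre it is chosen with
     first component 0, and otherwise the implication is vacuous. *)
  have [y0|yN0] := eqVneq (y *m tangent (tgt G) (pr2 G z')) 0.
    have [U' U1 U2] := @fp_tangent_surj _ _ _ _ _ _ _ _ _ _ _ _ _ fp z' 0 y
      (etrans (mul0mx _ _) (esym y0)).
    exact: (ex_intro _ U' (conj U2 (fun=> U1))).
  have [U' U1 U2] := fp_tangent_surj fp v0E.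
  exists U'; split; first exact: U2.
  by move=> H; case/eqP: yN0.
have Umm := etrans (tangent_triangle z' U' smooth_twist msm mult_twist) U'2.
have Up1 := tangent_square z' U' smooth_twist p1sm p1sm ism pr1_twist.
move: (U' *m tangent twist z') Umm Up1; rewrite zz => U Umm Up1.
exists (U *m tangent (pr1 G) z), (U *m tangent (pr2 G) z).
have [c E] := tangent_mul_at zg zh erefl erefl Umm.
split; [exact: c|exact: E|].
by move=> /U'1 U'0; rewrite Up1 U'0 mul0mx.
Qed.

Lemma tangent_mul_idt_r g v :
  let w := v *m tangent (src G) g *m tangent (idt G) (src G g) in
  composable g (idt G (src G g)) v w /\ tangent_mul G g (idt G (src G g)) v w = v.
Proof.
have es : smooth_map (fun q => idt G (src G q)) := smooth_map_comp ssm esm.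
have idm := smooth_map_id Gam.
have c (q : Gam) : src G q = tgt G (idt G (src G q)) by rewrite tgt_idt.
have E1 : v *m tangent (fun q : Gam => q) g = v by rewrite tangent_id mulmx1.
have E2 := tangent_triangle g v ssm esm (fun q => erefl (idt G (src G q))).
have E3 := congr1 (fun phi => v *m tangent phi g) (funext (mul_idt_r G)).
exact: (tangent_mul_pair_map idm es c erefl erefl E1 (esym E2) (etrans E3 E1)).
Qed.

Lemma tangent_src_idt x (u : 'rV[R]_m) :
  u *m tangent (idt G) x *m tangent (src G) (idt G x) = u.
Proof. by rewrite (tangent_triangle x u esm ssm (src_idt G)) tangent_id mulmx1. Qed.

Lemma tangent_tgt_idt x (u : 'rV[R]_m) :
  u *m tangent (idt G) x *m tangent (tgt G) (idt G x) = u.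
Proof. by rewrite (tangent_triangle x u esm tsm (tgt_idt G)) tangent_id mulmx1. Qed.

Lemma tangent_src_inv g u :
  u *m tangent (invg G) g *m tangent (src G) (invg G g) = u *m tangent (tgt G) g.
Proof. exact: (tangent_triangle g u ism ssm (src_inv G)). Qed.

Lemma tangent_tgt_inv g u :
  u *m tangent (invg G) g *m tangent (tgt G) (invg G g) = u *m tangent (src G) g.
Proof. exact: (tangent_triangle g u ism tsm (tgt_inv G)). Qed.

Lemma tangent_inv_surj g y : exists u, u *m tangent (invg G) g = y.
Proof.
exists (y *m tangent (invg G) (invg G g)).
have := tangent_triangle (invg G g) y ism ism (fun q => invgK q).
by rewrite invgK tangent_id mulmx1.
Qed.

Lemma invg_idt x : invg G (idt G x) = idt G x.
Proof.
have E := mul_idt_l G (invg G (idt G x)).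
rewrite tgt_inv src_idt in E.
have := mul_inv_r G (idt G x); rewrite tgt_idt => E'.
by rewrite -E.
Qed.

End GroupoidTangent.

(** * Twisted contact groupoids *)

Section ContactGroupoid.
Context (R : realType) (n m : nat) (Gam : manifold R (2 * n).+1) (Gam0 : manifold R m).
Context (G : lie_groupoid Gam Gam0).
Context (theta : field1 Gam) (omega : field2 Gam) (r : Gam -> R).
Context (Lam : field2 Gam) (E : vec_field Gam).
Context (hG : twisted_contact_groupoid G theta omega r).
Context (hJ : contact_jacobi theta omega Lam E).
Implicit Types (g h : Gam) (x : Gam0) (u v w y : 'rV[R]_((2 * n).+1)).

Let Om g := d1 theta g + omega g.
Let th g v := pair1 (theta g) v.
Let dr g v := pair1 (d0 r g) v.
Let Ts g v := v *m tangent (src G) g.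
Let Tt g v := v *m tangent (tgt G) g.
Let Ti g v := v *m tangent (invg G) g.
Let TM g h v w := tangent_mul G g h v w.

Let ssm : smooth_map (src G) := proj1 (src_submersion G).
Let tsm : smooth_map (tgt G) := proj1 (tgt_submersion G).
Let esm : smooth_map (idt G) := idt_smooth G.
Let ism : smooth_map (invg G) := invg_smooth G.
Let p1sm : smooth_map (pr1 G) := fp_smooth1 (comp_fibre_product G).
Let p2sm : smooth_map (pr2 G) := fp_smooth2 (comp_fibre_product G).
Let msm : smooth_map (mult G) := mult_smooth G.

Lemma groupoid_theta_form1 : form1 theta. Proof. by case: hG => -[]. Qed.
Lemma groupoid_omega_form2 : form2 omega. Proof. by case: hG => -[]. Qed.
Lemma groupoid_r_smooth : smooth_fun r. Proof. by case: hG. Qed.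

Lemma groupoid_contact_point g : contact_point (theta g) (Om g) (Lam g) (E g).
Proof. exact: contact_jacobi_point (proj1 groupoid_omega_form2) hJ. Qed.

Let liftP g h v w : src G g = tgt G h -> composable G g h v w ->
  exists z (U : 'rV[R]_(comp_dim G)),
  [/\ pr1 G z = g, pr2 G z = h & mult G z = gmul G g h] /\
  [/\ U *m tangent (pr1 G) z = v, U *m tangent (pr2 G) z = w
    & U *m tangent (mult G) z = TM g h v w].
Proof.
move=> gh vw; have [z [U [zg zh zv zw]]] := composable_lift gh vw.
have [_ zy] := tangent_mul_at zg zh zv zw erefl.
have zm : mult G z = gmul G g h by rewrite multE zg zh.
exact: (ex_intro _ z (ex_intro _ U (conj (And3 zg zh zm) (And3 zv zw (esym zy))))).
Qed.

(** The product and the image vector are named by [k] and [y], because tangent spaces depend on the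
    point and the groupoid laws have to be applied to both together. *)
Lemma theta_mul g h k v w y : src G g = tgt G h -> composable G g h v w ->
  gmul G g h = k -> TM g h v w = y -> th k y = expR (- r h) * th g v + th h w.
Proof.
move=> gh /(liftP gh) [z [U [[zg zh zm] [zv zw zy]]]] ghk vwy.
have {}zm := etrans zm ghk; have {}zy := etrans zy vwy.
have [_ _ _ /(_ z) H] := hG.
have : pair1 (pull1 (mult G) theta z) U = expR (- r (pr2 G z)) * pair1 (pull1 (pr1 G) theta z) U
  + pair1 (pull1 (pr2 G) theta z) U by rewrite H pair1D pair1Z.
rewrite /pull1 !pair1_mulmx /th.
by move: zg zh zm zv zw zy => <- <- <- <- <- <-.
Qed.

Let idt_mul x : gmul G (idt G x) (idt G x) = idt G x.
Proof. by have := mul_idt_l G (idt G x); rewrite tgt_idt. Qed.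

Let src_tgt_idt x : src G (idt G x) = tgt G (idt G x).
Proof. by rewrite src_idt tgt_idt. Qed.

(** Differentiating 1 1 = 1 along the units gives a = e^-r a + a for the value a of theta, and the
    exponential does not vanish. *)
Lemma theta_idt x (u : 'rV[R]_m) : th (idt G x) (u *m tangent (idt G) x) = 0.
Proof.
have E1 := congr1 (fun phi => u *m tangent phi x) (funext idt_mul).
have [cv cE] := tangent_mul_pair_map esm esm src_tgt_idt erefl erefl erefl erefl E1.
have := theta_mul (src_tgt_idt x) cv (idt_mul x) cE.
move: (th _ _) => a H; have e0 := expR_gt0 (- r (idt G x)).
have : expR (- r (idt G x)) * a = 0 by apply: (addIr a); rewrite -H add0r.
by move/eqP; rewrite mulf_eq0 (gt_eqF e0) /= => /eqP.
Qed.

(** Differentiating g^-1 g = 1 gives 0 = e^-r(g) theta(T iota u) + theta(u), as theta vanishes along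
    the units. *)
Lemma theta_inv g u : th (invg G g) (Ti g u) = - expR (r g) * th g u.
Proof.
have E1 : u *m tangent (fun q : Gam => q) g = u by rewrite tangent_id mulmx1.
have E2 := congr1 (fun phi => u *m tangent phi g) (funext (mul_inv_l G)).
have E3 := tangent_triangle g u ssm esm (fun q => erefl (idt G (src G q))).
have [cv cE] := tangent_mul_pair_map ism (smooth_map_id Gam) (src_inv G) erefl erefl erefl E1
  (etrans E2 (esym E3)).
have := theta_mul (src_inv G g) cv (mul_inv_l G g) cE.
rewrite theta_idt; move: (th _ _) (th g u) => a b /esym/eqP.
rewrite addr_eq0 => /eqP H.
by rewrite -[a]mul1r -expR0 -(subrr (r g)) expRD -mulrA H mulrN mulNr.
Qed.

Lemma inv_cancel g h v w : src G g = tgt G h -> composable G g h v w ->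
  composable G (invg G g) (gmul G g h) (Ti g v) (TM g h v w) /\
  TM (invg G g) (gmul G g h) (Ti g v) (TM g h v w) = w.
Proof.
move=> gh /(liftP gh) [z [U [[zg zh zm] [zv zw zy]]]].
have E1 := tangent_triangle z U p1sm ism (fun q => erefl (invg G (pr1 G q))).
have e q : gmul G (invg G (pr1 G q)) (mult G q) = pr2 G q.
  by have := mult_twist q; rewrite multE pr1_twist pr2_twist.
have E2 := congr1 (fun phi => U *m tangent phi z) (funext e).
have E3 : U *m tangent (pr1 G) z *m tangent (invg G) (pr1 G z) = Ti g v.
  by move: zg zv => <- <-.
exact: (tangent_mul_pair_map (smooth_map_comp p1sm ism) msm (twist_comm (G := G))
  (congr1 (invg G) zg) zm (etrans (esym E1) E3) zy (etrans E2 zw)).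
Qed.

Lemma inv_mul_cancel g h : src G g = tgt G h -> gmul G (invg G g) (gmul G g h) = h.
Proof.
by move=> gh; rewrite (Defs.mulA (src_inv G g) gh) mul_inv_l gh mul_idt_l.
Qed.

Let src_inv_mul g h : src G g = tgt G h -> src G (invg G g) = tgt G (gmul G g h).
Proof. by move=> gh; rewrite src_inv (tgt_mul gh). Qed.

Lemma theta_reeb g : th g (E g) = 1.
Proof. by case: (groupoid_contact_point g). Qed.

(** The value of theta on w, computed through g^-1 (g h) = h with first vector [E g], is theta(w) +
    e^-r(h) - e^(r(g) - r(gh)). The normalisation theta(E) = 1 makes the exponents comparable. *)
Lemma r_mul g h : src G g = tgt G h -> r (gmul G g h) = r g + r h.
Proof.
move=> gh; have [w vw] := @composable_r _ _ _ _ _ G g h (E g).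
have [cv cE] := inv_cancel gh vw.
have := theta_mul (src_inv_mul gh) cv (inv_mul_cancel gh) cE.
rewrite theta_inv (theta_mul gh vw erefl erefl) theta_reeb !mulr1.
move: (th h w) => b /esym/eqP; rewrite addrA -subr_eq0 addrK addrC mulrN subr_eq0 -expRD => /eqP.
move/(@expR_inj R) => H.
by move: (r g) (r h) (r _) H => x y z; lra.
Qed.

Lemma r_idt x : r (idt G x) = 0.
Proof.
have := r_mul (src_tgt_idt x); rewrite idt_mul => /eqP.
by rewrite -subr_eq0 opprD addrA subrr add0r oppr_eq0 => /eqP.
Qed.

Lemma r_inv g : r (invg G g) = - r g.
Proof.
have := r_mul (src_inv G g); rewrite mul_inv_l r_idt => /esym/eqP.
by rewrite addr_eq0 => /eqP.
Qed.

Lemma dr_idt x (u : 'rV[R]_m) : dr (idt G x) (u *m tangent (idt G) x) = 0.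
Proof.
have H := d0_comp x esm groupoid_r_smooth.
rewrite /dr -pair1_mulmx; move: (tangent _ _ *m _) H => c <-.
rewrite (_ : (fun q => _) = fun=> 0); last by apply/funext; exact: r_idt.
by rewrite d0_cst pair1_0l.
Qed.

Lemma dr_inv g u : dr (invg G g) (Ti g u) = - dr g u.
Proof.
have H := d0_comp g ism groupoid_r_smooth.
rewrite /dr /Ti -pair1_mulmx; move: (tangent _ _ *m _) H => c <-.
rewrite (_ : (fun q => _) = fun q => - r q); last by apply/funext; exact: r_inv.
by rewrite d0N ?pair1N //; exact: groupoid_r_smooth.
Qed.

Lemma dr_mul g h k v w y : src G g = tgt G h -> composable G g h v w ->
  gmul G g h = k -> TM g h v w = y -> dr k y = dr g v + dr h w.
Proof.
move=> gh /(liftP gh) [z [U [[zg zh zm] [zv zw zy]]]] ghk vwy.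
have {}zm := etrans zm ghk; have {}zy := etrans zy vwy.
have rs := groupoid_r_smooth.
have e : (fun q => r (mult G q)) = fun q => r (pr1 G q) + r (pr2 G q).
  by apply/funext => q; rewrite multE (r_mul (comp_comm q)).
have H0 := d0_comp z msm rs; have H1 := d0_comp z p1sm rs; have H2 := d0_comp z p2sm rs.
have := d0D z (smooth_fun_comp p1sm rs) (smooth_fun_comp p2sm rs).
rewrite -e => H3.
have H4 := etrans (esym H0) (etrans H3 (congr2 +%R H1 H2)).
have := congr1 (fun c => pair1 c U) H4; rewrite pair1D !pair1_mulmx /dr.
by move: zg zh zm zv zw zy => <- <- <- <- <- <-.
Qed.

Lemma d_pull1 l (Q : manifold R l) (phi : Q -> Gam) z (U V : 'rV[R]_l) : smooth_map phi ->
  eval2 (d1 (pull1 phi theta) z) U V =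
  eval2 (d1 theta (phi z)) (U *m tangent phi z) (V *m tangent phi z).
Proof.
by move=> ps; rewrite d1_pull1 ?eval2_conj //; exact: groupoid_theta_form1.
Qed.

Let e_pr2 : smooth_fun (fun z : Defs.comp G => expR (- r (pr2 G z))).
Proof. exact/smooth_fun_exp/smooth_funN/(smooth_fun_comp p2sm)/groupoid_r_smooth. Qed.

(** The equation for theta lives on the manifold of composable pairs, where its exterior derivative
    is taken; the last term comes from the derivative of the coefficient e^-r. *)
Lemma dtheta_mul_at z (U V : 'rV[R]_(comp_dim G)) :
  let u1 := U *m tangent (pr1 G) z in let v1 := V *m tangent (pr1 G) z in
  let u2 := U *m tangent (pr2 G) z in let v2 := V *m tangent (pr2 G) z in
  eval2 (d1 theta (mult G z)) (U *m tangent (mult G) z) (V *m tangent (mult G) z) =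
  expR (- r (pr2 G z)) * eval2 (d1 theta (pr1 G z)) u1 v1
  + eval2 (d1 theta (pr2 G z)) u2 v2
  - expR (- r (pr2 G z)) * (dr (pr2 G z) u2 * th (pr1 G z) v1 - th (pr1 G z) u1 * dr (pr2 G z) v2).
Proof.
move=> u1 v1 u2 v2; have rs := groupoid_r_smooth; have ts := groupoid_theta_form1.
rewrite -(d_pull1 _ _ _ msm) -(d_pull1 _ _ _ p1sm) -(d_pull1 _ _ _ p2sm).
have f1 := form1_pull1 p1sm ts; have f2 := form1_pull1 p2sm ts.
have e : pull1 (mult G) theta = fun z => expR (- r (pr2 G z)) *: pull1 (pr1 G) theta z
     + pull1 (pr2 G) theta z by apply/funext => q; case: hG.
rewrite e (d1D z (form1Z e_pr2 f1) f2) (d1Z z e_pr2 f1) !eval2D eval2N eval2Z !eval2_outer.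
have H0 : d0 (fun q => expR (- r (pr2 G q))) z =
    - (expR (- r (pr2 G z)) *: (tangent (pr2 G) z *m d0 r (pr2 G z))).
  have H1 := d0_comp z p2sm rs.
  have H2 := d0_exp z (smooth_funN (smooth_fun_comp p2sm rs)).
  rewrite H2 d0N; last exact: (smooth_fun_comp p2sm rs).
  by rewrite H1 scalerN.
rewrite H0 !pair1N !pair1Z /dr /th -!pair1_mulmx.
move: (eval2 _ _ _) (eval2 _ _ _) (pair1 _ _) (pair1 _ _) (pair1 _ _) (pair1 _ _) (expR _).
by move=> *; ring.
Qed.

(** Both arguments of a 2-form must be lifted over the same point, so [z] is given here instead of
    being produced with the lift as in [liftP]. *)
Let lift_at z g h v w : pr1 G z = g -> pr2 G z = h -> composable G g h v w ->
  exists2 U : 'rV[R]_(comp_dim G), U *m tangent (pr1 G) z = v & U *m tangent (pr2 G) z = w.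
Proof.
by move=> <- <- vw; exact: (fp_tangent_surj (comp_fibre_product G) vw).
Qed.

Lemma dtheta_mul g h k v w y v' w' y' : src G g = tgt G h ->
  composable G g h v w -> composable G g h v' w' ->
  gmul G g h = k -> TM g h v w = y -> TM g h v' w' = y' ->
  eval2 (d1 theta k) y y' = expR (- r h) * eval2 (d1 theta g) v v'
    + eval2 (d1 theta h) w w' - expR (- r h) * (dr h w * th g v' - th g v * dr h w').
Proof.
move=> gh vw vw' ghk wy wy'; have [z zg zh] := fp_surj (comp_fibre_product G) gh.
have [U U1 U2] := lift_at zg zh vw; have [V V1 V2] := lift_at zg zh vw'.
have zk : mult G z = k by rewrite multE zg zh.
have [_ Uy] := tangent_mul_at zg zh U1 U2 erefl.
have [_ Vy] := tangent_mul_at zg zh V1 V2 erefl.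
have := dtheta_mul_at z U V.
have {}Uy := etrans (esym Uy) wy; have {}Vy := etrans (esym Vy) wy'.
by move: zg zh zk U1 U2 Uy V1 V2 Vy => <- <- <- <- <- <- <- <- <-.
Qed.

Lemma omega_base : exists W : Gam0 -> 'rV[R]_m -> 'rV[R]_m -> R, forall g u v,
  eval2 (omega g) u v = W (src G g) (Ts g u) (Ts g v)
    - expR (- r g) * W (tgt G g) (Tt g u) (Tt g v).
Proof.
have [_ _ [w0 _ H] _] := hG; exists (fun x => eval2 (w0 x)) => g u v.
rewrite H eval2D eval2N eval2Z.
have E1 := eval2_conj (tangent (src G) g) (w0 (src G g)) u v.
have E2 := eval2_conj (tangent (tgt G) g) (w0 (tgt G g)) u v.
exact (congr2 (fun a b => a - expR (- r g) * b) E1 E2).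
Qed.

(** The two terms over the common point alpha(g) = beta(h) cancel, and the remaining exponentials
    combine since [r] is multiplicative. *)
Lemma omega_mul g h k v w y v' w' y' : src G g = tgt G h ->
  composable G g h v w -> composable G g h v' w' ->
  gmul G g h = k -> TM g h v w = y -> TM g h v' w' = y' ->
  eval2 (omega k) y y' = expR (- r h) * eval2 (omega g) v v' + eval2 (omega h) w w'.
Proof.
move=> gh vw vw' <- <- <-; have [W WE] := omega_base; rewrite !WE.
have s1 := tangent_mul_src gh vw; have s2 := tangent_mul_src gh vw'.
have t1 := tangent_mul_tgt gh vw; have t2 := tangent_mul_tgt gh vw'.
rewrite -/(TM g h v w) -/(TM g h v' w') in s1 s2 t1 t2 *.
have -> : Ts (gmul G g h) (TM g h v w) = Ts h w := s1.
have -> : Ts (gmul G g h) (TM g h v' w') = Ts h w' := s2.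
have -> : Tt (gmul G g h) (TM g h v w) = Tt g v := t1.
have -> : Tt (gmul G g h) (TM g h v' w') = Tt g v' := t2.
have -> : Ts g v = Tt h w := vw.
have -> : Ts g v' = Tt h w' := vw'.
rewrite (src_mul gh) (tgt_mul gh) (r_mul gh) gh opprD expRD.
move: (W _ _ _) (W _ _ _) (W _ _ _) (expR _) (expR _) => *; ring.
Qed.

Lemma Om_mul g h k v w y v' w' y' : src G g = tgt G h ->
  composable G g h v w -> composable G g h v' w' ->
  gmul G g h = k -> TM g h v w = y -> TM g h v' w' = y' ->
  eval2 (Om k) y y' = expR (- r h) * eval2 (Om g) v v'
    + eval2 (Om h) w w' - expR (- r h) * (dr h w * th g v' - th g v * dr h w').
Proof.
move=> gh vw vw' ghk wy wy'; rewrite /Om !eval2D.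
rewrite (dtheta_mul gh vw vw' ghk wy wy') (omega_mul gh vw vw' ghk wy wy').
by move: (eval2 _ _ _) (eval2 _ _ _) (eval2 _ _ _) (eval2 _ _ _) (expR _) => *; ring.
Qed.

Lemma pull1_inv g : pull1 (invg G) theta g = - expR (r g) *: theta g.
Proof.
by apply: pair1_injl => u; rewrite pair1Z -[RHS]theta_inv /pull1 pair1_mulmx.
Qed.

Lemma omega_inv g u v :
  eval2 (omega (invg G g)) (Ti g u) (Ti g v) = - expR (r g) * eval2 (omega g) u v.
Proof.
have [W WE] := omega_base; rewrite !WE r_inv src_inv tgt_inv.
have si a : Ts (invg G g) (Ti g a) = Tt g a := tangent_src_inv G g a.
have ti a : Tt (invg G g) (Ti g a) = Ts g a := tangent_tgt_inv G g a.
rewrite !si !ti opprK.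
have : expR (r g) * expR (- r g) = 1 by rewrite -expRD subrr expR0.
move: (W _ _ _) (W _ _ _) (expR _) (expR _) => b c a d ad.
by rewrite -[c in LHS]mul1r -ad; ring.
Qed.

Lemma Om_inv g u v : eval2 (Om (invg G g)) (Ti g u) (Ti g v) =
  - expR (r g) * (eval2 (Om g) u v + dr g u * th g v - th g u * dr g v).
Proof.
have rs := groupoid_r_smooth; have ts := groupoid_theta_form1.
have ers : smooth_fun (fun g => - expR (r g)) by exact/smooth_funN/smooth_fun_exp.
rewrite /Om !eval2D -[eval2 (d1 theta _) _ _](d_pull1 _ _ _ ism).
have -> : pull1 (invg G) theta = fun g => - expR (r g) *: theta g.
  by apply/funext; exact: pull1_inv.
rewrite (d1Z g ers ts) (d0N _ (smooth_fun_exp rs)) (d0_exp _ rs).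
rewrite !eval2D eval2N !eval2_outer !eval2Z !pair1N !pair1Z -/(dr g u) -/(dr g v).
rewrite omega_inv -/(th g u) -/(th g v).
move: (eval2 _ _ _) (eval2 _ _ _) (dr _ _) (dr _ _) (th _ _) (th _ _) (expR _).
by move=> *; ring.
Qed.

Lemma Om_idt x (u v : 'rV[R]_m) :
  eval2 (Om (idt G x)) (u *m tangent (idt G) x) (v *m tangent (idt G) x) = 0.
Proof.
have ts := groupoid_theta_form1; have ps := form1_pull1 esm ts.
rewrite /Om eval2D -[eval2 (d1 theta _) _ _](_ :
  eval2 (d1 (pull1 (idt G) theta) x) u v = _); last first.
  by rewrite (d1_pull1 x esm ts) eval2_conj.
(* Writing the zero form as 0 times itself lets the product rule [d1Z] compute its exterior
   derivative. *)
have e : pull1 (idt G) theta = fun x => 0 *: pull1 (idt G) theta x.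
  apply/funext => y; rewrite scale0r; apply: pair1_injl => z.
  by rewrite pair1_0l /pull1 pair1_mulmx; exact: theta_idt.
have cs : smooth_fun (fun _ : Gam0 => 0 : R) by move=> c _; exact: smooth_cst.
rewrite e (d1Z x cs ps) d0_cst scale0r trmx0 mul0mx mulmx0 subrr addr0.
have [W WE] := omega_base; rewrite WE r_idt oppr0 expR0 mul1r.
have si a : Ts (idt G x) (a *m tangent (idt G) x) = a := tangent_src_idt G x a.
have ti a : Tt (idt G x) (a *m tangent (idt G) x) = a := tangent_tgt_idt G x a.
rewrite !si !ti src_idt tgt_idt subrr addr0.
by rewrite /eval2 mulmx0 mul0mx mxE.
Qed.

End ContactGroupoid.

(** * Rank bounds in a contact vector space *)

Section Isotropic.
Context (R : realType) (n : nat) (t : 'cV[R]_((2 * n).+1)) (Om L : 'M[R]_((2 * n).+1)).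
Context (E : 'rV[R]_((2 * n).+1)) (cp : contact_point t Om L E).

(** The kernel of [Om] is spanned by the Reeb vector, on which theta is 1; adding the square of
    theta removes it. *)
Lemma nondegenerate_unit : Om + t *m t^T \in unitmx.
Proof.
have [Oa _ tE [OE _]] := cp.
rewrite -row_free_unit -kermx_eq0; apply/eqP/row_matrixP => i; rewrite row0.
set v := row i _.
have vP : v *m (Om + t *m t^T) = 0.
  by rewrite /v -row_mul mulmx_ker row0.
have H x : eval2 Om v x + pair1 t v * pair1 t x = 0.
  by rewrite -eval2_outer -eval2D /eval2 vP mul0mx mxE.
have tv : pair1 t v = 0.
  by have := H E; rewrite alternating_evalN // OE oppr0 add0r tE mulr1.
apply: (contact_point_inj cp); first by rewrite tv pair1_0r.
by move=> x; have := H x; rewrite tv mul0r addr0 eval2_0l.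
Qed.

(** For the invertible form Om + theta theta^T, the space [A] enlarged by the Reeb vector is still
    orthogonal to [B]. Hence rank A + 1 + rank B is at most 2n + 1. *)
Lemma isotropic_rank p q (A : 'M[R]_(p, (2 * n).+1)) (B : 'M[R]_(q, (2 * n).+1)) :
  A *m t = 0 -> B *m t = 0 -> A *m Om *m B^T = 0 -> (\rank A + \rank B <= 2 * n)%N.
Proof.
move=> At Bt AOB; have [Oa _ tE [OE _]] := cp.
pose P := Om + t *m t^T; have Pu : P \in unitmx := nondegenerate_unit.
have EP : E *m P = t^T.
  have EO : E *m Om = 0.
    apply: trmx_inj; apply/colP => i; have := OE (delta_mx 0 i).
    by rewrite eval2E /pair1 -rowE !mxE.
  rewrite /P mulmxDr EO add0r mulmxA.
  have -> : E *m t = 1%:M by apply/matrixP => i j; rewrite !ord1 [RHS]mxE eqxx -tE.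
  by rewrite mul1mx.
have AP : A *m P = A *m Om by rewrite /P mulmxDr mulmxA At mul0mx addr0.
have : col_mx A E *m P *m B^T = 0.
  rewrite mul_col_mx mul_col_mx AP AOB EP -trmx_mul Bt trmx0.
  by rewrite col_mx0.
move/mulmx0_rank_max; rewrite mxrank_tr mxrankMfree ?row_free_unit //.
rewrite -addsmxE mxrank_disjoint_sum.
  have -> : \rank E = 1%N.
    rewrite rank_rV; case: eqP => // E0.
    by move: tE; rewrite E0 pair1_0r => /esym/eqP; rewrite oner_eq0.
  by rewrite addn1 addSn ltnS.
apply/row_matrixP => i; rewrite row0; set v := row i _.
have : (v <= A :&: E)%MS by exact: row_sub.
rewrite sub_capmx => /andP[/submxP [a va] /sub_rVP [c vc]].
have : pair1 t v = 0 by rewrite va /pair1 -mulmxA At mulmx0 mxE.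
by rewrite vc pair1_scaler tE mulr1 => ->; rewrite scale0r.
Qed.

Lemma mulmx_form p q (A : 'M[R]_(p, (2 * n).+1)) (B : 'M[R]_(q, (2 * n).+1)) :
  (forall u v, (u <= A)%MS -> (v <= B)%MS -> eval2 Om u v = 0) -> A *m Om *m B^T = 0.
Proof.
move=> H; apply/matrixP => i j.
have := H (row i A) (row j B) (row_sub i A) (row_sub j B).
rewrite /eval2 -row_mul mxE => H0; rewrite [LHS]mxE [RHS]mxE -[RHS]H0.
by apply: eq_bigr => k _; rewrite !mxE.
Qed.

(** * Orthogonality of two kernels inside ker theta *)

Section Lagrangian.
Context (m : nat) (a b : 'M[R]_((2 * n).+1, m)).
Context (Oab : forall u v, u *m a = 0 -> pair1 t u = 0 -> v *m b = 0 -> pair1 t v = 0 ->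
  eval2 Om u v = 0).

Let Ka := kermx (row_mx a t).
Let Kb := kermx (row_mx b t).

Let KP (c : 'M[R]_((2 * n).+1, m)) u :
  reflect (u *m c = 0 /\ pair1 t u = 0) (u <= kermx (row_mx c t))%MS.
Proof.
apply: (iffP sub_kermxP); rewrite mul_mx_row.
  rewrite -row_mx0 => /eq_row_mx [-> H]; split => //.
  by rewrite /pair1 H mxE.
move=> [-> H]; rewrite (_ : u *m t = 0) ?row_mx0 //.
by apply/matrixP => i j; rewrite !ord1 [RHS]mxE -H.
Qed.

Let Kt (c : 'M[R]_((2 * n).+1, m)) : kermx (row_mx c t) *m t = 0.
Proof.
have := mulmx_ker (row_mx c t); rewrite mul_mx_row -row_mx0.
by case/eq_row_mx.
Qed.

Let Kab : Ka *m Om *m Kb^T = 0.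
Proof. by apply: mulmx_form => u v /KP [ua ut] /KP [vb vt]; exact: Oab. Qed.

Let rankK (c : 'M[R]_((2 * n).+1, m)) : (2 * n <= \rank (kermx (row_mx c t)) + m)%N.
Proof.
rewrite mxrank_ker; have := rank_leq_col (row_mx c t).
by move: (\rank _) => k; lia.
Qed.

(** Each kernel is cut out by m + 1 equations, so has dimension at least 2n - m, while the two
    dimensions add up to at most 2n. *)
Lemma lagrangian_dim : (n <= m)%N.
Proof.
have := isotropic_rank (Kt a) (Kt b) Kab; have := rankK a; have := rankK b.
by rewrite -/Ka -/Kb; lia.
Qed.

Context (mn : m = n).

(** When m = n the bounds are equalities, so theta and the columns of [b] are independent and can be
    given prescribed values on a vector. *)
Lemma lagrangian_transverse : exists2 u, u *m b = 0 & pair1 t u = 1.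
Proof.
have := isotropic_rank (Kt a) (Kt b) Kab; have := rankK a; have := rankK b.
rewrite -/Ka -/Kb => h1 h2 h3.
have full : row_full (row_mx b t).
  rewrite /row_full eqn_leq rank_leq_col /=.
  have := mxrank_ker (row_mx b t); rewrite -/Kb.
  have := rank_leq_row (row_mx b t); set k := \rank (row_mx b t).
  by move=> h4 h5; rewrite h5 in h1 h3; rewrite addn1; lia.
exists (row_mx 0 1 *m pinvmx (row_mx b t)); have := mulVpmx full;
  set p := pinvmx _; move=> H; have : row_mx (0 : 'rV[R]_m) 1 *m p *m row_mx b t = row_mx 0 1.
- by rewrite -mulmxA H mulmx1.
- by rewrite mul_mx_row => /eq_row_mx [].
- by rewrite -mulmxA H mulmx1.
by rewrite mul_mx_row => /eq_row_mx [_ H2]; rewrite /pair1 H2 mxE.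
Qed.

(** Adjoining [v] to the second kernel keeps it orthogonal to the first, and the rank bound is
    already attained, so [v] was in it. *)
Lemma lagrangian_perp v : pair1 t v = 0 ->
  (forall u, u *m a = 0 -> pair1 t u = 0 -> eval2 Om u v = 0) -> v *m b = 0.
Proof.
move=> tv Ov; have h1 := rankK a; have h2 := rankK b.
have Bt : col_mx Kb v *m t = 0.
  rewrite mul_col_mx Kt (_ : v *m t = 0) ?col_mx0 //.
  by apply/matrixP => i j; rewrite !ord1 [RHS]mxE -tv.
have KBO : Ka *m Om *m (col_mx Kb v)^T = 0.
  apply: mulmx_form => u w /KP [ua ut]; rewrite -addsmxE => /sub_addsmxP [[x y] /= ->].
  rewrite eval2_addr Oab //.
    by rewrite (mx11_scalar y) mul_scalar_mx eval2_scaler Ov // mulr0 addr0.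
  - by have /KP [] : (x *m Kb <= Kb)%MS by exact: submxMl.
  by have /KP [] : (x *m Kb <= Kb)%MS by exact: submxMl.
have h3 := isotropic_rank (Kt a) Bt KBO.
have sub : (Kb <= col_mx Kb v)%MS by rewrite -addsmxE addsmxSl.
have vB : (col_mx Kb v <= Kb)%MS.
  rewrite -(geq_leqif (mxrank_leqif_sup sub)).
  by rewrite -/Ka -/Kb in h1 h2 h3; lia.
have /KP [//] : (v <= Kb)%MS.
by apply: submx_trans vB; rewrite -addsmxE addsmxSr.
Qed.

End Lagrangian.

End Isotropic.

(* The values of all the tensors of a twisted contact groupoid at its points. TM is
   the tangent map of the product, Ts, Tt, Ti and Te are those of src, tgt, invg
   and idt, rho is dr and Om is d theta + omega. *)
Section LinearGroupoid.
Context (R : realType) (n m : nat) (Gam Gam0 : Type).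
Implicit Types (g h k : Gam) (x : Gam0) (u v w y : 'rV[R]_((2 * n).+1)).
Context (src tgt : Gam -> Gam0) (idt : Gam0 -> Gam) (invg : Gam -> Gam) (gmul : Gam -> Gam -> Gam).
Context (TM : Gam -> Gam -> 'rV[R]_((2 * n).+1) -> 'rV[R]_((2 * n).+1) -> 'rV[R]_((2 * n).+1)).
Context (Ts Tt : Gam -> 'M[R]_((2 * n).+1, m)) (Ti : Gam -> 'M[R]_((2 * n).+1)).
Context (Te : Gam0 -> 'M[R]_(m, (2 * n).+1)).
Context (theta rho : Gam -> 'cV[R]_((2 * n).+1)) (Om Lam : Gam -> 'M[R]_((2 * n).+1)).
Context (E : Gam -> 'rV[R]_((2 * n).+1)) (r : Gam -> R).

Record linear_groupoid : Prop := LinearGroupoidLaws {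
  lg_cp : forall g, contact_point (theta g) (Om g) (Lam g) (E g);
  lg_src_idt : forall x, src (idt x) = x;
  lg_tgt_idt : forall x, tgt (idt x) = x;
  lg_src_mul : forall g h, src g = tgt h -> src (gmul g h) = src h;
  lg_tgt_mul : forall g h, src g = tgt h -> tgt (gmul g h) = tgt g;
  lg_mul1g : forall g, gmul (idt (tgt g)) g = g;
  lg_mulg1 : forall g, gmul g (idt (src g)) = g;
  lg_inv_idt : forall x, invg (idt x) = idt x;
  lg_TM_src : forall g h v w, src g = tgt h -> v *m Ts g = w *m Tt h -> TM g h v w *m Ts (gmul g
    h) = w *m Ts h;
  lg_TM_tgt : forall g h v w, src g = tgt h -> v *m Ts g = w *m Tt h -> TM g h v w *m Tt (gmul g
    h) = v *m Tt g;
  lg_TM_surj : forall g h y, src g = tgt h -> exists v w, [/\ v *m Ts g = w *m Tt h, TM g h v w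
    = y & y *m Tt (gmul g h) = 0 -> v = 0];
  lg_TM1r : forall g v, v *m Ts g = v *m Ts g *m Te (src g) *m Tt (idt (src g)) /\
    TM g (idt (src g)) v (v *m Ts g *m Te (src g)) = v;
  lg_Ts_idt : forall x (a : 'rV[R]_m), a *m Te x *m Ts (idt x) = a;
  lg_Tt_idt : forall x (a : 'rV[R]_m), a *m Te x *m Tt (idt x) = a;
  lg_Ts_inv : forall g u, u *m Ti g *m Ts (invg g) = u *m Tt g;
  lg_Ti_surj : forall g y, exists u, u *m Ti g = y;
  lg_th_mul : forall g h k v w y, src g = tgt h -> v *m Ts g = w *m Tt h -> gmul g h = k -> TM g
    h v w = y -> pair1 (theta k) y = expR (- r h) * pair1 (theta g) v + pair1 (theta h) w;
  lg_dr_mul : forall g h k v w y, src g = tgt h -> v *m Ts g = w *m Tt h -> gmul g h = k -> TM g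
    h v w = y -> pair1 (rho k) y = pair1 (rho g) v + pair1 (rho h) w;
  lg_Om_mul : forall g h k v w y v' w' y', src g = tgt h -> v *m Ts g = w *m Tt h -> v' *m Ts g
    = w' *m Tt h -> gmul g h = k -> TM g h v w = y -> TM g h v' w' = y' -> eval2 (Om k) y y' =
    expR (- r h) * eval2 (Om g) v v' + eval2 (Om h) w w' - expR (- r h) * (pair1 (rho h) w *
    pair1 (theta g) v' - pair1 (theta g) v * pair1 (rho h) w');
  lg_th_idt : forall x (a : 'rV[R]_m), pair1 (theta (idt x)) (a *m Te x) = 0;
  lg_dr_idt : forall x (a : 'rV[R]_m), pair1 (rho (idt x)) (a *m Te x) = 0;
  lg_Om_idt : forall x (a b : 'rV[R]_m), eval2 (Om (idt x)) (a *m Te x) (b *m Te x) = 0;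
  lg_th_inv : forall g u, pair1 (theta (invg g)) (u *m Ti g) = - expR (r g) * pair1 (theta g) u;
  lg_dr_inv : forall g u, pair1 (rho (invg g)) (u *m Ti g) = - pair1 (rho g) u;
  lg_Om_inv : forall g u v, eval2 (Om (invg g)) (u *m Ti g) (v *m Ti g) = - expR (r g) * (eval2
    (Om g) u v + pair1 (rho g) u * pair1 (theta g) v - pair1 (theta g) u * pair1 (rho g) v);
  lg_r_mul : forall g h, src g = tgt h -> r (gmul g h) = r g + r h;
  lg_r_idt : forall x, r (idt x) = 0 }.

Let comp g h v w := v *m Ts g = w *m Tt h.
Let th g v := pair1 (theta g) v.
Let dr g v := pair1 (rho g) v.

Context (lg : linear_groupoid).

Let cp : forall g, contact_point (theta g) (Om g) (Lam g) (E g) := lg_cp lg.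
Let src_idt : forall x, src (idt x) = x := lg_src_idt lg.
Let tgt_idt : forall x, tgt (idt x) = x := lg_tgt_idt lg.
Let src_mul : forall g h, src g = tgt h -> src (gmul g h) = src h := lg_src_mul lg.
Let tgt_mul : forall g h, src g = tgt h -> tgt (gmul g h) = tgt g := lg_tgt_mul lg.
Let mul1g : forall g, gmul (idt (tgt g)) g = g := lg_mul1g lg.
Let mulg1 : forall g, gmul g (idt (src g)) = g := lg_mulg1 lg.
Let inv_idt : forall x, invg (idt x) = idt x := lg_inv_idt lg.
Let TM_src : forall g h v w, src g = tgt h -> comp g h v w -> TM g h v w *m Ts (gmul g h) = w *m
  Ts h := lg_TM_src lg.
Let TM_tgt : forall g h v w, src g = tgt h -> comp g h v w -> TM g h v w *m Tt (gmul g h) = v *m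
  Tt g := lg_TM_tgt lg.
Let TM_surj : forall g h y, src g = tgt h -> exists v w, [/\ comp g h v w, TM g h v w = y & y *m
  Tt (gmul g h) = 0 -> v = 0] := lg_TM_surj lg.
Let TM1r : forall g v, comp g (idt (src g)) v (v *m Ts g *m Te (src g)) /\ TM g (idt (src g)) v
  (v *m Ts g *m Te (src g)) = v := lg_TM1r lg.
Let Ts_idt : forall x (a : 'rV[R]_m), a *m Te x *m Ts (idt x) = a := lg_Ts_idt lg.
Let Tt_idt : forall x (a : 'rV[R]_m), a *m Te x *m Tt (idt x) = a := lg_Tt_idt lg.
Let Ts_inv : forall g u, u *m Ti g *m Ts (invg g) = u *m Tt g := lg_Ts_inv lg.
Let Ti_surj : forall g y, exists u, u *m Ti g = y := lg_Ti_surj lg.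
Let th_mul : forall g h k v w y, src g = tgt h -> comp g h v w -> gmul g h = k -> TM g h v w = y
  -> th k y = expR (- r h) * th g v + th h w := lg_th_mul lg.
Let dr_mul : forall g h k v w y, src g = tgt h -> comp g h v w -> gmul g h = k -> TM g h v w = y
  -> dr k y = dr g v + dr h w := lg_dr_mul lg.
Let Om_mul : forall g h k v w y v' w' y', src g = tgt h -> comp g h v w -> comp g h v' w' ->
  gmul g h = k -> TM g h v w = y -> TM g h v' w' = y' -> eval2 (Om k) y y' = expR (- r h) *
  eval2 (Om g) v v' + eval2 (Om h) w w' - expR (- r h) * (dr h w * th g v' - th g v * dr h w')
  := lg_Om_mul lg.
Let th_idt : forall x (a : 'rV[R]_m), th (idt x) (a *m Te x) = 0 := lg_th_idt lg.
Let dr_idt : forall x (a : 'rV[R]_m), dr (idt x) (a *m Te x) = 0 := lg_dr_idt lg.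
Let Om_idt : forall x (a b : 'rV[R]_m), eval2 (Om (idt x)) (a *m Te x) (b *m Te x) = 0 :=
  lg_Om_idt lg.
Let th_inv : forall g u, th (invg g) (u *m Ti g) = - expR (r g) * th g u := lg_th_inv lg.
Let dr_inv : forall g u, dr (invg g) (u *m Ti g) = - dr g u := lg_dr_inv lg.
Let Om_inv : forall g u v, eval2 (Om (invg g)) (u *m Ti g) (v *m Ti g) = - expR (r g) * (eval2
  (Om g) u v + dr g u * th g v - th g u * dr g v) := lg_Om_inv lg.
Let r_mul : forall g h, src g = tgt h -> r (gmul g h) = r g + r h := lg_r_mul lg.
Let r_idt : forall x, r (idt x) = 0 := lg_r_idt lg.

Let src_g1 g : src g = tgt (idt (src g)). Proof. by rewrite tgt_idt. Qed.
Let src_1g g : src (idt (tgt g)) = tgt g. Proof. by rewrite src_idt. Qed.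

Let Oma g : (Om g)^T = - Om g. Proof. by case: (cp g). Qed.
Let Lama g : (Lam g)^T = - Lam g. Proof. by case: (cp g). Qed.
Let thE g : th g (E g) = 1. Proof. by case: (cp g). Qed.
Let OmE g v : eval2 (Om g) (E g) v = 0. Proof. by case: (cp g) => _ _ _ []. Qed.
Let OmEr g v : eval2 (Om g) v (E g) = 0.
Proof. by rewrite alternating_evalN // OmE oppr0. Qed.
Let th_sharp g z : th g (sharp (Lam g) z) = 0.
Proof. by case: (cp g) => _ _ _ [_ /(_ z) []]. Qed.
Let Om_sharp g z v : eval2 (Om g) (sharp (Lam g) z) v = - (pair1 z v - pair1 z (E g) * th g v).
Proof. by case: (cp g) => _ _ _ [_ /(_ z) [_ /(_ v)]]. Qed.
Let cp_inj g u v : th g u = th g v -> (forall y, eval2 (Om g) u y = eval2 (Om g) v y) -> u = v.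
Proof. exact: (contact_point_inj (cp g)). Qed.
Let th0 g : th g 0 = 0. Proof. exact: pair1_0r. Qed.
Let dr0 g : dr g 0 = 0. Proof. exact: pair1_0r. Qed.
Let expV (a : R) : expR a * expR (- a) = 1. Proof. by rewrite -expRD subrr expR0. Qed.

(** At the pair (g, 1), [w] is the product of 0 with a vector w0, and [u] is the product of itself
    with 0. The formula for Om reduces to - dr(w0) theta(u), and dr(w0) = dr(w). *)
Lemma Om_ker g w u : w *m Tt g = 0 -> u *m Ts g = 0 ->
  eval2 (Om g) w u = - (dr g w * th g u).
Proof.
move=> wt us; have [v0 [w0 [c cE c0]]] := TM_surj w (src_g1 g).
rewrite mulg1 in c0; move: (c0 wt) c cE => -> c cE.
have := TM1r g u; rewrite us mul0mx => -[c' cE'].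
rewrite (Om_mul (src_g1 g) c c' (mulg1 g) cE cE') (dr_mul (src_g1 g) c (mulg1 g) cE).
rewrite eval2_0l eval2_0r th0 !dr0 r_idt oppr0 expR0.
by ring.
Qed.

Let Om_ker0 g w u : w *m Tt g = 0 -> th g w = 0 -> u *m Ts g = 0 -> th g u = 0 ->
  eval2 (Om g) w u = 0.
Proof. by move=> wt _ us uth; rewrite Om_ker // uth mulr0 oppr0. Qed.

Let Om_ker0' g u w : u *m Ts g = 0 -> th g u = 0 -> w *m Tt g = 0 -> th g w = 0 ->
  eval2 (Om g) u w = 0.
Proof. by move=> us uth wt wth; rewrite alternating_evalN // Om_ker0 // oppr0. Qed.

Lemma base_dim x : m = n.
Proof.
apply/eqP; rewrite eqn_leq (lagrangian_dim (cp (idt x)) (@Om_ker0 (idt x))) andbT.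
have At : Te x *m theta (idt x) = 0.
  by apply: pair1_injl => u; rewrite pair1_0l pair1_mulmx; exact: th_idt.
have AOA : Te x *m Om (idt x) *m (Te x)^T = 0.
  apply: mulmx_form => u v /submxP [a ->] /submxP [b ->].
  exact: Om_idt.
have := isotropic_rank (cp (idt x)) At At AOA.
have -> : \rank (Te x) = m.
  apply/eqP; rewrite -[_ == _]/(row_free (Te x)); apply/row_freeP; exists (Ts (idt x)).
  by apply/row_matrixP => i; rewrite row_mul row1 rowE Ts_idt.
by lia.
Qed.

Let mn g : m = n. Proof. exact: base_dim (src g). Qed.

(** Take w in ker T beta with theta(w) = 1. Then w - E lies in ker theta and is Om-orthogonal to the
    part of ker T alpha in ker theta, so it belongs to ker T beta. *)
Lemma reeb_tgt g : E g *m Tt g = 0.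
Proof.
have [w wt wth] := lagrangian_transverse (cp g) (@Om_ker0' g) (mn g).
have : (w - E g) *m Tt g = 0.
  apply: (lagrangian_perp (cp g) (@Om_ker0' g) (mn g)).
    by rewrite pair1_addr pair1_oppr wth -/(th _ _) thE subrr.
  move=> u us uth; rewrite eval2_addr eval2_oppr OmEr subr0 alternating_evalN //.
  by rewrite Om_ker // /th uth mulr0 !oppr0.
by rewrite mulmxBl wt sub0r => /eqP; rewrite oppr_eq0 => /eqP.
Qed.

(** [Om_ker] applied to E and to a vector of ker T alpha on which theta is 1 gives 0 = - dr(E). *)
Lemma reeb_r g : dr g (E g) = 0.
Proof.
have [u us uth] := lagrangian_transverse (cp g) (@Om_ker0 g) (mn g).
have := Om_ker (reeb_tgt g) us; rewrite OmE /th uth mulr1 => /esym/eqP.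
by rewrite oppr_eq0 => /eqP.
Qed.

Let comp0 g h w : w *m Tt h = 0 -> comp g h 0 w.
Proof. by rewrite /comp mul0mx => ->. Qed.

Lemma reeb_left g h : src g = tgt h -> TM g h 0 (E h) = E (gmul g h).
Proof.
move=> gh; have c := comp0 g (reeb_tgt h); apply: (@cp_inj (gmul g h)).
  by rewrite (th_mul gh c erefl erefl) th0 mulr0 add0r !thE.
move=> y; have [v [w [c' <- _]]] := TM_surj y gh.
rewrite (Om_mul gh c c' erefl erefl erefl) eval2_0l !OmE reeb_r th0.
by ring.
Qed.

(* The value at the unit of the generator of the right invariant field E^r. *)
Let e0 x := - (E (idt x) *m Ti (idt x)).
Definition right_reeb g := TM (idt (tgt g)) g (e0 (tgt g)) 0.

Let e0_src x : e0 x *m Ts (idt x) = 0.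
Proof.
have := Ts_inv (idt x) (E (idt x)); rewrite inv_idt reeb_tgt /e0 mulNmx => ->.
by rewrite oppr0.
Qed.

Let e0_th x : th (idt x) (e0 x) = 1.
Proof.
have := th_inv (idt x) (E (idt x)); rewrite inv_idt r_idt expR0 thE mulN1r.
by rewrite /th /e0 pair1_oppr => ->; rewrite opprK.
Qed.

Let e0_Om x v : eval2 (Om (idt x)) (e0 x) v = dr (idt x) v.
Proof.
have [u <-] := Ti_surj (idt x) v.
have := Om_inv (idt x) (E (idt x)) u; have := dr_inv (idt x) u.
rewrite inv_idt r_idt expR0 OmE thE reeb_r /e0 eval2_oppl => -> ->.
by ring.
Qed.

Let compr g : comp (idt (tgt g)) g (e0 (tgt g)) 0.
Proof. by rewrite /comp mul0mx e0_src. Qed.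

Lemma right_reeb_src g : right_reeb g *m Ts g = 0.
Proof.
by have := TM_src (src_1g g) (compr g); rewrite mul1g mul0mx.
Qed.

Lemma right_reeb_theta g : th g (right_reeb g) = expR (- r g).
Proof.
by rewrite (th_mul (src_1g g) (compr g) (mul1g g) erefl) e0_th th0 mulr1 addr0.
Qed.

Let TM_surj' g y : exists v w, [/\ comp (idt (tgt g)) g v w, TM (idt (tgt g)) g v w = y & True].
Proof.
by have [v [w [c cE _]]] := TM_surj y (src_1g g); exists v, w.
Qed.

(** At the units, Om(e0, v) = dr(v) by the formula for iota^*Om, and right translation multiplies by
    e^-r. So e^r E^r has theta equal to 1 and contraction dr with Om, whence [sharp_rho]. *)
Lemma right_reeb_Om g y : eval2 (Om g) (right_reeb g) y = expR (- r g) * dr g y.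
Proof.
have [v [w [c cE _]]] := TM_surj' g y.
rewrite (Om_mul (src_1g g) (compr g) c (mul1g g) erefl cE).
rewrite (dr_mul (src_1g g) c (mul1g g) cE) e0_Om e0_th eval2_0l dr0.
by ring.
Qed.

Lemma sharp_rho g : sharp (Lam g) (rho g) = E g - expR (r g) *: right_reeb g.
Proof.
apply: (@cp_inj g).
  rewrite th_sharp /th pair1_addr pair1_oppr pair1_scaler -!/(th _ _) thE.
  by rewrite right_reeb_theta expV subrr.
move=> y; rewrite Om_sharp eval2_addl eval2_oppl eval2_scalel OmE right_reeb_Om.
rewrite -/(dr g y) -/(dr g (E g)) reeb_r mulrA expV.
by ring.
Qed.

Lemma right_reeb_r g : dr g (right_reeb g) = 0.
Proof.
have := right_reeb_Om g (right_reeb g).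
have -> : eval2 (Om g) (right_reeb g) (right_reeb g) = 0.
  have := alternating_evalN (right_reeb g) (right_reeb g) (Oma g); lra.
by move/esym/eqP; rewrite mulf_eq0 gt_eqF ?expR_gt0 //= => /eqP.
Qed.

(* Here and in [inv_sharp], both sides satisfy the equations that determine the
   Jacobi structure of (theta/a, omega/a), a = - e^-r. *)
Lemma inv_reeb g : E (invg g) = - (right_reeb g *m Ti g).
Proof.
apply: (@cp_inj (invg g)).
  rewrite thE /th pair1_oppr -/(th _ _) th_inv right_reeb_theta mulNr opprK.
  by rewrite expV.
move=> y; have [u <-] := Ti_surj g y.
rewrite OmE eval2_oppl Om_inv right_reeb_Om right_reeb_r right_reeb_theta.
by ring.
Qed.

Lemma inv_sharp g z : sharp (Lam (invg g)) z =
  (- expR (- r g)) *: sharp (Lam g) (Ti g *m z) *m Ti g.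
Proof.
have dS a b : pair1 a (sharp (Lam g) b) = - pair1 b (sharp (Lam g) a).
  exact: pair1_sharpC.
rewrite -scalemxAl; apply: (@cp_inj (invg g)).
  by rewrite th_sharp /th pair1_scaler -/(th _ _) th_inv th_sharp !mulr0.
move=> y; have [u <-] := Ti_surj g y.
have drS : dr g (sharp (Lam g) (Ti g *m z)) =
    - (pair1 (Ti g *m z) (E g) - expR (r g) * pair1 (Ti g *m z) (right_reeb g)).
  by rewrite /dr dS sharp_rho pair1_addr pair1_oppr pair1_scaler.
rewrite Om_sharp eval2_scalel Om_inv Om_sharp th_sharp drS inv_reeb pair1_oppr th_inv.
rewrite -!pair1_mulmx; have := expV (r g).
move: (pair1 _ _) (pair1 _ _) (pair1 _ _) (th _ _) (dr _ _) (expR _) (expR _) => a b c d e p q pq.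
rewrite mul0r subr0.
by rewrite -[LHS]mul1r -pq; ring.
Qed.

(** Since alpha^*z vanishes on ker T alpha, its image under Lam# is Om-orthogonal to the part of ker
    T alpha in ker theta. *)
Lemma sharp_src_tgt g (z : 'cV[R]_m) : sharp (Lam g) (Ts g *m z) *m Tt g = 0.
Proof.
apply: (lagrangian_perp (cp g) (@Om_ker0' g) (mn g)); first exact: th_sharp.
move=> u us uth; rewrite alternating_evalN // Om_sharp /th uth mulr0 subr0 opprK.
by rewrite pair1_mulmx us pair1_0r.
Qed.

Lemma sharp_tgt_src g (z : 'cV[R]_m) : sharp (Lam g) (Tt g *m z) *m Ts g = 0.
Proof.
apply: (lagrangian_perp (cp g) (@Om_ker0 g) (mn g)); first exact: th_sharp.
move=> u us uth; rewrite alternating_evalN // Om_sharp /th uth mulr0 subr0 opprK.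
by rewrite pair1_mulmx us pair1_0r.
Qed.

(** By antisymmetry this is - (alpha^*z)(Lam#(dr)), and alpha^*z annihilates the E^r part of
    Lam#(dr). *)
Lemma dr_sharp_src g (z : 'cV[R]_m) :
  dr g (sharp (Lam g) (Ts g *m z)) = - pair1 (Ts g *m z) (E g).
Proof.
rewrite /dr pair1_sharpC // sharp_rho pair1_addr pair1_oppr pair1_scaler.
by rewrite [pair1 _ (right_reeb g)]pair1_mulmx right_reeb_src pair1_0r mulr0 oppr0 addr0.
Qed.

(** [a] and [b] have the shape of the differentials of alpha^*f_0 and e^-r beta^*g_0. The part of
    [b] in the image of beta^* gives nothing because Lam#(a) and E lie in ker T beta; the rest
    cancels by [dr_sharp_src]. *)
Lemma sharp_src_tgt_bracket g (z e : 'cV[R]_m) (f c : R) :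
  let a := Ts g *m z in
  let b := expR (- r g) *: (Tt g *m e) + c *: - (expR (- r g) *: rho g) in
  evalb (Lam g) a b + pair1 (f *: b - (expR (- r g) * c) *: a) (E g) = 0.
Proof.
move=> a b; rewrite -[evalb _ _ _]/(pair1 b (sharp (Lam g) a)) /b.
rewrite !(pair1D, pair1N, pair1Z) !(pair1_mulmx (Tt g)) reeb_tgt sharp_src_tgt.
rewrite -!/(dr _ _) dr_sharp_src reeb_r !pair1_0r -/a.
by move: (pair1 _ _) (expR _) => *; ring.
Qed.

Let th_sharp_reeb g z c : th g (sharp (Lam g) z + c *: E g) = c.
Proof. by rewrite /th pair1_addr pair1_scaler -!/(th _ _) th_sharp thE add0r mulr1. Qed.

Let th_sharp_right g b z c :
  th g (b *: sharp (Lam g) z + c *: right_reeb g) = expR (- r g) * c.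
Proof.
rewrite /th pair1_addr !pair1_scaler -!/(th _ _) th_sharp right_reeb_theta.
by rewrite mulr0 add0r mulrC.
Qed.

Section Left.
Context (zeta : Gam0 -> 'cV[R]_m) (f : Gam0 -> R).
Let Y g := sharp (Lam g) (Ts g *m zeta (src g)) + f (src g) *: E g.

Let Yth g : th g (Y g) = f (src g).
Proof. exact: th_sharp_reeb. Qed.

Let YOm g v : eval2 (Om g) (Y g) v =
  - (pair1 (Ts g *m zeta (src g)) v - pair1 (Ts g *m zeta (src g)) (E g) * th g v).
Proof. by rewrite /Y eval2_addl eval2_scalel OmE mulr0 addr0 Om_sharp. Qed.

Let Ydr g : dr g (Y g) = - pair1 (Ts g *m zeta (src g)) (E g).
Proof.
rewrite /Y /dr pair1_addr pair1_scaler -!/(dr _ _) reeb_r mulr0 addr0.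
exact: dr_sharp_src.
Qed.

Lemma left_form_tgt g : Y g *m Tt g = 0.
Proof. by rewrite mulmxDl sharp_src_tgt -scalemxAl reeb_tgt scaler0 addr0. Qed.

(** Against a product of v and w, the right-hand side contains theta(v) through theta of the
    product. On the left the same term is produced by the dr term of the formula for Om, since dr(Y)
    = - (alpha^*zeta)(E). *)
Lemma left_form_invariant g h : src g = tgt h -> TM g h 0 (Y h) = Y (gmul g h).
Proof.
move=> gh; have c := comp0 g (left_form_tgt h); apply: (@cp_inj (gmul g h)).
  by rewrite (th_mul gh c erefl erefl) th0 mulr0 add0r !Yth src_mul.
move=> y; have [v [w [c' <- _]]] := TM_surj y gh.
rewrite (Om_mul gh c c' erefl erefl erefl) eval2_0l !YOm Ydr th0.
rewrite (th_mul gh c' erefl erefl) src_mul // !pair1_mulmx TM_src //.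
have -> : E (gmul g h) *m Ts (gmul g h) = E h *m Ts h.
  by rewrite -reeb_left // TM_src //; exact: comp0 (reeb_tgt h).
by ring.
Qed.

End Left.

Section Right.
Context (zeta : Gam0 -> 'cV[R]_m) (f : Gam0 -> R).
Let Y g := expR (- r g) *: sharp (Lam g) (Tt g *m zeta (tgt g)) + f (tgt g) *: right_reeb g.

Let Yth g : th g (Y g) = expR (- r g) * f (tgt g).
Proof. exact: th_sharp_right. Qed.

Let YOm g v : eval2 (Om g) (Y g) v =
  expR (- r g) * (f (tgt g) * dr g v - pair1 (Tt g *m zeta (tgt g)) v).
Proof.
rewrite /Y eval2_addl !eval2_scalel right_reeb_Om Om_sharp.
rewrite [pair1 _ (E g)]pair1_mulmx reeb_tgt pair1_0r; by ring.
Qed.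

Lemma right_form_src g : Y g *m Ts g = 0.
Proof.
by rewrite mulmxDl -!scalemxAl sharp_tgt_src right_reeb_src !scaler0 addr0.
Qed.

Let compr0 g h : comp h g (Y h) 0.
Proof. by rewrite /comp right_form_src mul0mx. Qed.

(** Right translation by [g] multiplies theta by e^-r(g); the factor e^-r of the field matches this
    because [r] is multiplicative. *)
Lemma right_form_invariant g h : src h = tgt g -> TM h g (Y h) 0 = Y (gmul h g).
Proof.
move=> hg; have c := compr0 g h; apply: (@cp_inj (gmul h g)).
  rewrite (th_mul hg c erefl erefl) th0 addr0 !Yth tgt_mul // r_mul // opprD expRD.
  by ring.
move=> y; have [v [w [c' <- _]]] := TM_surj y hg.
rewrite (Om_mul hg c c' erefl erefl erefl) eval2_0l !YOm Yth dr0.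
rewrite (dr_mul hg c' erefl erefl) tgt_mul // !pair1_mulmx TM_tgt // r_mul // opprD expRD.
by ring.
Qed.

End Right.

(** The tangent space at a unit is the direct sum of the tangent space of the units and of ker T
    alpha, with projection T alpha followed by T epsilon. *)
Lemma unit_ext x y y' : th (idt x) y = th (idt x) y' ->
  (forall a : 'rV[R]_m, eval2 (Om (idt x)) y (a *m Te x) = eval2 (Om (idt x)) y' (a *m Te x)) ->
  (forall u, u *m Ts (idt x) = 0 -> eval2 (Om (idt x)) y u = eval2 (Om (idt x)) y' u) -> y = y'.
Proof.
move=> H1 H2 H3; apply: (@cp_inj (idt x)) => // v.
have -> : v = v *m Ts (idt x) *m Te x + (v - v *m Ts (idt x) *m Te x) by rewrite addrC subrK.
rewrite eval2_addr [RHS]eval2_addr H2; congr (_ + _); apply: H3.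
by rewrite mulmxBl Ts_idt subrr.
Qed.

Lemma unit_ext' x y y' : th (idt x) y = th (idt x) y' ->
  (forall a : 'rV[R]_m, eval2 (Om (idt x)) y (a *m Te x) = eval2 (Om (idt x)) y' (a *m Te x)) ->
  (forall u, u *m Tt (idt x) = 0 -> eval2 (Om (idt x)) y u = eval2 (Om (idt x)) y' u) -> y = y'.
Proof.
move=> H1 H2 H3; apply: (@cp_inj (idt x)) => // v.
have -> : v = v *m Tt (idt x) *m Te x + (v - v *m Tt (idt x) *m Te x) by rewrite addrC subrK.
rewrite eval2_addr [RHS]eval2_addr H2; congr (_ + _); apply: H3.
by rewrite mulmxBl Tt_idt subrr.
Qed.

(** * Invariant fields are determined by their values at the units *)

Section Converse.
Context (Y : Gam -> 'rV[R]_((2 * n).+1)).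
(** These values are forced: contracting the desired formula for the field with theta, and with Om
    along the units, leaves only f and - zeta there. *)
Let f x := th (idt x) (Y (idt x)).
Let zeta x := - (Te x *m Defs.contract (Y (idt x)) (Om (idt x))).

Let zetaE x (a : 'rV[R]_m) : pair1 (zeta x) a = - eval2 (Om (idt x)) (Y (idt x)) (a *m Te x).
Proof. by rewrite /zeta pair1N pair1_mulmx -eval2E. Qed.

Lemma left_converse g : (forall g, Y g *m Tt g = 0) ->
  (forall g h, src g = tgt h -> TM g h 0 (Y h) = Y (gmul g h)) ->
  Y g = sharp (Lam g) (Ts g *m zeta (src g)) + f (src g) *: E g.
Proof.
move=> Yt Yl.
(* Both fields are left invariant, and every g is g times a unit, so agreement at the units is
   enough. *)
suff H x : Y (idt x) = sharp (Lam (idt x)) (Ts (idt x) *m zeta (src (idt x)))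
    + f (src (idt x)) *: E (idt x).
  have := Yl g (idt (src g)) (src_g1 g); rewrite mulg1 => <-; rewrite H.
  by rewrite (left_form_invariant zeta f (src_g1 g)) mulg1.
have YE : pair1 (zeta x) (E (idt x) *m Ts (idt x)) = - dr (idt x) (Y (idt x)).
  rewrite zetaE.
  (* The component of E in ker T alpha; theta takes the value 1 on it since theta vanishes along the
     units, so [Om_ker] computes Om(Y, d) = - dr(Y). *)
  pose d := E (idt x) - E (idt x) *m Ts (idt x) *m Te x.
  have ds : d *m Ts (idt x) = 0 by rewrite mulmxBl Ts_idt subrr.
  have dth : th (idt x) d = 1 by rewrite /th pair1_addr pair1_oppr -!/(th _ _) th_idt thE subr0.
  have := Om_ker (Yt (idt x)) ds; rewrite dth mulr1 /d eval2_addr eval2_oppr OmEr add0r.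
  by move=> ->.
have OmY v : eval2 (Om (idt x)) (sharp (Lam (idt x)) (Ts (idt x) *m zeta (src (idt x)))
    + f (src (idt x)) *: E (idt x)) v =
    - (pair1 (zeta x) (v *m Ts (idt x)) + dr (idt x) (Y (idt x)) * th (idt x) v).
  by rewrite eval2_addl eval2_scalel OmE mulr0 addr0 Om_sharp !pair1_mulmx src_idt YE mulNr opprK.
apply: (@unit_ext x).
- by rewrite th_sharp_reeb src_idt.
- by move=> a; rewrite OmY Ts_idt th_idt mulr0 addr0 zetaE opprK.
by move=> u us; rewrite OmY us pair1_0r add0r Om_ker.
Qed.

Lemma right_converse g : (forall g, Y g *m Ts g = 0) ->
  (forall g h, src h = tgt g -> TM h g (Y h) 0 = Y (gmul h g)) ->
  Y g = expR (- r g) *: sharp (Lam g) (Tt g *m zeta (tgt g)) + f (tgt g) *: right_reeb g.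
Proof.
move=> Ys Yr.
suff H x : Y (idt x) = expR (- r (idt x)) *: sharp (Lam (idt x)) (Tt (idt x) *m zeta (tgt (idt x)))
    + f (tgt (idt x)) *: right_reeb (idt x).
  have := Yr g (idt (tgt g)) (src_1g g); rewrite mul1g => <-; rewrite H.
  by rewrite (right_form_invariant zeta f (src_1g g)) mul1g.
have OmY v : eval2 (Om (idt x))
    (expR (- r (idt x)) *: sharp (Lam (idt x)) (Tt (idt x) *m zeta (tgt (idt x)))
    + f (tgt (idt x)) *: right_reeb (idt x)) v =
    f x * dr (idt x) v - pair1 (zeta x) (v *m Tt (idt x)).
  rewrite eval2_addl !eval2_scalel right_reeb_Om Om_sharp tgt_idt !pair1_mulmx reeb_tgt pair1_0r.
  by rewrite r_idt oppr0 expR0 mul0r subr0 !mul1r addrC.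
apply: (@unit_ext' x).
- by rewrite th_sharp_right tgt_idt r_idt oppr0 expR0 mul1r.
- by move=> a; rewrite OmY Tt_idt dr_idt mulr0 sub0r zetaE opprK.
move=> u ut; rewrite OmY ut pair1_0r subr0 alternating_evalN // Om_ker // opprK.
exact: mulrC.
Qed.

End Converse.

End LinearGroupoid.

(** The source map is a smooth left inverse of the unit section, and its tangent map one of the
    tangent map. *)
Lemma idt_embedding (R : realType) k m (Gam : manifold R k) (Gam0 : manifold R m)
    (G : lie_groupoid Gam Gam0) : embedding (idt G).
Proof.
split; first exact: idt_smooth.
- move=> x; apply/row_freeP; exists (tangent (src G) (idt G x)).
  by apply/row_matrixP => i; rewrite row_mul row1 rowE; exact: tangent_src_idt.
- by move=> x y H; rewrite -(src_idt G x) H src_idt.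
move=> U Uo; exists (src G @^-1` U).
  by have [[/continuousP sc _] _] := src_submersion G; exact: sc.
by apply/funext => x; rewrite /preimage /= src_idt.
Qed.

(** * From identities at points back to the groupoid *)

Section ContactGroupoidStructure.
Context (R : realType) (n m : nat) (Gam : manifold R (2 * n).+1) (Gam0 : manifold R m).
Context (G : lie_groupoid Gam Gam0).
Context (theta : field1 Gam) (omega : field2 Gam) (r : Gam -> R).
Context (Lam : field2 Gam) (E : vec_field Gam).
Context (hG : twisted_contact_groupoid G theta omega r).
Context (hJ : contact_jacobi theta omega Lam E).
Implicit Types (g h : Gam) (x : Gam0).

Let Om g := d1 theta g + omega g.

Lemma contact_linear_groupoid :
  linear_groupoid (src G) (tgt G) (idt G) (invg G) (gmul G) (tangent_mul G)
    (tangent (src G)) (tangent (tgt G)) (tangent (invg G)) (tangent (idt G))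
    theta (d0 r) Om Lam E r.
Proof.
split.
- exact (groupoid_contact_point hG hJ).
- exact (src_idt G).
- exact (tgt_idt G).
- exact (@src_mul _ _ _ _ _ G).
- exact (@tgt_mul _ _ _ _ _ G).
- exact (mul_idt_l G).
- exact (mul_idt_r G).
- exact (invg_idt G).
- exact (@tangent_mul_src _ _ _ _ _ G).
- exact (@tangent_mul_tgt _ _ _ _ _ G).
- exact (@tangent_mul_surj _ _ _ _ _ G).
- exact (@tangent_mul_idt_r _ _ _ _ _ G).
- exact (@tangent_src_idt _ _ _ _ _ G).
- exact (@tangent_tgt_idt _ _ _ _ _ G).
- exact (@tangent_src_inv _ _ _ _ _ G).
- exact (@tangent_inv_surj _ _ _ _ _ G).
- exact (@theta_mul _ _ _ _ _ G theta omega r hG).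
- exact (@dr_mul _ _ _ _ _ G theta omega r Lam E hG hJ).
- exact (@Om_mul _ _ _ _ _ G theta omega r Lam E hG hJ).
- exact (@theta_idt _ _ _ _ _ G theta omega r hG).
- exact (@dr_idt _ _ _ _ _ G theta omega r Lam E hG hJ).
- exact (@Om_idt _ _ _ _ _ G theta omega r Lam E hG hJ).
- exact (@theta_inv _ _ _ _ _ G theta omega r hG).
- exact (@dr_inv _ _ _ _ _ G theta omega r Lam E hG hJ).
- exact (@Om_inv _ _ _ _ _ G theta omega r Lam E hG hJ).
- exact (@r_mul _ _ _ _ _ G theta omega r Lam E hG hJ).
- exact (@r_idt _ _ _ _ _ G theta omega r Lam E hG hJ).
Qed.

Let lg := contact_linear_groupoid.
Let ts : form1 theta := groupoid_theta_form1 hG.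
Let ws : form2 omega := groupoid_omega_form2 hG.
Let rs : smooth_fun r := groupoid_r_smooth hG.
Let Es : vector_field E. Proof. by case: hJ. Qed.
Let E0 x := E (idt G x).

Lemma idt_legendrian : legendrian theta (idt G).
Proof.
split; first exact: idt_embedding.
  have [x _] := manifold_nonempty Gam0; exact: base_dim lg x.
move=> x; apply: pair1_injl => u; rewrite pair1_0l /pull1 pair1_mulmx.
exact: theta_idt hG x u.
Qed.

Lemma reeb_left_invariant : left_invariant G E.
Proof. by split; [exact: Es|exact: reeb_tgt lg|exact: reeb_left lg]. Qed.

Lemma reeb_section : algebroid_section G E0.
Proof.
by split; [exact: smooth_along_comp (idt_smooth G) Es|move=> x; exact: reeb_tgt lg _].
Qed.

Lemma reeb_left_field g : E g = left_field G E0 g.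
Proof.
have c : src G g = tgt G (idt G (src G g)) by rewrite tgt_idt.
by have := reeb_left lg c; rewrite mul_idt_r => <-.
Qed.

Let sa : smooth_fun (fun g => expR (- r g)) := smooth_fun_exp (smooth_funN rs).

Let d0_expN g : d0 (fun q => expR (- r q)) g = - (expR (- r g) *: d0 r g).
Proof. by rewrite (d0_exp g (smooth_funN rs)) (d0N g rs) scalerN. Qed.

Let Ti g := tangent (invg G) g.

Lemma inv_bivector g :
  Lam (invg G g) = (Ti g)^T *m (- expR (- r g) *: Lam g) *m Ti g.
Proof.
apply/row_matrixP => i; rewrite !rowE.
have := inv_sharp lg g (delta_mx i 0).
rewrite /sharp trmx_mul trmx_delta => ->.
by rewrite -/(Ti g) -scalemxAl -[in RHS]scalemxAr -!scalemxAl -scalemxAr !mulmxA.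
Qed.

Lemma inv_vector g : E (invg G g) =
  conformal_vector (fun g => - expR (- r g)) Lam E g *m Ti g.
Proof.
rewrite /conformal_vector (d0N g sa) d0_expN opprK sharpZr.
have := sharp_rho lg g; have := inv_reeb lg g.
have := expRD (- r g) (r g); rewrite addNr expR0.
move: (right_reeb _ _ _ _ _ g) => Er e -> ->.
rewrite scalerBr scalerA -e scale1r addrAC scaleNr subrr add0r.
by rewrite mulNmx.
Qed.

Let inv_omega g : - expR (r g) *: omega g = pull2 (invg G) omega g.
Proof.
apply: eval2_inj => u v; rewrite eval2Z.
rewrite /pull2 eval2_conj; exact: esym (omega_inv hG hJ g u v).
Qed.

Lemma inv_conformal : conformal_twisted_jacobi_map (fun g => - expR (- r g))
  Lam E omega Lam E omega (invg G).
Proof.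
have tJ := contact_twisted_jacobi ts ws hJ.
have sb : smooth_fun (fun g => - expR (r g)) := smooth_funN (smooth_fun_exp rs).
have ab g : - expR (- r g) * - expR (r g) = 1 by rewrite mulrNN -expRD addNr expR0.
have a0 g : - expR (- r g) != 0 by rewrite oppr_eq0 gt_eqF // expR_gt0.
have wE : conformal_form (fun g => - expR (- r g)) omega = fun g => - expR (r g) *: omega g.
  apply/funext => g; congr (_ *: _).
  by apply: (mulfI (a0 g)); rewrite ab divff.
split; [exact: smooth_funN sa|exact: a0|exact: tJ|split].
(* The changed structure is that of the contact data multiplied by 1/a = - e^r, whose 1-form is
   iota^*theta. *)
- rewrite wE; apply: contact_twisted_jacobi.
  + exact: form1Z sb ts.
  + exact: form2Z sb ws.
  + exact: conformal_contact ts ws hJ (smooth_funN sa) sb ab.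
- exact: tJ.
- exact: invg_smooth.
by split; [exact: inv_bivector|exact: inv_vector|rewrite wE; exact: inv_omega].
Qed.

Section Fields.
Context (Y : vec_field Gam) (Ys : vector_field Y).

(** The covectors of the pointwise converse, written as the pull-back of a contraction; in this form
    their smooth dependence on the unit is visible. *)
Let zeta0 x : 'cV[R]_m := - pull1 (idt G) (fun g => Defs.contract (Y g) (Om g)) x.
Let f0 x := pair1 (theta (idt G x)) (Y (idt G x)).

Let zeta0_form : form1 zeta0.
Proof.
apply/form1N/(form1_pull1 (idt_smooth G))/form1_contract => //.
exact: form2D (form2_d1 ts) ws.
Qed.

Let f0_smooth : smooth_fun f0.
Proof. exact: (smooth_fun_comp (idt_smooth G) (smooth_fun_pair1 ts Ys)). Qed.

Lemma left_invariantP : left_invariant G Y <->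
  exists (zeta0 : field1 Gam0) (f0 : Gam0 -> R), [/\ form1 zeta0, smooth_fun f0
    & forall g, Y g = sharp (Lam g) (pull1 (src G) zeta0 g)
      + f0 (src G g) *: left_field G E0 g].
Proof.
split=> [[_ Yt Yl]|[z [f [zs fs YE]]]].
  exists zeta0, f0; split=> // g; rewrite -reeb_left_field.
  exact (left_converse lg g Yt Yl).
have {}YE g : Y g = sharp (Lam g) (tangent (src G) g *m z (src G g)) + f (src G g) *: E g.
  by rewrite YE reeb_left_field.
split=> // [g|g h gh]; first by rewrite YE; exact (left_form_tgt lg z f g).
by rewrite !YE; exact (left_form_invariant lg z f gh).
Qed.

Lemma right_invariantP : right_invariant G Y <->
  exists (zeta0 : field1 Gam0) (f0 : Gam0 -> R), [/\ form1 zeta0, smooth_fun f0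
    & forall g, Y g = expR (- r g) *: sharp (Lam g) (pull1 (tgt G) zeta0 g)
      + f0 (tgt G g) *: right_field G E0 g].
Proof.
split=> [[_ Yt Yl]|[z [f [zs fs YE]]]].
  by exists zeta0, f0; split=> // g; exact (right_converse lg g Yt Yl).
split=> // [g|g h gh]; first by rewrite YE; exact (right_form_src lg z f g).
by rewrite !YE; exact (right_form_invariant lg z f gh).
Qed.

End Fields.

Lemma src_tgt_bracket (f0 g0 : Gam0 -> R) g : smooth_fun f0 -> smooth_fun g0 ->
  jacobi_bracket Lam E (fun q => f0 (src G q)) (fun q => expR (- r q) * g0 (tgt G q)) g = 0.
Proof.
move=> fs gs; have [[ssm _] [tsm _]] := (src_submersion G, tgt_submersion G).
rewrite /jacobi_bracket (d0M g sa (smooth_fun_comp tsm gs)) d0_expN.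
rewrite (d0_comp g ssm fs) (d0_comp g tsm gs).
exact (sharp_src_tgt_bracket lg g (d0 f0 (src G g)) (d0 g0 (tgt G g)) _ _).
Qed.

End ContactGroupoidStructure.

Theorem proposition3p2 (R : realType) (n m : nat)
    (Gam : manifold R (2 * n).+1) (Gam0 : manifold R m)
    (G : lie_groupoid Gam Gam0)
    (theta : field1 Gam) (omega : field2 Gam) (r : Gam -> R)
    (Lam : field2 Gam) (E : vec_field Gam)
    (hG : twisted_contact_groupoid G theta omega r)
    (hJ : contact_jacobi theta omega Lam E) :
  (* E0 is the section of the Lie algebroid corresponding to E *)
  let E0 : Gam0 -> 'rV[R]_((2 * n).+1) := fun x => E (idt G x) in
  let El := left_field G E0 in
  let Er := right_field G E0 in
  [/\ [/\ forall g h, src G g = tgt G h -> r (gmul G g h) = r g + r h,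
          forall x, r (idt G x) = 0
        & forall g, r (invg G g) = - r g],
      forall g, pull1 (invg G) theta g = - expR (r g) *: theta g,
      legendrian theta (idt G)
    & left_invariant G E /\ forall g, pair1 (d0 r g) (E g) = 0] /\
  [/\ [/\ algebroid_section G E0, forall g, E g = El g
        & forall g, sharp (Lam g) (d0 r g) = El g - expR (r g) *: Er g],
      conformal_twisted_jacobi_map (fun g => - expR (- r g))
        Lam E omega Lam E omega (invg G),
      forall Y : vec_field Gam, vector_field Y ->
        (left_invariant G Y <->
         exists (zeta0 : field1 Gam0) (f0 : Gam0 -> R),
           [/\ form1 zeta0, smooth_fun f0
             & forall g, Y g = sharp (Lam g) (pull1 (src G) zeta0 g)
                               + f0 (src G g) *: El g]) /\
        (right_invariant G Y <->
         exists (zeta0 : field1 Gam0) (f0 : Gam0 -> R),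
           [/\ form1 zeta0, smooth_fun f0
             & forall g, Y g = expR (- r g)
                                 *: sharp (Lam g) (pull1 (tgt G) zeta0 g)
                               + f0 (tgt G g) *: Er g])
    & forall f0 g0 : Gam0 -> R, smooth_fun f0 -> smooth_fun g0 ->
        forall g, jacobi_bracket Lam E (fun x => f0 (src G x))
          (fun x => expR (- r x) * g0 (tgt G x)) g = 0].
Proof.
move=> E0 El Er; split.
  split.
  - by split; [exact: r_mul hG hJ|exact: r_idt hG hJ|exact: r_inv hG hJ].
  - exact: pull1_inv hG.
  - exact: idt_legendrian hG hJ.
  - by split; [exact: reeb_left_invariant hG hJ|exact: reeb_r (contact_linear_groupoid hG hJ)].
split.
- split; [exact: reeb_section hG hJ|exact: reeb_left_field hG hJ|].
  move=> g; have <- : E g = El g := reeb_left_field hG hJ g.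
  exact (sharp_rho (contact_linear_groupoid hG hJ) g).
- exact: inv_conformal hG hJ.
- move=> Y Ys; split; [exact (left_invariantP hG hJ Ys)|exact (right_invariantP hG hJ Ys)].
- by move=> f0 g0 fs gs g; exact (src_tgt_bracket hG hJ g fs gs).
Qed.
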